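(* Let $0<r_1<r_2<\infty$ and $A=\{\zeta\in\mathbb{C}\colon r_1\le|\zeta|\le r_2\}$. Let $f\colon A\to\mathbb{C}$ be a Hölder continuous function such that $$\frac{1}{2\pi}\int_0^{2\pi} f(a+\rho e^{i\theta})\,d\theta=0$$ for every circle $b\Delta(a,\rho)\subset A$ ($a\in\mathbb{C}$, $\rho>0$) which surrounds the origin. Then $f=f^++f^-$ where $f^+$ and $f^-$ are Hölder continuous functions on $A$ such that for each circle $b\Delta(a,\rho)\subset A$ which surrounds the origin: (i) $f^+|b\Delta(a,\rho)$ has a continuous extension to $\overline{\Delta}(a,\rho)$ which is holomorphic on $\Delta(a,\rho)$; and (ii) $f^-|b\Delta(a,\rho)$ has a continuous extension to $[\mathbb{C}\cup\{\infty\}]\setminus\Delta(a,\rho)$ which is holomorphic on $[\mathbb{C}\cup\{\infty\}]\setminus\overline{\Delta}(a,\rho)$ and vanishes at $\infty$.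
   Context: For $a\in\mathbb{C}$ and $\rho>0$, $\Delta(a,\rho)=\{\zeta\in\mathbb{C}\colon|\zeta-a|<\rho\}$, $\overline{\Delta}(a,\rho)$ is its closure and $b\Delta(a,\rho)$ is its boundary circle. A circle $b\Delta(a,\rho)\subset A$ surrounds the origin if $0\in\Delta(a,\rho)$, i.e. $|a|<\rho$. A function $f$ on a set $K\subset\mathbb{C}$ is Hölder continuous on $K$ if there are constants $M<\infty$ and $\alpha$, $0<\alpha<1$, such that $|f(z)-f(w)|\le M|z-w|^\alpha$ for all $z,w\in K$; the exponent $\alpha$ is allowed to depend on the function. All functions are complex-valued. $\mathbb{C}\cup\{\infty\}$ is the Riemann sphere. *)

(* Defs.v *)
From Stdlib Require Import Reals.
From Coquelicot Require Import Coquelicot.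

Set Implicit Arguments.

Local Open Scope R_scope.

Definition annulus (r1 r2 : R) (z : C) : Prop := r1 <= Cmod z <= r2.

Definition disc (a : C) (rho : R) (z : C) : Prop := Cmod (z - a)%C < rho.

Definition closed_disc (a : C) (rho : R) (z : C) : Prop := Cmod (z - a)%C <= rho.

Definition circle (a : C) (rho : R) (z : C) : Prop := Cmod (z - a)%C = rho.

Definition circle_around_0_in (A : C -> Prop) (a : C) (rho : R) : Prop :=
  0 < rho /\ (forall z : C, circle a rho z -> A z) /\ disc a rho (RtoC 0).

(* The case z = w is excluded only because Rpower 0 alpha is not 0. *)
Definition holder_on (K : C -> Prop) (f : C -> C) : Prop :=
  exists M alpha : R, 0 < alpha < 1 /\
    forall z w : C, K z -> K w -> z <> w ->
      Cmod (f z - f w)%C <= M * Rpower (Cmod (z - w)%C) alpha.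

Definition cis (theta : R) : C := (cos theta, sin theta).

Definition circle_mean (f : C -> C) (a : C) (rho : R) : C :=
  (RtoC (/ (2 * PI)) *
   RInt (V := C_R_CompleteNormedModule)
     (fun theta : R => f (a + RtoC rho * cis theta)%C) 0 (2 * PI))%C.

Definition holomorphic_on (D : C -> Prop) (g : C -> C) : Prop :=
  forall z : C, D z -> ex_derive (K := C_AbsRing) (V := C_NormedModule) g z.

Definition disc_extension (h : C -> C) (a : C) (rho : R) (g : C -> C) : Prop :=
  (forall z : C, circle a rho z -> g z = h z) /\
  continuous_on (T := C_UniformSpace) (U := C_UniformSpace) (closed_disc a rho) g /\
  holomorphic_on (disc a rho) g.

Inductive sphere : Type :=
  | Fin : C -> sphere
  | Infty : sphere.

(* One-point compactification: neighbourhoods of Infty contain Infty and the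
   complement of some large disc. *)
Definition sphere_locally (p : sphere) (P : sphere -> Prop) : Prop :=
  match p with
  | Fin z => locally (T := C_UniformSpace) z (fun w : C => P (Fin w))
  | Infty => P Infty /\ exists M : R, forall w : C, M < Cmod w -> P (Fin w)
  end.

Definition sphere_continuous_on (K : sphere -> Prop) (g : sphere -> C) : Prop :=
  forall p : sphere, K p ->
    filterlim g (within K (sphere_locally p)) (locally (T := C_UniformSpace) (g p)).

(* The inverse of the chart p |-> 1 / p at Infty. *)
Definition sphere_inv (w : C) : sphere :=
  if Ceq_dec w (RtoC 0) then Infty else Fin (/ w)%C.

Definition sphere_holomorphic_on (D : sphere -> Prop) (g : sphere -> C) : Prop :=
  forall p : sphere, D p ->
    match p with
    | Fin z =>
        ex_derive (K := C_AbsRing) (V := C_NormedModule) (fun w : C => g (Fin w)) z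
    | Infty =>
        ex_derive (K := C_AbsRing) (V := C_NormedModule)
          (fun w : C => g (sphere_inv w)) (RtoC 0)
    end.

Definition sphere_minus (D : C -> Prop) (p : sphere) : Prop :=
  match p with
  | Fin z => ~ D z
  | Infty => True
  end.

Definition exterior_extension (h : C -> C) (a : C) (rho : R) (g : sphere -> C) : Prop :=
  (forall z : C, circle a rho z -> g (Fin z) = h z) /\
  sphere_continuous_on (sphere_minus (disc a rho)) g /\
  sphere_holomorphic_on (sphere_minus (closed_disc a rho)) g /\
  g Infty = RtoC 0.

(* Main.v *)
Require Import Defs.
From Stdlib Require Import Reals Lra Lia ssreflect.
From Coquelicot Require Import Coquelicot.

(** The Cauchy transform [C_s f (z) = avg_t (f (z e^it) / (1 - s e^-it))], for
    [0 <= s < 1], is the sum over [n >= 0] of [s^n f_n], where [f_n] is the component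
    of [f] of angular frequency [n], that is [f_n (z e^iu) = e^inu f_n (z)].  For a
    Hoelder continuous [f] it converges, as [s] tends to 1, at the rate
    [(1 - s)^(alpha / 2)] uniformly on the annulus ([kernel_dom], [analytic_part_tail]);
    the limit [f^+] is again Hoelder continuous, with a smaller exponent
    ([analytic_part_hol]).  The frequency 0 of [f] is a mean over a circle centred at
    the origin, hence vanishes, so that [f = f^+ + conj ((conj f)^+)]
    ([decomposition]).  The hypotheses being invariant under conjugation, only
    [f^+] has to be studied: the assertion on [f^- = conj ((conj f)^+)] follows by
    reflection in the circle ([extension_outside]), provided the extension of
    [(conj f)^+] into the disc vanishes at the centre.

    So everything reduces to the vanishing, for all [k >= 0] and all admissible
    circles, of the moments [avg_t (f^+ (a + rho e^it) e^ikt)]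
    ([analytic_part_mom]).  The moments with [k >= 1] are the negative Fourier
    coefficients of the restriction to the circle; when they vanish, the Cauchy
    integral coincides with the Poisson integral, so it is both holomorphic inside
    and continuous up to the circle ([extension_into_disc]).  The moment with [k = 0]
    is the value at the centre.

    By uniform convergence it suffices to treat the moments of each [f_n], [n >= 0].
    Rotations permute the admissible circles, so [f_n] has vanishing means too, and by
    the pure frequency of [f_n] the centre of the circle can be taken to be a real number [x].  Write
    [f_n (z) = v (|z|^2) z^n] and let [M_k (x, r)] be the [k]-th moment on the circle of
    centre [x] and radius [r].  Suppose that [v] is continuously differentiable and that
    [M_(k-1)] vanishes identically.  Differentiating [f_n (x + r e^it)] in [r] and in [t]
    shows that the derivative of [f_n] in [z] has zero [k]-th moment; as the
    rotation field acts on [f_n] by multiplication by [n], the derivative of [M_k] in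
    [x] then satisfies [x M_k' = - (n + k) M_k].  Thus [x^(n+k) M_k] is constant, and it
    vanishes at [x = 0] ([mom_zero_succ]).  Induction starts from [M_0 = 0], the
    hypothesis.  If [v] is only continuous, the averages of its dilates over a
    short interval are continuously differentiable, and shrinking the interval
    recovers [v] ([mom_zero_cont]). *)

Local Open Scope R_scope.

Notation CV := C_R_CompleteNormedModule.
Notation R2 := (prod_UniformSpace R_UniformSpace R_UniformSpace).

(** * Continuity of complex expressions *)

Definition ccont {T : UniformSpace} (g : T -> C) (x : T) : Prop :=
  continuous (T := T) (U := C_UniformSpace) g x.

Definition rcont {T : UniformSpace} (g : T -> R) (x : T) : Prop :=
  continuous (T := T) (U := R_UniformSpace) g x.

Section Continuity.
Context {T : UniformSpace}.
Implicit Types (x : T).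

Lemma ccont_fst (g : T -> C) x : ccont g x -> rcont (fun y => fst (g y)) x.
Proof.
  move=> H; apply: (continuous_comp (V := R2) (W := R_UniformSpace) g fst x H).
  exact: (continuous_fst (U := R_UniformSpace) (V := R_UniformSpace)).
Qed.

Lemma ccont_snd (g : T -> C) x : ccont g x -> rcont (fun y => snd (g y)) x.
Proof.
  move=> H; apply: (continuous_comp (V := R2) (W := R_UniformSpace) g snd x H).
  exact: (continuous_snd (U := R_UniformSpace) (V := R_UniformSpace)).
Qed.

Lemma ccont_pair (g h : T -> R) x :
  rcont g x -> rcont h x -> ccont (fun y => (g y, h y) : C) x.
Proof.
  move=> Hg Hh P [eps HP].
  have A := Hg _ (locally_ball (g x) eps).
  have B := Hh _ (locally_ball (h x) eps).
  have AB : locally x (fun y => ball (g x) eps (g y) /\ ball (h x) eps (h y))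
    by apply filter_and.
  rewrite /filtermap; move: AB; apply filter_imp => y [H1 H2]; apply: HP; split => //.
Qed.

Lemma rcont_const (c : R) x : rcont (fun _ => c) x.
Proof. exact: filterlim_const. Qed.
Lemma rcont_plus (f g : T -> R) x : rcont f x -> rcont g x -> rcont (fun y => f y + g y) x.
Proof. apply: (continuous_plus (V := R_NormedModule)). Qed.
Lemma rcont_opp (f : T -> R) x : rcont f x -> rcont (fun y => - f y) x.
Proof. apply: (continuous_opp (V := R_NormedModule)). Qed.
Lemma rcont_minus (f g : T -> R) x : rcont f x -> rcont g x -> rcont (fun y => f y - g y) x.
Proof. apply: (continuous_minus (V := R_NormedModule)). Qed.
Lemma rcont_mult (f g : T -> R) x : rcont f x -> rcont g x -> rcont (fun y => f y * g y) x.
Proof. apply: (continuous_mult (K := R_AbsRing)). Qed.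
Lemma rcont_comp (h : R -> R) (f : T -> R) x :
  rcont h (f x) -> rcont f x -> rcont (fun y => h (f y)) x.
Proof. move=> H1 H2; exact: (continuous_comp f h x). Qed.
Lemma ccont_comp (h : R -> C) (f : T -> R) x :
  ccont h (f x) -> rcont f x -> ccont (fun y => h (f y)) x.
Proof. move=> H1 H2; exact: (continuous_comp f h x). Qed.
Lemma rcont_cos (f : T -> R) x : rcont f x -> rcont (fun y => cos (f y)) x.
Proof. apply: rcont_comp; exact: continuous_cos. Qed.
Lemma rcont_sin (f : T -> R) x : rcont f x -> rcont (fun y => sin (f y)) x.
Proof. apply: rcont_comp; exact: continuous_sin. Qed.
Lemma rcont_inv (f : T -> R) x : f x <> 0 -> rcont f x -> rcont (fun y => / f y) x.
Proof. move=> H; apply: (rcont_comp Rinv); exact: continuous_Rinv. Qed.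
Lemma rcont_pow (f : T -> R) n x : rcont f x -> rcont (fun y => f y ^ n) x.
Proof.
  move=> H; elim: n => [|n IH] /=; [exact: rcont_const | exact: rcont_mult].
Qed.
Lemma rcont_ext (f g : T -> R) x : (forall y, f y = g y) -> rcont f x -> rcont g x.
Proof. move=> E; exact: continuous_ext. Qed.
Lemma ccont_ext (f g : T -> C) x : (forall y, f y = g y) -> ccont f x -> ccont g x.
Proof. move=> E; exact: continuous_ext. Qed.

Lemma ccont_RtoC (f : T -> R) x : rcont f x -> ccont (fun y => RtoC (f y)) x.
Proof. move=> H; apply: ccont_pair => //; exact: rcont_const. Qed.
Lemma ccont_const (c : C) x : ccont (fun _ => c) x.
Proof. exact: filterlim_const. Qed.
Lemma ccont_cis (f : T -> R) x : rcont f x -> ccont (fun y => cis (f y)) x.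
Proof. move=> H; apply: ccont_pair; [exact: rcont_cos | exact: rcont_sin]. Qed.
Lemma ccont_plus (f g : T -> C) x : ccont f x -> ccont g x -> ccont (fun y => f y + g y)%C x.
Proof.
  move=> Hf Hg; apply: ccont_pair; apply: rcont_plus;
  first [exact: ccont_fst | exact: ccont_snd].
Qed.
Lemma ccont_opp (f : T -> C) x : ccont f x -> ccont (fun y => - f y)%C x.
Proof.
  move=> Hf; apply: ccont_pair; apply: rcont_opp;
  first [exact: ccont_fst | exact: ccont_snd].
Qed.
Lemma ccont_conj (f : T -> C) x : ccont f x -> ccont (fun y => Cconj (f y)) x.
Proof.
  move=> Hf; apply: ccont_pair; first exact: ccont_fst.
  apply: rcont_opp; exact: ccont_snd.
Qed.
Lemma ccont_minus (f g : T -> C) x : ccont f x -> ccont g x -> ccont (fun y => f y - g y)%C x.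
Proof. move=> Hf Hg; apply: ccont_plus => //; exact: ccont_opp. Qed.
Lemma ccont_mult (f g : T -> C) x : ccont f x -> ccont g x -> ccont (fun y => f y * g y)%C x.
Proof.
  move=> Hf Hg.
  have [A B] := (ccont_fst _ _ Hf, ccont_snd _ _ Hf).
  have [A' B'] := (ccont_fst _ _ Hg, ccont_snd _ _ Hg).
  apply: ccont_pair.
  - apply: rcont_minus; exact: rcont_mult.
  - apply: rcont_plus; exact: rcont_mult.
Qed.
Lemma ccont_pow (f : T -> C) n x : ccont f x -> ccont (fun y => f y ^ n)%C x.
Proof.
  move=> H; elim: n => [|n IH] /=; [exact: ccont_const | exact: ccont_mult].
Qed.
Lemma ccont_inv (f : T -> C) x : f x <> RtoC 0 -> ccont f x -> ccont (fun y => / f y)%C x.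
Proof.
  move=> H Hf.
  have [A B] := (ccont_fst _ _ Hf, ccont_snd _ _ Hf).
  have Hn : fst (f x) ^ 2 + snd (f x) ^ 2 <> 0.
  { move=> E; apply: H. case: (f x) E => [u v] /= E.
    have [-> ->] : u = 0 /\ v = 0 by split; nra. by []. }
  have D : rcont (fun y => / (fst (f y) ^ 2 + snd (f y) ^ 2)) x.
  { apply: rcont_inv => //; apply: rcont_plus; exact: rcont_pow. }
  apply: ccont_pair; apply: rcont_mult => //; exact: rcont_opp.
Qed.
Lemma rcont_Cmod (f : T -> C) x : ccont f x -> rcont (fun y => Cmod (f y)) x.
Proof.
  move=> Hf; apply: (rcont_comp sqrt); first exact: continuous_sqrt.
  apply: rcont_plus; apply: rcont_pow; first [exact: ccont_fst | exact: ccont_snd].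
Qed.
End Continuity.

Lemma rcont_id (x : R) : rcont (fun y : R => y) x.
Proof. exact: continuous_id. Qed.
Lemma rcont_pfst (p : R * R) : rcont (T := prod_UniformSpace R_UniformSpace R_UniformSpace) (fun q => fst q) p.
Proof. exact: continuous_fst. Qed.
Lemma rcont_psnd (p : R * R) : rcont (T := prod_UniformSpace R_UniformSpace R_UniformSpace) (fun q => snd q) p.
Proof. exact: continuous_snd. Qed.

(** The continuity lemmas are applied according to the head of the expression. *)
Ltac cont_step :=
  match goal with
  | |- forall _, _ => intro
  | |- ccont (fun _ => ?c) _ => exact: ccont_const
  | |- rcont (fun _ => ?c) _ => exact: rcont_const
  | |- ccont (fun _ => RtoC _) _ => apply: ccont_RtoC
  | |- ccont (fun _ => Cplus _ _) _ => apply: ccont_plus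
  | |- ccont (fun _ => Cminus _ _) _ => apply: ccont_minus
  | |- ccont (fun _ => Copp _) _ => apply: ccont_opp
  | |- ccont (fun _ => Cmult _ _) _ => apply: ccont_mult
  | |- ccont (fun _ => Cpow _ _) _ => apply: ccont_pow
  | |- ccont (fun _ => Cconj _) _ => apply: ccont_conj
  | |- ccont (fun _ => cis _) _ => apply: ccont_cis
  | |- ccont cis ?x => apply: (ccont_cis (fun y => y) x)
  | |- ccont RtoC ?x => apply: (ccont_RtoC (fun y => y) x)
  | |- ccont (fun _ => Cinv _) _ => apply: ccont_inv
  | |- ccont (fun _ => Cdiv _ _) _ => apply: ccont_mult
  | |- rcont (fun _ => Rplus _ _) _ => apply: rcont_plus
  | |- rcont (fun _ => Rminus _ _) _ => apply: rcont_minus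
  | |- rcont (fun _ => Ropp _) _ => apply: rcont_opp
  | |- rcont (fun _ => Rmult _ _) _ => apply: rcont_mult
  | |- rcont (fun _ => pow _ _) _ => apply: rcont_pow
  | |- rcont (fun _ => cos _) _ => apply: rcont_cos
  | |- rcont (fun _ => sin _) _ => apply: rcont_sin
  | |- rcont (fun _ => Cmod _) _ => apply: rcont_Cmod
  | |- rcont (fun _ => Rinv _) _ => apply: rcont_inv
  | |- rcont (fun _ => Rdiv _ _) _ => apply: rcont_mult
  | |- rcont (fun x => x) _ => exact: rcont_id
  | |- rcont (fun x => fst x) _ => exact: rcont_pfst
  | |- rcont (fun x => snd x) _ => exact: rcont_psnd
  (* unification leaves the innermost functions eta-reduced *)
  | |- rcont fst _ => exact: rcont_pfst
  | |- rcont (Rmult ?a) ?x => apply: (rcont_mult (fun _ => a) (fun y => y) x)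
  | |- rcont (Rplus ?a) ?x => apply: (rcont_plus (fun _ => a) (fun y => y) x)
  | |- rcont cos ?x => apply: (rcont_cos (fun y => y) x)
  | |- rcont sin ?x => apply: (rcont_sin (fun y => y) x)
  | |- rcont Rinv ?x => apply: (rcont_inv (fun y => y) x)
  | |- rcont Ropp ?x => apply: (rcont_opp (fun y => y) x)
  | |- rcont snd _ => exact: rcont_psnd
  | |- _ => assumption
  | H : forall x, ccont ?g x |- ccont ?g _ => exact: H
  | H : forall x, rcont ?g x |- rcont ?g _ => exact: H
  | H : forall x, ccont ?g x |- ccont (fun y => ?g _) _ => apply: (ccont_comp g); [exact: H |]
  | H : forall x, rcont ?g x |- rcont (fun y => ?g _) _ => apply: (rcont_comp g); [exact: H |]
  end.
Ltac cont := repeat cont_step.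

(** * Integrals of complex-valued functions *)

Lemma ex_RInt_C (g : R -> C) a b : (forall t, ccont g t) -> ex_RInt (V := CV) g a b.
Proof. move=> H; apply: (ex_RInt_continuous (V := CV)) => z _; exact: H. Qed.

Lemma ex_RInt_R (g : R -> R) a b : (forall t, rcont g t) -> ex_RInt g a b.
Proof. move=> H; apply: (ex_RInt_continuous (V := R_CompleteNormedModule)) => z _; exact: H. Qed.

Definition CInt (g : R -> C) (a b : R) : C := RInt (V := CV) g a b.

Lemma CInt_pair (g : R -> C) a b : (forall t, ccont g t) ->
  CInt g a b = (RInt (fun t => fst (g t)) a b, RInt (fun t => snd (g t)) a b).
Proof.
  move=> H. apply: (is_RInt_unique (V := CV)).
  apply: (is_RInt_ext (V := CV) (fun t => (fst (g t), snd (g t)))).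
  - by move=> x _; rewrite -surjective_pairing.
  - apply: (is_RInt_fct_extend_pair (U := R_NormedModule) (V := R_NormedModule)).
    + apply: (RInt_correct (V := R_CompleteNormedModule)); apply: ex_RInt_R => t; exact: (ccont_fst g t (H t)).
    + apply: (RInt_correct (V := R_CompleteNormedModule)); apply: ex_RInt_R => t; exact: (ccont_snd g t (H t)).
Qed.

Lemma CInt_ext (f g : R -> C) a b : (forall t, f t = g t) -> CInt f a b = CInt g a b.
Proof. move=> H; apply: (RInt_ext (V := CV)) => x _; exact: H. Qed.

Lemma CInt_plus (f g : R -> C) a b : (forall t, ccont f t) -> (forall t, ccont g t) ->
  CInt (fun t => f t + g t)%C a b = (CInt f a b + CInt g a b)%C.
Proof. move=> Hf Hg; apply: (RInt_plus (V := CV)); exact: ex_RInt_C. Qed.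

Lemma CInt_scal (c : C) (f : R -> C) a b : (forall t, ccont f t) ->
  CInt (fun t => c * f t)%C a b = (c * CInt f a b)%C.
Proof.
  move=> Hf. rewrite !CInt_pair //; last by cont.
  have H1 : ex_RInt (fun t => fst (f t)) a b by apply: ex_RInt_R => t; exact: (ccont_fst f t (Hf t)).
  have H2 : ex_RInt (fun t => snd (f t)) a b by apply: ex_RInt_R => t; exact: (ccont_snd f t (Hf t)).
  case: c => c1 c2; rewrite /Cmult /=; congr pair.
  - rewrite (RInt_minus (V := R_CompleteNormedModule) (fun t => c1 * fst (f t)) (fun t => c2 * snd (f t))).
    + by rewrite !(RInt_scal (V := R_CompleteNormedModule)).
    + exact: (ex_RInt_scal (V := R_NormedModule)).
    + exact: (ex_RInt_scal (V := R_NormedModule)).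
  - rewrite (RInt_plus (V := R_CompleteNormedModule) (fun t => c1 * snd (f t)) (fun t => c2 * fst (f t))).
    + by rewrite !(RInt_scal (V := R_CompleteNormedModule)).
    + exact: (ex_RInt_scal (V := R_NormedModule)).
    + exact: (ex_RInt_scal (V := R_NormedModule)).
Qed.

Lemma CInt_conj (f : R -> C) a b : (forall t, ccont f t) ->
  CInt (fun t => Cconj (f t)) a b = Cconj (CInt f a b).
Proof.
  move=> Hf. rewrite !CInt_pair //; last by cont.
  rewrite /Cconj /=; congr pair.
  apply: (RInt_opp (V := R_CompleteNormedModule)). apply: ex_RInt_R => t; exact: (ccont_snd f t (Hf t)).
Qed.

(** * Interchanging integrals *)

Lemma rcont_slice_r (G : R -> R -> R) t u :
  rcont (T := R2) (fun p => G (fst p) (snd p)) (t, u) -> rcont (fun u => G t u) u.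
Proof.
  move=> H P HP. have [d Hd] := H P HP. exists d => y Hy.
  apply: (Hd (t, y)); split => //; exact: ball_center.
Qed.

Lemma rcont_slice_l (G : R -> R -> R) t u :
  rcont (T := R2) (fun p => G (fst p) (snd p)) (t, u) -> rcont (fun t => G t u) t.
Proof.
  move=> H P HP. have [d Hd] := H P HP. exists d => y Hy.
  apply: (Hd (y, u)); split => //; exact: ball_center.
Qed.

Lemma ccont_slice_r (G : R -> R -> C) t u :
  ccont (T := R2) (fun p => G (fst p) (snd p)) (t, u) -> ccont (fun u => G t u) u.
Proof.
  move=> H P HP. have [d Hd] := H P HP. exists d => y Hy.
  apply: (Hd (t, y)); split => //; exact: ball_center.
Qed.

Lemma ccont_slice_l (G : R -> R -> C) t u :
  ccont (T := R2) (fun p => G (fst p) (snd p)) (t, u) -> ccont (fun t => G t u) t.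
Proof.
  move=> H P HP. have [d Hd] := H P HP. exists d => y Hy.
  apply: (Hd (y, u)); split => //; exact: ball_center.
Qed.

Lemma RInt_param_cont (G : R -> R -> R) c d :
  (forall p, rcont (T := R2) (fun p => G (fst p) (snd p)) p) -> c <= d ->
  forall t, rcont (fun t => RInt (fun u => G t u) c d) t.
Proof.
  move=> HG Hcd t.
  apply/filterlim_locally => eps.
  have He : 0 < eps / (d - c + 1) by apply: Rdiv_lt_0_compat; [exact: cond_pos | lra].
  have [del Hdel] := uniform_continuity_2d_1d' G c d t
    (fun x _ => proj2 (continuity_2d_pt_filterlim G t x) (HG (t, x))) (mkposreal _ He).
  exists del => v Hv.
  have Hvt : t - del <= v <= t + del.
  { move: Hv; rewrite /ball /= /AbsRing_ball /= /abs /minus /plus /opp /= => Hv.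
    have := Rabs_def2 _ _ Hv. lra. }
  have ex w : ex_RInt (fun u => G w u) c d.
  { apply: ex_RInt_R => u; apply: (rcont_slice_r G w u); exact: HG. }
  rewrite /ball /= /AbsRing_ball /= /abs /minus /plus /opp /=.
  have -> : RInt (fun u => G v u) c d + - RInt (fun u => G t u) c d =
    RInt (fun u => G v u - G t u) c d.
  { by rewrite (RInt_minus (V := R_CompleteNormedModule) (fun u => G v u) (fun u => G t u)). }
  apply: (Rle_lt_trans _ (RInt (fun _ => eps / (d - c + 1)) c d)).
  - apply: (norm_RInt_le (V := R_NormedModule) (fun u => G v u - G t u) (fun _ => eps / (d - c + 1)) c d) => //.
    + move=> x Hx. left. apply: (Hdel x t x v) => //.
      * have := cond_pos del; lra.
      * rewrite Rminus_eq_0 Rabs_R0; exact: cond_pos.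
    + apply: (RInt_correct (V := R_CompleteNormedModule)).
      exact: (ex_RInt_minus (V := R_NormedModule)).
    + apply: (RInt_correct (V := R_CompleteNormedModule)).
      exact: ex_RInt_const.
  - rewrite RInt_const /scal /= /mult /=.
    have := cond_pos eps => Hp.
    have -> : (d - c) * (eps / (d - c + 1)) = eps * ((d - c) / (d - c + 1)) by field; lra.
    have : (d - c) / (d - c + 1) < 1.
    { apply: (Rmult_lt_reg_r (d - c + 1)); first lra. field_simplify; lra. }
    nra.
Qed.

(** Both sides, as functions of the upper bound [b], have the same
    derivative. *)
Lemma RInt_swap (G : R -> R -> R) a b c d :
  (forall p, rcont (T := R2) (fun p => G (fst p) (snd p)) p) -> a <= b -> c <= d ->
  RInt (fun t => RInt (fun u => G t u) c d) a b = RInt (fun u => RInt (fun t => G t u) a b) c d.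
Proof.
  move=> HG Hab Hcd.
  pose D x := RInt (fun t => RInt (fun u => G t u) c d) a x - RInt (fun u => RInt (fun t => G t u) a x) c d.
  have exl u x : ex_RInt (fun t => G t u) a x.
  { apply: ex_RInt_R => t; apply: (rcont_slice_l G t u); exact: HG. }
  have derI u x : is_derive (fun x => RInt (fun t => G t u) a x) x (G x u).
  { apply: (is_derive_RInt (fun t => G t u) _ a).
    - exists (mkposreal 1 Rlt_0_1) => y _. exact: (RInt_correct (V := R_CompleteNormedModule)).
    - apply: (rcont_slice_l G x u); exact: HG. }
  have cont_up x : a <= x -> forall u, rcont (fun u => RInt (fun t => G t u) a x) u.
  { move=> Hx u. apply: (RInt_param_cont (fun u t => G t u)) => // p.
    have := HG (snd p, fst p) => H P HP. have [e He] := H P HP. exists e => y [H1 H2].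
    by apply: (He (snd y, fst y)). }
  have exin x : ex_RInt (fun u => RInt (fun t => G t u) a x) c d.
  { case: (Rle_dec a x) => Hx; first by apply: ex_RInt_R; exact: cont_up.
    apply: (ex_RInt_ext (fun u => - RInt (fun t => G t u) x a)).
    - move=> u _. apply: (opp_RInt_swap (V := R_CompleteNormedModule) (fun t => G t u)).
      apply: ex_RInt_R => t; apply: (rcont_slice_l G t u); exact: HG.
    - apply: (ex_RInt_opp (V := R_NormedModule)). apply: ex_RInt_R => u.
      apply: (RInt_param_cont (fun u t => G t u)) => // [p|]; last lra.
      have := HG (snd p, fst p) => H P HP. have [e He] := H P HP. exists e => y [H1 H2].
      by apply: (He (snd y, fst y)). }
  have derD x : is_derive D x 0.
  { have -> : 0 = minus (RInt (fun u => G x u) c d) (RInt (fun u => G x u) c d)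
      by rewrite minus_eq_zero.
    apply: (is_derive_minus (V := R_NormedModule)).
    - apply: (is_derive_RInt (fun t => RInt (fun u => G t u) c d) _ a).
      + exists (mkposreal 1 Rlt_0_1) => y _. apply: (RInt_correct (V := R_CompleteNormedModule)).
        apply: ex_RInt_R. exact: RInt_param_cont.
      + exact: RInt_param_cont.
    - have -> : RInt (fun u => G x u) c d =
        RInt (fun u => Derive (fun x => RInt (fun t => G t u) a x) x) c d.
      { apply: RInt_ext => u _. by rewrite (is_derive_unique _ _ _ (derI u x)). }
      apply: is_derive_RInt_param.
      + exists (mkposreal 1 Rlt_0_1) => y _ u _. eexists; exact: derI.
      + move=> u _. apply/continuity_2d_pt_filterlim.
        rewrite (is_derive_unique _ _ _ (derI u x)).
        apply: (filterlim_ext (fun p => G (fst p) (snd p))).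
        * move=> p. by rewrite (is_derive_unique _ _ _ (derI (snd p) (fst p))).
        * exact: (HG (x, u)).
      + exists (mkposreal 1 Rlt_0_1) => y _. exact: exin. }
  have : D b = D a.
  { case: (Req_dec a b) => [-> //|Hne].
    symmetry; apply: (eq_is_derive D a b); last lra.
    move=> t _; exact: derD. }
  rewrite /D !RInt_point.
  rewrite (RInt_ext (fun u => RInt (fun t => G t u) a a) (fun _ => 0)); last by move=> u _; rewrite RInt_point.
  rewrite RInt_const /scal /= /mult /= /zero /=. lra.
Qed.

Lemma ccont_CInt_param (G : R -> R -> C) c d :
  (forall p, ccont (T := R2) (fun p => G (fst p) (snd p)) p) -> c <= d ->
  forall t, ccont (fun t => CInt (fun u => G t u) c d) t.
Proof.
  move=> HG Hcd t.
  apply: (ccont_ext (fun t => (RInt (fun u => fst (G t u)) c d, RInt (fun u => snd (G t u)) c d))).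
  - move=> y; rewrite CInt_pair // => u. apply: (ccont_slice_r G y u); exact: HG.
  - apply: ccont_pair; apply: RInt_param_cont => // p; first [exact: (ccont_fst _ _ (HG p)) | exact: (ccont_snd _ _ (HG p))].
Qed.

Lemma ccont2_swap (G : R -> R -> C) :
  (forall p, ccont (T := R2) (fun p => G (fst p) (snd p)) p) ->
  (forall p, ccont (T := R2) (fun p => G (snd p) (fst p)) p).
Proof.
  move=> HG p. have := HG (snd p, fst p) => H P HP. have [e He] := H P HP. exists e => y [H1 H2].
  by apply: (He (snd y, fst y)).
Qed.

Lemma CInt_swap (G : R -> R -> C) a b c d :
  (forall p, ccont (T := R2) (fun p => G (fst p) (snd p)) p) -> a <= b -> c <= d ->
  CInt (fun t => CInt (fun u => G t u) c d) a b = CInt (fun u => CInt (fun t => G t u) a b) c d.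
Proof.
  move=> HG Hab Hcd.
  have HG' := ccont2_swap G HG.
  have L t : forall u, ccont (fun u => G t u) u by move=> u; apply: (ccont_slice_r G t u); exact: HG.
  have L' u : forall t, ccont (fun t => G t u) t by move=> t; apply: (ccont_slice_l G t u); exact: HG.
  rewrite (CInt_pair (fun t => CInt (fun u => G t u) c d)); last exact: ccont_CInt_param.
  rewrite (CInt_pair (fun u => CInt (fun t => G t u) a b)); last exact: (ccont_CInt_param (fun u t => G t u)).
  congr pair.
  - rewrite (RInt_ext _ (fun t => RInt (fun u => fst (G t u)) c d)); last by move=> t _; rewrite CInt_pair.
    rewrite [RHS](RInt_ext _ (fun u => RInt (fun t => fst (G t u)) a b)); last by move=> t _; rewrite CInt_pair.
    apply: RInt_swap => // p; exact: (ccont_fst _ _ (HG p)).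
  - rewrite (RInt_ext _ (fun t => RInt (fun u => snd (G t u)) c d)); last by move=> t _; rewrite CInt_pair.
    rewrite [RHS](RInt_ext _ (fun u => RInt (fun t => snd (G t u)) a b)); last by move=> t _; rewrite CInt_pair.
    apply: RInt_swap => // p; exact: (ccont_snd _ _ (HG p)).
Qed.

Lemma Cmod_CInt_le (f : R -> C) (g : R -> R) a b : a <= b ->
  (forall t, ccont f t) -> (forall t, rcont g t) ->
  (forall t, Cmod (f t) <= g t) -> Cmod (CInt f a b) <= RInt g a b.
Proof.
  move=> Hab Hf Hg H.
  rewrite Cmod_norm.
  apply: (norm_RInt_le (V := C_R_NormedModule) f g a b) => //.
  - move=> x _. have := H x. by rewrite Cmod_norm.
  - apply: (RInt_correct (V := CV)); exact: ex_RInt_C.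
  - apply: (RInt_correct (V := R_CompleteNormedModule)); exact: ex_RInt_R.
Qed.

(** * Averages over a period *)

(** The mean over the circle of centre [a] and radius [rho] is [avg] of the
    parametrized restriction, definitionally. *)
Definition avg (g : R -> C) : C := (RtoC (/ (2 * PI)) * CInt g 0 (2 * PI))%C.

Lemma twoPI_pos : 0 < 2 * PI.
Proof. have := PI_RGT_0; lra. Qed.

Lemma avg_ext (f g : R -> C) : (forall t, f t = g t) -> avg f = avg g.
Proof. by move=> H; rewrite /avg (CInt_ext f g). Qed.

Lemma avg_plus (f g : R -> C) : (forall t, ccont f t) -> (forall t, ccont g t) ->
  avg (fun t => f t + g t)%C = (avg f + avg g)%C.
Proof. move=> Hf Hg; rewrite /avg CInt_plus //; ring. Qed.

Lemma avg_scal c (f : R -> C) : (forall t, ccont f t) ->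
  avg (fun t => c * f t)%C = (c * avg f)%C.
Proof. move=> Hf; rewrite /avg CInt_scal //; ring. Qed.

Lemma avg_minus (f g : R -> C) : (forall t, ccont f t) -> (forall t, ccont g t) ->
  avg (fun t => f t - g t)%C = (avg f - avg g)%C.
Proof.
  move=> Hf Hg.
  rewrite (avg_ext _ (fun t => f t + RtoC (-1) * g t)%C); last by (move=> t; ring).
  rewrite avg_plus //; last by cont.
  rewrite avg_scal //; ring.
Qed.

Lemma avg_conj (f : R -> C) : (forall t, ccont f t) ->
  avg (fun t => Cconj (f t)) = Cconj (avg f).
Proof.
  move=> Hf; rewrite /avg CInt_conj // Cmult_conj; congr Cmult.
  rewrite /Cconj /RtoC /=. by rewrite Ropp_0.
Qed.

Lemma avg_const c : avg (fun _ => c) = c.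
Proof.
  rewrite /avg /CInt (RInt_const (V := CV)) scal_R_Cmult Rminus_0_r.
  have := twoPI_pos => H.
  rewrite Cmult_assoc -RtoC_mult Rinv_l; [ring | lra].
Qed.

Lemma Cmod_avg_dom (f : R -> C) (g : R -> R) :
  (forall t, ccont f t) -> (forall t, rcont g t) ->
  (forall t, Cmod (f t) <= g t) -> Cmod (avg f) <= fst (avg (fun t => RtoC (g t))).
Proof.
  move=> Hf Hg H. have P := twoPI_pos.
  have L := Cmod_CInt_le f g 0 (2 * PI) (Rlt_le _ _ P) Hf Hg H.
  rewrite /avg Cmod_mult Cmod_R (CInt_pair (fun t => RtoC (g t))); last by cont.
  rewrite /RtoC /= Rabs_pos_eq; last by left; exact: Rinv_0_lt_compat.
  have Q := Rinv_0_lt_compat _ P.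
  rewrite Rmult_0_l Rminus_0_r; exact: (Rmult_le_compat_l _ _ _ (Rlt_le _ _ Q) L).
Qed.

Lemma Cmod_avg_le (f : R -> C) B :
  (forall t, ccont f t) -> (forall t, Cmod (f t) <= B) -> Cmod (avg f) <= B.
Proof.
  move=> Hf H. have := Cmod_avg_dom f (fun _ => B) Hf (fun t => rcont_const B t) H.
  by rewrite avg_const.
Qed.

Lemma avg_swap (G : R -> R -> C) :
  (forall p, ccont (T := R2) (fun p => G (fst p) (snd p)) p) ->
  avg (fun t => avg (fun u => G t u)) = avg (fun u => avg (fun t => G t u)).
Proof.
  move=> HG. have P := Rlt_le _ _ twoPI_pos.
  rewrite /avg !CInt_scal; first by rewrite CInt_swap.
  - exact: (ccont_CInt_param (fun u t => G t u) _ _ (ccont2_swap G HG)).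
  - exact: ccont_CInt_param.
Qed.

Lemma ccont_avg_param (G : R -> R -> C) :
  (forall p, ccont (T := R2) (fun p => G (fst p) (snd p)) p) ->
  forall t, ccont (fun t => avg (fun u => G t u)) t.
Proof.
  move=> HG t. apply: ccont_mult; first exact: ccont_const.
  apply: ccont_CInt_param => //. exact: (Rlt_le _ _ twoPI_pos).
Qed.

Lemma avg_shift (g : R -> C) s : (forall t, ccont g t) -> (forall t, g (t + 2 * PI) = g t) ->
  avg (fun t => g (t + s)) = avg g.
Proof.
  move=> Hg Hp. rewrite /avg; congr Cmult.
  have sh (c a b : R) : CInt (fun t => g (t + c)) a b = CInt g (a + c) (b + c).
  { rewrite /CInt; have := RInt_comp_lin (V := CV) g 1 c a b.
    rewrite !Rmult_1_l => <-; last exact: ex_RInt_C.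
    apply: CInt_ext => t. rewrite Rmult_1_l. by rewrite (scal_one (V := CV)). }
  have chas (a b c : R) : (CInt g a b + CInt g b c)%C = CInt g a c.
  { apply: (RInt_Chasles (V := CV)); exact: ex_RInt_C. }
  rewrite sh Rplus_0_l.
  have E : CInt g (2 * PI) (2 * PI + s) = CInt g 0 s.
  { rewrite (CInt_ext g (fun t => g (t + 2 * PI)) 0 s); last by move=> t; rewrite Hp.
    rewrite sh. by rewrite Rplus_0_l (Rplus_comm s). }
  have A := chas s (2 * PI) (2 * PI + s). rewrite E in A.
  have B := chas 0 s (2 * PI).
  rewrite -A -B. apply: Cplus_comm.
Qed.

(** * The unit circle *)

Lemma cis_plus a b : cis (a + b) = (cis a * cis b)%C.
Proof. rewrite /cis /Cmult /= cos_plus sin_plus; congr pair; ring. Qed.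

Lemma cis_0 : cis 0 = RtoC 1.
Proof. by rewrite /cis cos_0 sin_0. Qed.

Lemma cis_PI : cis PI = RtoC (-1).
Proof. by rewrite /cis cos_PI sin_PI. Qed.

Lemma cis_opp a : cis (- a) = Cconj (cis a).
Proof. by rewrite /cis /Cconj cos_neg sin_neg. Qed.

Lemma cis_period t : cis (t + 2 * PI) = cis t.
Proof. rewrite cis_plus {2}/cis cos_2PI sin_2PI; exact: Cmult_1_r. Qed.

Lemma Cmod_cis t : Cmod (cis t) = 1.
Proof.
  rewrite /Cmod /cis /=. rewrite -[RHS]sqrt_1; congr sqrt.
  have := sin2_cos2 t; rewrite /Rsqr; lra.
Qed.

Lemma cis_conj_mult t : (cis t * Cconj (cis t) = RtoC 1)%C.
Proof. by rewrite -cis_opp -cis_plus Rplus_opp_r cis_0. Qed.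

Lemma cis_pow t n : (cis t ^ n)%C = cis (INR n * t).
Proof.
  elim: n => [|n IH]; first by rewrite /= Rmult_0_l cis_0.
  rewrite Cpow_S IH -cis_plus S_INR; congr cis; ring.
Qed.

Lemma polar z : exists t, z = (RtoC (Cmod z) * cis t)%C.
Proof.
  case: (Req_dec (Cmod z) 0) => H.
  { exists 0. rewrite H Cmult_0_l; exact: Cmod_eq_0. }
  have Hp : 0 < Cmod z by have := Cmod_ge_0 z; lra.
  case: z H Hp => x y H Hp. move: H Hp; set r := Cmod _ => H Hp.
  have Hr : r * r = x * x + y * y.
  { rewrite /r /Cmod /=. rewrite sqrt_sqrt; nra. }
  have Hx : -1 <= x / r <= 1.
  { have : Rabs (x / r) <= Rabs 1.
    { apply: Rsqr_le_abs_0. rewrite /Rsqr.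
      have -> : x / r * (x / r) = (x * x) / (r * r) by field.
      apply: (Rmult_le_reg_r (r * r)); first nra.
      have -> : x * x / (r * r) * (r * r) = x * x by field. nra. }
    rewrite Rabs_R1 => /Rabs_le_between. lra. }
  have S : sin (acos (x / r)) = Rabs (y / r).
  { rewrite sin_acos //. rewrite -sqrt_Rsqr_abs; congr sqrt. rewrite /Rsqr.
    apply: (Rmult_eq_reg_r (r * r)); last nra. field_simplify; [|lra|lra].
    nra. }
  have E c s : c = x / r -> s = y / r -> (x, y) = (RtoC r * (c, s))%C.
  { move=> -> ->. rewrite /Cmult /=; congr pair; field; lra. }
  case: (Rle_dec 0 y) => Hy.
  - exists (acos (x / r)). rewrite /cis. apply: E; first by rewrite cos_acos.
    rewrite S Rabs_pos_eq //. apply: Rmult_le_pos => //. left; exact: Rinv_0_lt_compat.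
  - exists (- acos (x / r)). rewrite /cis cos_neg sin_neg. apply: E; first by rewrite cos_acos.
    rewrite S Rabs_left1; first ring.
    have := Rinv_0_lt_compat _ Hp. rewrite /Rdiv; nra.
Qed.

(** Rotating by [PI / n] changes the sign of [cis t ^ n] but not its average. *)
Lemma avg_cis_pow n : (0 < n)%nat -> avg (fun t => cis t ^ n)%C = RtoC 0.
Proof.
  move=> Hn.
  have Hn' : 0 < INR n by apply: lt_0_INR.
  have E : avg (fun t => cis (t + PI / INR n) ^ n)%C = avg (fun t => cis t ^ n)%C.
  { apply: (avg_shift (fun t => cis t ^ n)%C); first by cont.
    by move=> t; rewrite cis_period. }
  rewrite (avg_ext _ (fun t => RtoC (-1) * cis t ^ n)%C) in E.
  - rewrite avg_scal in E; last by cont.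
    move: E; case: (avg _) => u v; rewrite /Cmult /RtoC /= => [[E1 E2]]. congr pair; lra.
  - move=> t. rewrite cis_plus Cpow_mult_l (cis_pow (PI / _)).
    have -> : INR n * (PI / INR n) = PI by field; lra.
    rewrite cis_PI; ring.
Qed.

(** * Differentiation in a real variable *)

(** Taken componentwise, so that differentiation under the integral sign reduces to the
    real-valued case. *)
Definition cder (g : R -> C) (x : R) (l : C) : Prop :=
  is_derive (fun y => fst (g y)) x (fst l) /\ is_derive (fun y => snd (g y)) x (snd l).

Lemma cder_ext (f g : R -> C) x l : (forall y, f y = g y) -> cder f x l -> cder g x l.
Proof. move=> E [A B]; split; [move: A | move: B]; apply: is_derive_ext => y; by rewrite E. Qed.

Lemma cder_ext_loc (f g : R -> C) x l : locally x (fun y => f y = g y) -> cder f x l -> cder g x l.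
Proof.
  move=> E [A B]; split; [move: A | move: B]; apply: is_derive_ext_loc;
  (case: E => d Hd; exists d => y Hy; by rewrite Hd).
Qed.

Lemma cder_const c x : cder (fun _ => c) x (RtoC 0).
Proof. split; exact: is_derive_const. Qed.

Lemma cder_RtoC (f : R -> R) x l : is_derive f x l -> cder (fun y => RtoC (f y)) x (RtoC l).
Proof. move=> H; split => //; exact: is_derive_const. Qed.

Lemma cder_plus (f g : R -> C) x a b : cder f x a -> cder g x b ->
  cder (fun y => f y + g y)%C x (a + b)%C.
Proof. move=> [A B] [A' B']; split; exact: (is_derive_plus (V := R_NormedModule)). Qed.

Lemma is_derive_ext_val (f : R -> R) (x a b : R) : a = b -> is_derive f x a -> is_derive f x b.
Proof. by move=> ->. Qed.

Lemma cder_mult (f g : R -> C) x a b : cder f x a -> cder g x b ->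
  cder (fun y => f y * g y)%C x (a * g x + f x * b)%C.
Proof.
  move=> [A B] [A' B']; split.
  - have := is_derive_minus (V := R_NormedModule) _ _ _ _ _
      (is_derive_mult _ _ _ _ _ A A' Rmult_comm) (is_derive_mult _ _ _ _ _ B B' Rmult_comm).
    apply: is_derive_ext_val. rewrite /minus /plus /opp /mult /=; ring.
  - have := is_derive_plus (V := R_NormedModule) _ _ _ _ _
      (is_derive_mult _ _ _ _ _ A B' Rmult_comm) (is_derive_mult _ _ _ _ _ B A' Rmult_comm).
    apply: is_derive_ext_val. rewrite /minus /plus /opp /mult /=; ring.
Qed.

Lemma cder_val (f : R -> C) x a b : a = b -> cder f x a -> cder f x b.
Proof. by move=> ->. Qed.

Lemma cder_scal c (f : R -> C) x a : cder f x a -> cder (fun y => c * f y)%C x (c * a)%C.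
Proof.
  move=> H; apply: cder_val (cder_mult _ _ _ _ _ (cder_const c x) H); ring.
Qed.

Lemma cder_pow (f : R -> C) n x a : cder f x a ->
  cder (fun y => f y ^ n)%C x (RtoC (INR n) * f x ^ (n - 1) * a)%C.
Proof.
  move=> H; elim: n => [|n IH].
  - apply: cder_val (cder_const _ x). rewrite /=; ring.
  - apply: cder_val (cder_mult _ _ _ _ _ H IH).
    rewrite S_INR RtoC_plus. have -> : (S n - 1 = n)%nat by lia.
    case: n {IH} => [|n]; first by rewrite /=; ring.
    have -> : (S n - 1 = n)%nat by lia. rewrite !Cpow_S; ring.
Qed.

Lemma cder_cis x : cder cis x (Ci * cis x)%C.
Proof.
  split => /=.
  - apply: (is_derive_ext_val _ _ _ _ _ (is_derive_cos x)). ring.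
  - apply: (is_derive_ext_val _ _ _ _ _ (is_derive_sin x)). ring.
Qed.

Lemma cder_comp (f : R -> C) (h : R -> R) x l m :
  cder f (h x) l -> is_derive h x m -> cder (fun y => f (h y)) x (RtoC m * l)%C.
Proof.
  move=> [A B] Hh; split.
  - have := is_derive_comp _ _ _ _ _ A Hh. apply: is_derive_ext_val.
    rewrite /scal /= /mult /=; ring.
  - have := is_derive_comp _ _ _ _ _ B Hh. apply: is_derive_ext_val.
    rewrite /scal /= /mult /=; ring.
Qed.

Lemma cder_unique (f : R -> C) x a b : cder f x a -> cder f x b -> a = b.
Proof.
  move=> [A B] [A' B'].
  have := is_derive_unique _ _ _ A; rewrite (is_derive_unique _ _ _ A').
  have := is_derive_unique _ _ _ B; rewrite (is_derive_unique _ _ _ B').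
  by case: a {A B} => ? ?; case: b {A' B'} => ? ? /= -> ->.
Qed.

Lemma cder_zero_const (f : R -> C) a b :
  (forall t, Rmin a b <= t <= Rmax a b -> cder f t (RtoC 0)) -> f a = f b.
Proof.
  move=> H.
  have inc (g : R -> R) u v : u <= v -> (forall t, u <= t <= v -> is_derive g t 0) -> g u = g v.
  { move=> [Huv|<-] // Hg. exact: (eq_is_derive g u v). }
  have Q (g : R -> R) : (forall t, Rmin a b <= t <= Rmax a b -> is_derive g t 0) -> g a = g b.
  { move=> Hg. case: (Rle_dec a b) => Hab.
    - apply: inc => // t Ht. apply: Hg. by rewrite Rmin_left // Rmax_right.
    - symmetry; apply: inc; first lra. move=> t Ht. apply: Hg. rewrite Rmin_right ?Rmax_left; lra. }
  rewrite (surjective_pairing (f a)) (surjective_pairing (f b)); congr pair.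
  - apply: (Q (fun t => fst (f t))) => t Ht; exact: (proj1 (H t Ht)).
  - apply: (Q (fun t => snd (f t))) => t Ht; exact: (proj2 (H t Ht)).
Qed.

Lemma cder_CInt (g : R -> C) a x : (forall t, ccont g t) -> cder (fun y => CInt g a y) x (g x).
Proof.
  move=> Hg.
  apply: (cder_ext (fun y => (RInt (fun t => fst (g t)) a y, RInt (fun t => snd (g t)) a y))).
  { move=> y; by rewrite CInt_pair. }
  split.
  - apply: (is_derive_RInt (fun t => fst (g t)) _ a).
    + exists (mkposreal 1 Rlt_0_1) => y _. apply: (RInt_correct (V := R_CompleteNormedModule)).
      apply: ex_RInt_R => t; exact: (ccont_fst g t (Hg t)).
    + exact: (ccont_fst g x (Hg x)).
  - apply: (is_derive_RInt (fun t => snd (g t)) _ a).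
    + exists (mkposreal 1 Rlt_0_1) => y _. apply: (RInt_correct (V := R_CompleteNormedModule)).
      apply: ex_RInt_R => t; exact: (ccont_snd g t (Hg t)).
    + exact: (ccont_snd g x (Hg x)).
Qed.

Lemma CInt_cder (f g : R -> C) a b : a <= b -> (forall t, cder f t (g t)) -> (forall t, ccont g t) ->
  CInt g a b = (f b - f a)%C.
Proof.
  move=> Hab Hd Hg.
  have : (fun y => f y - CInt g a y)%C a = (fun y => f y - CInt g a y)%C b.
  { apply: (cder_zero_const (fun y => f y - CInt g a y)%C a b) => t _.
    have := cder_plus _ _ _ _ _ (Hd t) (cder_scal (RtoC (-1)) _ _ _ (cder_CInt g a t Hg)).
    move=> H. apply: (cder_ext (fun y => f y + RtoC (-1) * CInt g a y)%C); first by (move=> y; ring).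
    apply: cder_val H; ring. }
  move=> /=. rewrite {1}/CInt (RInt_point (V := CV)).
  have -> : (zero : CV) = RtoC 0 by [].
  move=> E. have -> : (f a = f b - CInt g a b)%C by rewrite -E; ring. ring.
Qed.

Lemma avg_cder_periodic (f g : R -> C) : (forall t, cder f t (g t)) -> (forall t, ccont g t) ->
  (forall t, f (t + 2 * PI) = f t) -> avg g = RtoC 0.
Proof.
  move=> Hd Hg Hp. rewrite /avg (CInt_cder f g) //; last exact: (Rlt_le _ _ twoPI_pos).
  have := Hp 0. rewrite Rplus_0_l => ->. ring.
Qed.

Lemma cder_avg (G D : R -> R -> C) x0 :
  locally x0 (fun x => forall t, cder (fun y => G y t) x (D x t)) ->
  locally x0 (fun x => forall t, ccont (fun u => G x u) t) ->
  (forall t, ccont (T := R2) (fun p => D (fst p) (snd p)) (x0, t)) ->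
  cder (fun x => avg (fun t => G x t)) x0 (avg (fun t => D x0 t)).
Proof.
  move=> HG HcG HD. apply: cder_scal.
  have HD0 t : ccont (fun u => D x0 u) t by apply: ccont_slice_r; exact: HD.
  apply: (cder_ext_loc (fun x => (RInt (fun t => fst (G x t)) 0 (2 * PI), RInt (fun t => snd (G x t)) 0 (2 * PI)))).
  { case: HcG => d Hd; exists d => y Hy. by rewrite CInt_pair //; apply: Hd. }
  rewrite CInt_pair //.
  have main (pr : C -> R) : (forall c g y, cder g y c -> is_derive (fun z => pr (g z)) y (pr c)) ->
    (forall (T : UniformSpace) (g : T -> C) x, ccont g x -> rcont (fun y => pr (g y)) x) ->
    is_derive (fun x => RInt (fun t => pr (G x t)) 0 (2 * PI)) x0 (RInt (fun t => pr (D x0 t)) 0 (2 * PI)).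
  { move=> Hpd Hpc.
    have dv : locally x0 (fun x => forall t, is_derive (fun y => pr (G y t)) x (pr (D x t))).
    { case: HG => d Hd; exists d => y Hy t. exact: (Hpd _ (fun y => G y t)) (Hd y Hy t). }
    have dv0 := locally_singleton _ _ dv.
    have -> : RInt (fun t => pr (D x0 t)) 0 (2 * PI) = RInt (fun t => Derive (fun y => pr (G y t)) x0) 0 (2 * PI).
    { apply: RInt_ext => t _. by rewrite (is_derive_unique _ _ _ (dv0 t)). }
    apply: is_derive_RInt_param.
    - case: dv => d Hd; exists d => y Hy t _. eexists; exact: Hd.
    - move=> t _. apply: (continuity_2d_pt_ext_loc (fun u v => pr (D u v))).
      + case: dv => d Hd; exists d => u v Hu Hv. symmetry; apply: is_derive_unique; exact: Hd.
      + apply/continuity_2d_pt_filterlim. exact: (Hpc R2 _ (x0, t) (HD t)).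
    - case: HcG => d Hd; exists d => y Hy. apply: ex_RInt_R => t. apply: (Hpc _ (fun t => G y t)).
      exact: Hd. }
  split.
  - apply: (main fst); first by move=> c g y []. exact: @ccont_fst.
  - apply: (main snd); first by move=> c g y []. exact: @ccont_snd.
Qed.

(** * Circles centred on the real axis *)

Definition pt (x r t : R) : C := (RtoC x + RtoC r * cis t)%C.
Definition sq (x r t : R) : R := x ^ 2 + r ^ 2 + 2 * x * r * cos t.

Lemma sq_Cmod x r t : sq x r t = Cmod (pt x r t) ^ 2.
Proof.
  have [S _] : sin t * sin t + cos t * cos t = 1 /\ True by split => //; exact: sin2_cos2.
  rewrite Cmod2_alt /sq /pt /Re /Im /=.
  have E : r * r = r * r * (sin t * sin t + cos t * cos t) by rewrite S; ring.
  rewrite !Rmult_1_r E. ring.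
Qed.

Lemma pt_conj x r t : Cconj (pt x r t) = (RtoC x + RtoC r * Cconj (cis t))%C.
Proof.
  have H a : Cconj (RtoC a) = RtoC a by rewrite /Cconj /RtoC /= Ropp_0.
  by rewrite /pt Cplus_conj Cmult_conj !H.
Qed.

Lemma sq_ge x r t : Rabs x < r -> (r - Rabs x) ^ 2 <= sq x r t.
Proof.
  move=> H. rewrite /sq. have := COS_bound t => Hc. have := Rabs_pos x => Hx.
  have E : x ^ 2 = Rabs x ^ 2 by rewrite pow2_abs.
  have A : - (Rabs x * r) <= x * r * cos t.
  { have : Rabs (x * r * cos t) <= Rabs x * r.
    { rewrite !Rabs_mult (Rabs_pos_eq r); last lra.
      have : Rabs (cos t) <= 1 by apply/Rabs_le_between.
      have := Rabs_pos (cos t). have : 0 <= Rabs x * r by nra. nra. }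
    move=> /Rabs_le_between; lra. }
  nra.
Qed.

Lemma sq_pos x r t : Rabs x < r -> 0 < sq x r t.
Proof. move=> H; have := sq_ge x r t H. nra. Qed.

Lemma cos_cis t : RtoC (cos t) = ((cis t + Cconj (cis t)) / RtoC 2)%C.
Proof. by rewrite -re_alt. Qed.

(** The [k]-th moment of [v (|z|^2) * z ^ n] on the circle of real centre [x] and
    radius [r]. *)
Definition mom (v : R -> C) (n k : nat) (x r : R) : C :=
  avg (fun t => v (sq x r t) * pt x r t ^ n * cis t ^ k)%C.

Section Smooth.
Variables (v w : R -> C) (n : nat).
Hypothesis vw : forall s, 0 < s -> cder v s (w s).
Hypothesis wc : forall s, 0 < s -> ccont w s.
Hypothesis vc : forall s, 0 < s -> ccont v s.

(** The Wirtinger derivatives of [v (|z|^2) * z ^ n] with respect to [z] and to the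
    conjugate of [z], where [w] is the derivative of [v]. *)
Definition dz (x r t : R) : C :=
  (w (sq x r t) * Cconj (pt x r t) * pt x r t ^ n +
   RtoC (INR n) * v (sq x r t) * pt x r t ^ (n - 1))%C.
Definition dzbar (x r t : R) : C := (w (sq x r t) * (pt x r t * pt x r t ^ n))%C.
Definition val (x r t : R) : C := (v (sq x r t) * pt x r t ^ n)%C.

Section Cont.
Context {T : UniformSpace}.
Variables (X Y Z : T -> R) (p : T).
Hypotheses (HX : rcont X p) (HY : rcont Y p) (HZ : rcont Z p).

Lemma rcont_sq : rcont (fun q => sq (X q) (Y q) (Z q)) p.
Proof. by rewrite /sq; cont. Qed.
Lemma ccont_pt : ccont (fun q => pt (X q) (Y q) (Z q)) p.
Proof. by rewrite /pt; cont. Qed.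

Hypothesis Hp : Rabs (X p) < Y p.
Lemma ccont_dz : ccont (fun q => dz (X q) (Y q) (Z q)) p.
Proof.
  have A := rcont_sq; have B := ccont_pt. have S := sq_pos _ _ (Z p) Hp.
  rewrite /dz; cont => //; apply: (ccont_comp _ _ p _ A); [exact: wc | exact: vc].
Qed.
Lemma ccont_dzbar : ccont (fun q => dzbar (X q) (Y q) (Z q)) p.
Proof.
  have A := rcont_sq; have B := ccont_pt. have S := sq_pos _ _ (Z p) Hp.
  rewrite /dzbar; cont => //; apply: (ccont_comp _ _ p _ A); exact: wc.
Qed.
Lemma ccont_val : ccont (fun q => val (X q) (Y q) (Z q)) p.
Proof.
  have A := rcont_sq; have B := ccont_pt. have S := sq_pos _ _ (Z p) Hp.
  rewrite /val; cont => //; apply: (ccont_comp _ _ p _ A); exact: vc.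
Qed.
End Cont.

Lemma cder_chain (sg : R -> R) (zt : R -> C) y ds dzt :
  0 < sg y -> is_derive sg y ds -> cder zt y dzt ->
  cder (fun u => v (sg u) * zt u ^ n)%C y
    (RtoC ds * w (sg y) * zt y ^ n + v (sg y) * (RtoC (INR n) * zt y ^ (n - 1) * dzt))%C.
Proof.
  move=> Hp Hs Hz. apply: cder_mult; last exact: cder_pow.
  apply: cder_comp => //. exact: vw.
Qed.

Lemma cder_val_x x r t : Rabs x < r ->
  cder (fun y => val y r t) x (dz x r t + dzbar x r t)%C.
Proof.
  move=> H.
  have D : is_derive (fun y => sq y r t) x (2 * x + 2 * r * cos t).
  { rewrite /sq; auto_derive => //; ring. }
  have E : cder (fun y => pt y r t) x (RtoC 1).
  { rewrite /pt; apply: cder_val (cder_plus _ _ _ _ _ (cder_RtoC _ x 1 (is_derive_id x)) (cder_const (RtoC r * cis t)%C x)). ring. }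
  apply: cder_val (cder_chain (fun y => sq y r t) (fun y => pt y r t) _ _ _ (sq_pos _ _ t H) D E).
  have -> : RtoC (2 * x + 2 * r * cos t) = (pt x r t + Cconj (pt x r t))%C.
  { rewrite pt_conj /pt RtoC_plus !RtoC_mult cos_cis; field. }
  rewrite /dz /dzbar; ring.
Qed.

Lemma cder_val_r x r t : Rabs x < r ->
  cder (fun y => val x y t) r (dz x r t * cis t + dzbar x r t * Cconj (cis t))%C.
Proof.
  move=> H.
  have D : is_derive (fun y => sq x y t) r (2 * r + 2 * x * cos t).
  { rewrite /sq; auto_derive => //; ring. }
  have E : cder (fun y => pt x y t) r (cis t).
  { rewrite /pt; apply: cder_val (cder_plus _ _ _ _ _ (cder_const (RtoC x) r) (cder_mult _ _ _ _ _ (cder_RtoC _ r 1 (is_derive_id r)) (cder_const (cis t) r))). ring. }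
  apply: cder_val (cder_chain (fun y => sq x y t) (fun y => pt x y t) _ _ _ (sq_pos _ _ t H) D E).
  have -> : RtoC (2 * r + 2 * x * cos t) = (Cconj (pt x r t) * cis t + pt x r t * Cconj (cis t))%C.
  { have E1 := cis_conj_mult t.
    have -> : (Cconj (pt x r t) * cis t + pt x r t * Cconj (cis t) =
      RtoC x * (cis t + Cconj (cis t)) + RtoC 2 * RtoC r * (cis t * Cconj (cis t)))%C
      by rewrite pt_conj /pt; ring.
    rewrite E1 RtoC_plus !RtoC_mult cos_cis; field. }
  rewrite /dz /dzbar; ring.
Qed.

Lemma cder_val_t x r t : Rabs x < r ->
  cder (fun y => val x r y) t (Ci * RtoC r * (dz x r t * cis t - dzbar x r t * Cconj (cis t)))%C.
Proof.
  move=> H.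
  have D : is_derive (fun y => sq x r y) t (- (2 * x * r * sin t)).
  { rewrite /sq; auto_derive => //; ring. }
  have E : cder (fun y => pt x r y) t (Ci * RtoC r * cis t)%C.
  { rewrite /pt; apply: cder_val (cder_plus _ _ _ _ _ (cder_const (RtoC x) t) (cder_scal (RtoC r) _ _ _ (cder_cis t))). ring. }
  apply: cder_val (cder_chain (fun y => sq x r y) (fun y => pt x r y) _ _ _ (sq_pos _ _ t H) D E).
  have -> : RtoC (- (2 * x * r * sin t)) = (Ci * RtoC r * (Cconj (pt x r t) * cis t - pt x r t * Cconj (cis t)))%C.
  { have -> : (Cconj (pt x r t) * cis t - pt x r t * Cconj (cis t) =
      RtoC x * (cis t - Cconj (cis t)))%C by rewrite pt_conj /pt; ring.
    rewrite im_alt'. have -> : Im (cis t) = sin t by [].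
    rewrite RtoC_opp !RtoC_mult.
    have -> : (Ci * RtoC r * (RtoC x * (RtoC 2 * Ci * RtoC (sin t))) = (Ci * Ci) * (RtoC 2 * RtoC x * RtoC r * RtoC (sin t)))%C by ring.
    have -> : (Ci * Ci)%C = RtoC (-1) by rewrite /Ci /Cmult /RtoC /=; congr pair; ring.
    ring. }
  rewrite /dz /dzbar; ring.
Qed.

(** Since [val] has frequency [n], the rotation field [z d/dz - zbar d/dzbar] multiplies
    it by [n]; the point [z] is then replaced by [x + r e^it]. *)
Lemma euler_rotation x r t :
  (RtoC (INR n) * val x r t - RtoC r * (dz x r t * cis t - dzbar x r t * Cconj (cis t)) =
   RtoC x * (dz x r t - dzbar x r t))%C.
Proof.
  have A : (RtoC (INR n) * (pt x r t * pt x r t ^ (n - 1)) = RtoC (INR n) * pt x r t ^ n)%C.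
  { case: n => [|m]; first by rewrite /=; ring.
    have -> : (S m - 1 = m)%nat by lia. by rewrite Cpow_S. }
  have B : (pt x r t * dz x r t - Cconj (pt x r t) * dzbar x r t = RtoC (INR n) * val x r t)%C.
  { rewrite /dz /dzbar /val.
    have -> : (RtoC (INR n) * (v (sq x r t) * pt x r t ^ n) = v (sq x r t) * (RtoC (INR n) * pt x r t ^ n))%C by ring.
    rewrite -A; ring. }
  rewrite -B pt_conj /pt; ring.
Qed.
End Smooth.

(** * Propagation of vanishing moments *)

(** The circle of real centre [x] and radius [r] surrounds the origin inside the open
    annulus of radii [q1] and [q2]. *)
Definition admissible (q1 q2 x r : R) : Prop := q1 < r - Rabs x /\ r + Rabs x < q2.

Lemma admissible_near q1 q2 x r : admissible q1 q2 x r ->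
  exists d : posreal, forall x' r', Rabs (x' - x) < d -> Rabs (r' - r) < d -> admissible q1 q2 x' r'.
Proof.
  move=> [A B].
  have Hd : 0 < Rmin (r - Rabs x - q1) (q2 - (r + Rabs x)) / 2.
  { have := Rmin_glb_lt (r - Rabs x - q1) (q2 - (r + Rabs x)) 0. lra. }
  exists (mkposreal _ Hd) => x' r' /= Hx Hr.
  have L1 := Rmin_l (r - Rabs x - q1) (q2 - (r + Rabs x)).
  have L2 := Rmin_r (r - Rabs x - q1) (q2 - (r + Rabs x)).
  have [R1 R2] := Rabs_def2 _ _ Hr.
  have T : Rabs x' <= Rabs (x' - x) + Rabs x.
  { have := Rabs_triang (x' - x) x. by have -> : x' - x + x = x' by ring. }
  split; lra.
Qed.

Lemma ball_Rabs (x : R) (d : posreal) (y : R) : ball x d y -> Rabs (y - x) < d.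
Proof. by []. Qed.

(** Radial and angular differentiation of the [k]-th moment give two relations between the
    moments of [dz] and [dzbar], which force the moment of order [k + 1] of [dz] to be
    zero. The rotation identity then becomes the equation [x m' = - (n + k + 1) m] for
    the moment [m] of order [k + 1]; it is integrated from [x = 0]. *)
Lemma mom_zero_succ (v w : R -> C) n k q1 q2 :
  (forall s, 0 < s -> cder v s (w s)) -> (forall s, 0 < s -> ccont w s) ->
  (forall s, 0 < s -> ccont v s) -> 0 <= q1 ->
  (forall x r, admissible q1 q2 x r -> mom v n k x r = RtoC 0) ->
  forall x r, admissible q1 q2 x r -> mom v n (S k) x r = RtoC 0.
Proof.
  move=> vw wc vc Hq H0.
  have adm x r : admissible q1 q2 x r -> Rabs x < r by move=> [A _]; lra.
  have P1 x r : admissible q1 q2 x r -> forall t, ccont (fun t => dz v w n x r t) t.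
  { move=> /adm Ha t. apply: (ccont_dz v w n wc vc (fun _ => x) (fun _ => r) (fun t => t)) => //; exact: rcont_const. }
  have P2 x r : admissible q1 q2 x r -> forall t, ccont (fun t => dzbar w n x r t) t.
  { move=> /adm Ha t. apply: (ccont_dzbar w n wc (fun _ => x) (fun _ => r) (fun t => t)) => //; exact: rcont_const. }
  have P3 x r : admissible q1 q2 x r -> forall t, ccont (fun t => val v n x r t) t.
  { move=> /adm Ha t. apply: (ccont_val v n vc (fun _ => x) (fun _ => r) (fun t => t)) => //; exact: rcont_const. }
  have momE j x r : mom v n j x r = avg (fun t => val v n x r t * cis t ^ j)%C by [].
  (* an angular derivative has zero average; integrating by parts against [e^ijt]
     produces the factor [- j] *)
  have ang j x r : admissible q1 q2 x r ->
    avg (fun t => RtoC r * (dz v w n x r t * cis t - dzbar w n x r t * Cconj (cis t)) * cis t ^ j)%C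
      = (RtoC (- INR j) * mom v n j x r)%C.
  { move=> Ha. have Q1 := P1 _ _ Ha. have Q2 := P2 _ _ Ha. have Q3 := P3 _ _ Ha.
    have E : avg (fun t => Ci * (RtoC r * (dz v w n x r t * cis t - dzbar w n x r t * Cconj (cis t)) * cis t ^ j +
        RtoC (INR j) * (val v n x r t * cis t ^ j)))%C = RtoC 0.
    { apply: (avg_cder_periodic (fun t => val v n x r t * cis t ^ j)%C).
      - move=> t.
        apply: cder_val (cder_mult _ _ _ _ _ (cder_val_t v w n vw x r t (adm _ _ Ha)) (cder_pow _ j _ _ (cder_cis t))).
        have A : (RtoC (INR j) * (cis t * cis t ^ (j - 1)) = RtoC (INR j) * cis t ^ j)%C.
        { case: j => [|m]; first by rewrite /=; ring.
          have -> : (S m - 1 = m)%nat by lia. by rewrite Cpow_S. }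
        transitivity (Ci * (RtoC r * (dz v w n x r t * cis t - dzbar w n x r t * Cconj (cis t)) * cis t ^ j) +
          Ci * val v n x r t * (RtoC (INR j) * (cis t * cis t ^ (j - 1))))%C; first by ring.
        rewrite A; ring.
      - cont.
      - move=> t. by rewrite /val /sq /pt cis_period cos_plus cos_2PI sin_2PI Rmult_0_r Rmult_1_r Rminus_0_r. }
    rewrite avg_scal in E; last by cont.
    rewrite avg_plus in E; [|cont|cont].
    rewrite avg_scal in E; last by cont.
    rewrite momE RtoC_opp.
    set a := avg _ in E *. set b := avg _ in E *.
    have : (a + RtoC (INR j) * b = - Ci * (Ci * (a + RtoC (INR j) * b)))%C.
    { have -> : (- Ci * (Ci * (a + RtoC (INR j) * b)) = - (Ci * Ci) * (a + RtoC (INR j) * b))%C by ring.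
      have -> : (Ci * Ci)%C = RtoC (-1) by rewrite /Ci /Cmult /RtoC /=; congr pair; ring. ring. }
    rewrite E => F. transitivity (a + RtoC (INR j) * b - RtoC (INR j) * b)%C; first by ring.
    rewrite F; ring. }
  have rad x r : admissible q1 q2 x r ->
    avg (fun t => (dz v w n x r t * cis t + dzbar w n x r t * Cconj (cis t)) * cis t ^ k)%C = RtoC 0.
  { move=> Ha. have [d Hd] := admissible_near _ _ _ _ Ha.
    have Hd' y : ball r d y -> admissible q1 q2 x y.
    { move=> Hy; apply: Hd; last exact: ball_Rabs. rewrite Rminus_eq_0 Rabs_R0; exact: cond_pos. }
    apply: (cder_unique (fun y => mom v n k x y) r).
    - apply: (cder_avg (fun y t => val v n x y t * cis t ^ k)%C
        (fun y t => (dz v w n x y t * cis t + dzbar w n x y t * Cconj (cis t)) * cis t ^ k)%C).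
      + exists d => y Hy t.
        apply: cder_val (cder_mult _ _ _ _ _ (cder_val_r v w n vw x y t (adm _ _ (Hd' _ Hy))) (cder_const _ y)). ring.
      + exists d => y Hy t. have := P3 _ _ (Hd' _ Hy) t => Q. by cont.
      + move=> t.
        have A := ccont_dz v w n wc vc (T := R2) (fun _ => x) fst snd (r, t) (rcont_const _ _) (rcont_pfst _) (rcont_psnd _) (adm _ _ Ha).
        have B := ccont_dzbar w n wc (T := R2) (fun _ => x) fst snd (r, t) (rcont_const _ _) (rcont_pfst _) (rcont_psnd _) (adm _ _ Ha).
        by cont.
    - apply: (cder_ext_loc (fun _ => RtoC 0)); last exact: cder_const.
      exists d => y Hy. by rewrite H0 //; exact: Hd'. }
  have dz0 x r : admissible q1 q2 x r -> avg (fun t => dz v w n x r t * cis t ^ S k)%C = RtoC 0.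
  { move=> Ha. have Q1 := P1 _ _ Ha. have Q2 := P2 _ _ Ha.
    have A := ang k _ _ Ha. rewrite H0 // Cmult_0_r in A.
    have B := rad _ _ Ha.
    have Hr : r <> 0 by have := adm _ _ Ha; have := Rabs_pos x; lra.
    have S2 : (avg (fun t => (dz v w n x r t * cis t + dzbar w n x r t * Cconj (cis t)) * cis t ^ k) +
      RtoC (/ r) * avg (fun t => RtoC r * (dz v w n x r t * cis t - dzbar w n x r t * Cconj (cis t)) * cis t ^ k))%C
      = (RtoC 2 * avg (fun t => dz v w n x r t * cis t ^ S k))%C.
    { rewrite -!avg_scal -?avg_plus; try by cont.
      apply: avg_ext => t. rewrite RtoC_inv // Cpow_S. field. move=> [E]; exact: Hr. }
    rewrite A B in S2.
    have : (RtoC (/ 2) * (RtoC 2 * avg (fun t => dz v w n x r t * cis t ^ S k)))%C = RtoC 0 by rewrite -S2; ring.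
    rewrite Cmult_assoc -RtoC_mult Rinv_l ?Cmult_1_l //; lra. }
  have der x r : admissible q1 q2 x r ->
    cder (fun y => mom v n (S k) y r) x (avg (fun t => (dz v w n x r t + dzbar w n x r t) * cis t ^ S k))%C.
  { move=> Ha. have [d Hd] := admissible_near _ _ _ _ Ha.
    have Hd' y : ball x d y -> admissible q1 q2 y r.
    { move=> Hy; apply: Hd; first exact: ball_Rabs. rewrite Rminus_eq_0 Rabs_R0; exact: cond_pos. }
    apply: (cder_avg (fun y t => val v n y r t * cis t ^ S k)%C
        (fun y t => (dz v w n y r t + dzbar w n y r t) * cis t ^ S k)%C).
      + exists d => y Hy t.
        apply: cder_val (cder_mult _ _ _ _ _ (cder_val_x v w n vw y r t (adm _ _ (Hd' _ Hy))) (cder_const _ y)). ring.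
      + exists d => y Hy t. have := P3 _ _ (Hd' _ Hy) t => Q. by cont.
      + move=> t.
        have A := ccont_dz v w n wc vc (T := R2) fst (fun _ => r) snd (x, t) (rcont_pfst _) (rcont_const _ _) (rcont_psnd _) (adm _ _ Ha).
        have B := ccont_dzbar w n wc (T := R2) fst (fun _ => r) snd (x, t) (rcont_pfst _) (rcont_const _ _) (rcont_psnd _) (adm _ _ Ha).
        by cont. }
  (* here [dz + dzbar = 2 dz - (dz - dzbar)], and the average of [dz * e^i(k+1)t] is zero *)
  have ode x r : admissible q1 q2 x r ->
    (RtoC x * avg (fun t => (dz v w n x r t + dzbar w n x r t) * cis t ^ S k) =
     RtoC (- INR (n + S k)) * mom v n (S k) x r)%C.
  { move=> Ha. have Q1 := P1 _ _ Ha. have Q2 := P2 _ _ Ha. have Q3 := P3 _ _ Ha.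
    have A := ang (S k) _ _ Ha. have Z := dz0 _ _ Ha.
    have E : (RtoC x * avg (fun t => (dz v w n x r t + dzbar w n x r t) * cis t ^ S k) =
      RtoC (2 * x) * avg (fun t => dz v w n x r t * cis t ^ S k) +
      (avg (fun t => RtoC r * (dz v w n x r t * cis t - dzbar w n x r t * Cconj (cis t)) * cis t ^ S k)
       + RtoC (- INR n) * avg (fun t => val v n x r t * cis t ^ S k)))%C.
    { rewrite -!avg_scal -?avg_plus; try by cont.
      apply: avg_ext => t.
      have Eu := euler_rotation v w n x r t.
      rewrite RtoC_mult RtoC_opp.
      transitivity (RtoC 2 * RtoC x * (dz v w n x r t * cis t ^ S k) - (RtoC x * (dz v w n x r t - dzbar w n x r t)) * cis t ^ S k)%C; first by ring.
      rewrite -Eu; ring. }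
    rewrite E A Z -momE plus_INR !RtoC_opp RtoC_plus; ring. }
  move=> x r Ha.
  case: (Req_dec x 0) => [->|Hx].
  { have -> : mom v n (S k) 0 r = avg (fun t => (v (r ^ 2)%R * RtoC r ^ n) * cis t ^ (n + S k))%C.
    { apply: avg_ext => t. rewrite /sq /pt.
      have -> : 0 ^ 2 + r ^ 2 + 2 * 0 * r * cos t = r ^ 2 by ring.
      rewrite Cplus_0_l Cpow_mult_l Cpow_add_r; ring. }
    rewrite avg_scal; last by cont.
    rewrite avg_cis_pow; [ring | lia]. }
  have Ha' t : Rmin 0 x <= t <= Rmax 0 x -> admissible q1 q2 t r.
  { move=> Ht. have : Rabs t <= Rabs x.
    { move: Ht. rewrite /Rmin /Rmax. case: Rle_dec => _ Ht.
      - rewrite !Rabs_pos_eq; lra.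
      - rewrite !Rabs_left1; lra. }
    case: Ha; rewrite /admissible; lra. }
  have E : (fun y => RtoC y ^ (n + S k) * mom v n (S k) y r)%C 0 = (fun y => RtoC y ^ (n + S k) * mom v n (S k) y r)%C x.
  { apply: (cder_zero_const (fun y => RtoC y ^ (n + S k) * mom v n (S k) y r)%C) => t Ht.
    have Hat := Ha' _ Ht.
    apply: cder_val (cder_mult _ _ _ _ _ (cder_pow _ (n + S k) _ _ (cder_RtoC _ t 1 (is_derive_id t))) (der _ _ Hat)).
    have -> : (n + S k - 1 = n + k)%nat by lia.
    have -> : (n + S k = S (n + k))%nat by lia.
    have O := ode _ _ Hat. rewrite RtoC_opp in O.
    have Eq : (n + S k = S (n + k))%nat by lia. rewrite Eq in O.
    rewrite Cpow_S.
    set M' := avg _ in O *.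
    transitivity (RtoC t ^ (n + k) * (RtoC (INR (S (n + k))) * mom v n (S k) t r + RtoC t * M'))%C; first by ring.
    rewrite O; ring. }
  move: E => /=. have -> : (n + S k = S (n + k))%nat by lia.
  rewrite Cpow_S !Cmult_0_l => E.
  have Hn : (RtoC x ^ S (n + k))%C <> RtoC 0.
  { apply: Cpow_nz => [[]]. exact: Hx. }
  have : (/ (RtoC x ^ S (n + k)) * (RtoC x ^ S (n + k) * mom v n (S k) x r))%C = RtoC 0 by rewrite -E; ring.
  by rewrite Cmult_assoc Cinv_l // Cmult_1_l.
Qed.

Lemma mom_zero_smooth (v w : R -> C) n q1 q2 :
  (forall s, 0 < s -> cder v s (w s)) -> (forall s, 0 < s -> ccont w s) ->
  (forall s, 0 < s -> ccont v s) -> 0 <= q1 ->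
  (forall x r, admissible q1 q2 x r -> mom v n 0 x r = RtoC 0) ->
  forall k x r, admissible q1 q2 x r -> mom v n k x r = RtoC 0.
Proof.
  move=> vw wc vc Hq H0; elim => [//|k IH]. exact: (mom_zero_succ v w n k q1 q2).
Qed.

Lemma avg_CInt_swap (G : R -> R -> C) c d :
  (forall p, ccont (T := R2) (fun p => G (fst p) (snd p)) p) -> c <= d ->
  avg (fun t => CInt (fun u => G t u) c d) = CInt (fun u => avg (fun t => G t u)) c d.
Proof.
  move=> HG Hcd. rewrite /avg CInt_swap //; last exact: (Rlt_le _ _ twoPI_pos).
  rewrite CInt_scal //. apply: (ccont_CInt_param (fun u t => G t u)); last exact: (Rlt_le _ _ twoPI_pos).
  exact: ccont2_swap.
Qed.

(** * Averaging over dilations *)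

Section Average.
Variable v : R -> C.
Hypothesis vc : forall s, ccont v s.

(** The integral of the dilates [v (u s)] over [1 <= u <= y], by [dil_avgE]; in this form
    it is visibly differentiable in [s], although [v] is only continuous. *)
Definition dil_avg (y s : R) : C := (RtoC (/ s) * (CInt v 0 (y * s) - CInt v 0 s))%C.
Definition dil_avg' (y s : R) : C :=
  (RtoC (- / s ^ 2) * (CInt v 0 (y * s) - CInt v 0 s) +
   RtoC (/ s) * (RtoC y * v (y * s)%R - v s))%C.

Lemma dil_avgE y s : 0 < s -> dil_avg y s = CInt (fun u => v (u * s)) 1 y.
Proof.
  move=> Hs.
  have E : (RtoC s * CInt (fun u => v (u * s)) 1 y = CInt v s (y * s))%C.
  { rewrite -CInt_scal; last by cont.
    have := RInt_comp_lin (V := CV) v s 0 1 y.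
    rewrite !Rplus_0_r Rmult_1_r (Rmult_comm s y) => H.
    rewrite /CInt -H; last exact: ex_RInt_C.
    apply: (RInt_ext (V := CV)) => t _. by rewrite scal_R_Cmult Rplus_0_r (Rmult_comm s t). }
  have Ch : (CInt v 0 s + CInt v s (y * s))%C = CInt v 0 (y * s).
  { apply: (RInt_Chasles (V := CV)); exact: ex_RInt_C. }
  rewrite /dil_avg -Ch -E.
  have -> : (RtoC (/ s) * (CInt v 0 s + RtoC s * CInt (fun u => v (u * s)) 1 y - CInt v 0 s) =
    RtoC (/ s) * RtoC s * CInt (fun u => v (u * s)) 1 y)%C by ring.
  rewrite -RtoC_mult Rinv_l ?Cmult_1_l //; lra.
Qed.

Lemma cont_prim s : ccont (fun s => CInt v 0 s) s.
Proof.
  have [A B] := cder_CInt v 0 s vc.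
  apply: (ccont_ext (fun s => (fst (CInt v 0 s), snd (CInt v 0 s)))).
  { move=> y; by rewrite -surjective_pairing. }
  apply: ccont_pair.
  - apply: (ex_derive_continuous (V := R_NormedModule)); eexists; exact: A.
  - apply: (ex_derive_continuous (V := R_NormedModule)); eexists; exact: B.
Qed.

Lemma cder_dil_avg y s : 0 < s -> cder (dil_avg y) s (dil_avg' y s).
Proof.
  move=> Hs.
  have D1 : cder (fun s => CInt v 0 (y * s)) s (RtoC y * v (y * s)%R)%C.
  { apply: (cder_comp (fun s => CInt v 0 s) (fun s => y * s)); first exact: cder_CInt.
    auto_derive => //; ring. }
  have D2 : is_derive Rinv s (- / s ^ 2).
  { auto_derive; [lra | field; lra]. }
  apply: (cder_ext (fun s => RtoC (/ s) * (CInt v 0 (y * s) + RtoC (-1) * CInt v 0 s))%C).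
  { move=> u; rewrite /dil_avg; ring. }
  apply: cder_val (cder_mult _ _ _ _ _ (cder_RtoC _ _ _ D2) (cder_plus _ _ _ _ _ D1 (cder_scal (RtoC (-1)) _ _ _ (cder_CInt v 0 s vc)))).
  rewrite /dil_avg'; ring.
Qed.

Lemma cont_dil_avg y s : 0 < s -> ccont (dil_avg y) s.
Proof.
  move=> Hs. have P := cont_prim. rewrite /dil_avg. cont; lra.
Qed.

Lemma cont_dil_avg' y s : 0 < s -> ccont (dil_avg' y) s.
Proof.
  move=> Hs. have P := cont_prim. rewrite /dil_avg'. cont; nra.
Qed.

(** The [k]-th moment of the dilate of [v] by [u]: up to a factor, the moment of [v] on
    the circle dilated by the square root of [u]. *)
Definition dil_mom n k x r u : C :=
  avg (fun t => v (u * sq x r t)%R * pt x r t ^ n * cis t ^ k)%C.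

Lemma cont2_dil n k x r p :
  ccont (T := R2) (fun p => v (snd p * sq x r (fst p))%R * pt x r (fst p) ^ n * cis (fst p) ^ k)%C p.
Proof. rewrite /sq /pt. by cont. Qed.

Lemma mom_dil_avg n k x r y : 1 <= y -> Rabs x < r ->
  mom (dil_avg y) n k x r = CInt (dil_mom n k x r) 1 y.
Proof.
  move=> Hy Hx. have C2 := cont2_dil n k x r.
  rewrite -(avg_CInt_swap (fun t u => v (u * sq x r t)%R * pt x r t ^ n * cis t ^ k)%C) //.
  apply: avg_ext => t. rewrite dil_avgE; last exact: sq_pos.
  transitivity (pt x r t ^ n * cis t ^ k * CInt (fun u => v (u * sq x r t)) 1 y)%C; first by ring.
  rewrite -CInt_scal; last by cont.
  apply: CInt_ext => u; ring.
Qed.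

Lemma mom_dilate n k x r l :
  mom v n k (l * x) (l * r) = (RtoC l ^ n * dil_mom n k x r (l ^ 2))%C.
Proof.
  rewrite /dil_mom -avg_scal.
  - apply: avg_ext => t.
    have -> : sq (l * x) (l * r) t = l ^ 2 * sq x r t by rewrite /sq; ring.
    have -> : pt (l * x) (l * r) t = (RtoC l * pt x r t)%C by rewrite /pt !RtoC_mult; ring.
    rewrite Cpow_mult_l; ring.
  - move=> t. rewrite /sq /pt. by cont.
Qed.

Lemma admissible_dilate q1 q2 x r l : 0 < l -> q1 < l * (r - Rabs x) -> l * (r + Rabs x) < q2 ->
  admissible q1 q2 (l * x) (l * r).
Proof. move=> Hl A B. rewrite /admissible Rabs_mult (Rabs_pos_eq l); lra. Qed.

(** The moments of [dil_avg y] vanish for all [y] in an interval, by the differentiable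
    case; differentiating in [y] removes the average. *)
Lemma mom_zero_cont n q1 q2 : 0 <= q1 ->
  (forall x r, admissible q1 q2 x r -> mom v n 0 x r = RtoC 0) ->
  forall k x r, admissible q1 q2 x r -> mom v n k x r = RtoC 0.
Proof.
  move=> Hq H0 k x1 r1 [A1 A2].
  have Hx1 := Rabs_pos x1.
  (* The given circle is written as the dilate by [/ c] of a smaller one, so that the
     parameter [(/ c)^2] is interior to an interval of admissible upper bounds [y]. *)
  have [c [Hc0 [Hc1 Hc2]]] : exists c, 0 < c /\ c < 1 /\ q1 < c * (r1 - Rabs x1).
  { exists ((1 + q1 / (r1 - Rabs x1)) / 2).
    have K : q1 / (r1 - Rabs x1) * (r1 - Rabs x1) = q1 by field; lra.
    have K0 : 0 <= q1 / (r1 - Rabs x1).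
    { apply: Rmult_le_pos => //. left; apply: Rinv_0_lt_compat; lra. }
    have K1 : q1 / (r1 - Rabs x1) < 1 by nra.
    split; [lra | split; [lra | nra]]. }
  have [d [Hd1 Hd2]] : exists d, 1 < d /\ d * (r1 + Rabs x1) < q2.
  { exists ((1 + q2 / (r1 + Rabs x1)) / 2).
    have K : q2 / (r1 + Rabs x1) * (r1 + Rabs x1) = q2 by field; lra.
    have K1 : 1 < q2 / (r1 + Rabs x1) by nra.
    split; [lra | nra]. }
  have Hic : c * / c = 1 by field; lra.
  have Hic0 := Rinv_0_lt_compat _ Hc0.
  have Hic1 : 1 < / c by nra.
  set x := c * x1. set r := c * r1.
  have Ax : Rabs x = c * Rabs x1 by rewrite /x Rabs_mult (Rabs_pos_eq c) //; lra.
  have Hxr : Rabs x < r by rewrite Ax /r; nra.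
  have zero y : 1 <= y -> y < (d * / c) ^ 2 -> CInt (dil_mom n k x r) 1 y = RtoC 0.
  { move=> Hy1 Hy2.
    have Sy : sqrt y * sqrt y = y by apply: sqrt_sqrt; lra.
    have Sy1 : 1 <= sqrt y by rewrite -sqrt_1; apply: sqrt_le_1; lra.
    have Syd : sqrt y < d * / c.
    { apply: Rsqr_incrst_0; rewrite /Rsqr; nra. }
    rewrite -mom_dil_avg //.
    apply: (mom_zero_smooth (dil_avg y) (dil_avg' y) n q1 (q2 / sqrt y)) => //.
    - exact: cder_dil_avg.
    - exact: cont_dil_avg'.
    - exact: cont_dil_avg.
    - move=> x' r' [B1 B2]. have Hx' := Rabs_pos x'.
      rewrite mom_dil_avg //; last lra.
      rewrite /CInt (RInt_ext (V := CV) _ (fun _ => RtoC 0)).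
      + rewrite (RInt_const (V := CV)) scal_R_Cmult; ring.
      + move=> u [U1 U2]. rewrite Rmin_left // in U1. rewrite Rmax_right // in U2.
        have Su : sqrt u * sqrt u = u by apply: sqrt_sqrt; lra.
        have Su1 : 1 <= sqrt u by rewrite -sqrt_1; apply: sqrt_le_1; lra.
        have Suy : sqrt u <= sqrt y by apply: sqrt_le_1; lra.
        have M := mom_dilate n 0 x' r' (sqrt u).
        rewrite H0 in M.
        * have -> : u = sqrt u ^ 2 by rewrite -{1}Su; ring.
          have N : (RtoC (sqrt u) ^ n)%C <> RtoC 0 by apply: Cpow_nz => [[]]; lra.
          have : (/ (RtoC (sqrt u) ^ n) * (RtoC (sqrt u) ^ n * dil_mom n 0 x' r' (sqrt u ^ 2)))%C = RtoC 0 by rewrite -M; ring.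
          by rewrite Cmult_assoc Cinv_l // Cmult_1_l.
        * apply: admissible_dilate; [lra | nra |].
          apply: (Rle_lt_trans _ (sqrt y * (r' + Rabs x'))); first by nra.
          have : q2 / sqrt y * sqrt y = q2 by field; lra. nra.
    - split; rewrite Ax /r; first nra.
      have : q2 / sqrt y * sqrt y = q2 by field; lra.
      have : sqrt y * c < d.
      { have : sqrt y * c < d * / c * c by nra. have -> : d * / c * c = d by field; lra. by []. }
      move=> K1 K2. apply: (Rmult_lt_reg_r (sqrt y)); first lra. rewrite K2. nra. }
  have dc : forall u, ccont (dil_mom n k x r) u.
  { apply: (ccont_avg_param (fun u t => v (u * sq x r t)%R * pt x r t ^ n * cis t ^ k)%C).
    apply: (ccont2_swap (fun t u => v (u * sq x r t)%R * pt x r t ^ n * cis t ^ k)%C).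
    exact: cont2_dil. }
  have vanish : dil_mom n k x r ((/ c) ^ 2) = RtoC 0.
  { apply: (cder_unique (fun y => CInt (dil_mom n k x r) 1 y) ((/ c) ^ 2)); first exact: cder_CInt.
    apply: (cder_ext_loc (fun _ => RtoC 0)); last exact: cder_const.
    have H1 : 0 < (/ c) ^ 2 - 1 by nra.
    have H2 : 0 < (d * / c) ^ 2 - (/ c) ^ 2.
    { have -> : (d * / c) ^ 2 - (/ c) ^ 2 = (d ^ 2 - 1) * (/ c) ^ 2 by ring. apply: Rmult_lt_0_compat; nra. }
    exists (mkposreal _ (Rmin_glb_lt _ _ _ H1 H2)) => y /ball_Rabs /= Hy.
    have L1 := Rmin_l ((/ c) ^ 2 - 1) ((d * / c) ^ 2 - (/ c) ^ 2).
    have L2 := Rmin_r ((/ c) ^ 2 - 1) ((d * / c) ^ 2 - (/ c) ^ 2).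
    have [B1 B2] := Rabs_def2 _ _ Hy.
    rewrite zero //=; simpl in *; lra. }
  have := mom_dilate n k x r (/ c). rewrite vanish.
  have -> : / c * x = x1 by rewrite /x; field; lra.
  have -> : / c * r = r1 by rewrite /r; field; lra.
  move=> ->; ring.
Qed.
End Average.

(** * Powers and moduli of continuity *)

(** The power [t ^ a], with value 0 at [t = 0], where [Rpower] has the value 1. *)
Definition hpow (t a : R) : R :=
  match Rle_dec t 0 with left _ => 0 | right _ => Rpower t a end.

Lemma hpowE t a : 0 < t -> hpow t a = Rpower t a.
Proof. rewrite /hpow; case: Rle_dec => //; lra. Qed.
Lemma hpow_0 t a : t <= 0 -> hpow t a = 0.
Proof. rewrite /hpow; case: Rle_dec => //; lra. Qed.
Lemma hpow_ge0 t a : 0 <= hpow t a.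
Proof. rewrite /hpow; case: Rle_dec => H; [lra | left; exact: exp_pos]. Qed.
Lemma hpow_gt0 t a : 0 < t -> 0 < hpow t a.
Proof. move=> H; rewrite hpowE //; exact: exp_pos. Qed.
Lemma hpow_mono t u a : 0 <= a -> t <= u -> hpow t a <= hpow u a.
Proof.
  move=> Ha Htu. case: (Rle_dec t 0) => Ht; first by rewrite (hpow_0 t) //; exact: hpow_ge0.
  rewrite !hpowE; [|lra|lra]. apply: Rle_Rpower_l; lra.
Qed.
Lemma hpow_mult t u a : 0 <= t -> 0 <= u -> hpow (t * u) a = hpow t a * hpow u a.
Proof.
  move=> [Ht|<-]; last by rewrite Rmult_0_l (hpow_0 0) //; lra.
  move=> [Hu|<-]; last by rewrite Rmult_0_r (hpow_0 0) //; lra.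
  rewrite !hpowE ?Rpower_mult_distr //. exact: Rmult_lt_0_compat.
Qed.
Lemma hpow_hpow t a b : hpow (hpow t a) b = hpow t (a * b).
Proof.
  case: (Rle_dec t 0) => Ht; first by rewrite !(hpow_0 t) // hpow_0 //; lra.
  rewrite (hpowE t); last lra. rewrite (hpowE t); last lra. rewrite hpowE; last exact: exp_pos.
  exact: Rpower_mult.
Qed.
Lemma hpow_sqr t a : 0 <= t -> hpow (t ^ 2) (a / 2) = hpow t a.
Proof.
  move=> [Ht|<-]; last by rewrite !hpow_0 //; lra.
  rewrite !hpowE //; last by apply: pow_lt.
  rewrite -(Rpower_pow 2) // Rpower_mult; congr Rpower. rewrite /=; lra.
Qed.
Lemma hpow_1 a : hpow 1 a = 1.
Proof. rewrite hpowE; last lra. by rewrite /Rpower ln_1 Rmult_0_r exp_0. Qed.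
Lemma hpow_le1 t a : 0 <= a -> t <= 1 -> hpow t a <= 1.
Proof. move=> Ha Ht; rewrite -(hpow_1 a); exact: hpow_mono. Qed.
Lemma hpow_ge1 t a : 0 <= a -> 1 <= t -> 1 <= hpow t a.
Proof. move=> Ha Ht; rewrite -(hpow_1 a); exact: hpow_mono. Qed.
Lemma hpow_lt1 t a : 0 < a -> 0 < t < 1 -> hpow t a < 1.
Proof.
  move=> Ha Ht; rewrite hpowE; last lra. rewrite /Rpower -exp_0. apply: exp_increasing.
  have : ln t < 0 by rewrite -ln_1; apply: ln_increasing; lra. nra.
Qed.
Lemma hpow_anti t a b : a <= b -> 0 <= t <= 1 -> hpow t b <= hpow t a.
Proof.
  move=> Hab [[Ht|<-] Ht1]; last by rewrite !hpow_0; lra.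
  rewrite !hpowE // /Rpower. have : ln t <= 0 by rewrite -ln_1; apply: ln_le.
  move=> L. have : b * ln t <= a * ln t by nra.
  case=> [H|->]; [left; exact: exp_increasing | lra].
Qed.
Lemma hpow_pow t a n : 0 < t -> hpow (t ^ n) a = hpow t a ^ n.
Proof.
  move=> Ht; elim: n => [|n IH]; first exact: hpow_1.
  rewrite /= hpow_mult; [by rewrite IH | lra | left; exact: pow_lt].
Qed.
Lemma hpow_plus t a b : hpow t a * hpow t b = hpow t (a + b).
Proof.
  case: (Rle_dec t 0) => Ht; first by rewrite !(hpow_0 t) //; lra.
  rewrite !hpowE; try lra. by rewrite Rpower_plus.
Qed.
Lemma hpow_one t : 0 <= t -> hpow t 1 = t.
Proof. move=> [H|<-]; [by rewrite hpowE // Rpower_1 | by rewrite hpow_0; lra]. Qed.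

(** A weak form of the concavity of [t |-> t ^ b]: the bound is linear in [t], so it can
    be averaged against any kernel. *)
Lemma hpow_linear t e b : 0 <= t -> 0 < e -> 0 < b <= 1 -> hpow t b <= hpow e b * (1 + t / e).
Proof.
  move=> Ht He Hb. have P := hpow_gt0 e b He.
  have Q : 0 <= t / e by apply: Rmult_le_pos => //; left; exact: Rinv_0_lt_compat.
  have -> : t = e * (t / e) by field; lra.
  rewrite hpow_mult //; last lra.
  have -> : e * (t / e) / e = t / e by field; lra.
  apply: Rmult_le_compat_l; first lra.
  case: (Rle_dec (t / e) 1) => H.
  - have := hpow_le1 (t / e) b. lra.
  - have : hpow (t / e) b <= hpow (t / e) 1.
    { rewrite !hpowE; try lra. apply: Rle_Rpower; lra. }
    rewrite hpow_one //; lra.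
Qed.

Lemma hpow_small a e : 0 < a -> 0 < e -> exists d : posreal, forall t, t < d -> hpow t a < e.
Proof.
  move=> Ha He. exists (mkposreal _ (hpow_gt0 e (/ a) He)) => t /= Ht.
  case: (Rle_dec t 0) => H; first by rewrite hpow_0.
  have E : hpow (hpow e (/ a)) a = e.
  { rewrite hpow_hpow Rinv_l; last lra. rewrite hpow_one; lra. }
  rewrite -E hpowE; last lra. rewrite (hpowE (hpow _ _)); last lra.
  rewrite /Rpower. apply: exp_increasing. apply: Rmult_lt_compat_l => //. apply: ln_increasing; lra.
Qed.

(** * Hoelder continuous functions *)

(** [holder_on] with its constants exposed and the diagonal included. *)
Definition hol (K : C -> Prop) (f : C -> C) (M a : R) : Prop :=
  0 <= M /\ 0 < a < 1 /\
  forall z w, K z -> K w -> Cmod (f z - f w)%C <= M * hpow (Cmod (z - w)%C) a.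

Lemma holder_hol K f : holder_on K f -> exists M a, hol K f M a.
Proof.
  move=> [M [a [Ha H]]]. exists (Rabs M), a. split; first exact: Rabs_pos. split => // z w Hz Hw.
  case: (Ceq_dec z w) => [->|Hne].
  - have -> : (f w - f w = RtoC 0)%C by ring. rewrite Cmod_0.
    apply: Rmult_le_pos; [exact: Rabs_pos | exact: hpow_ge0].
  - apply: (Rle_trans _ _ _ (H _ _ Hz Hw Hne)).
    rewrite hpowE; last by apply/Cmod_gt_0; exact: Cminus_eq_contra.
    apply: Rmult_le_compat_r; [left; exact: exp_pos | exact: Rle_abs].
Qed.

Lemma hol_holder K f M a : hol K f M a -> holder_on K f.
Proof.
  move=> [HM [Ha H]]. exists M, a. split => // z w Hz Hw Hne.
  rewrite -hpowE; first exact: H. by apply/Cmod_gt_0; exact: Cminus_eq_contra.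
Qed.

Lemma hol_conj K f M a : hol K f M a -> hol K (fun z => Cconj (f z)) M a.
Proof.
  move=> [HM [Ha H]]. split => //; split => // z w Hz Hw.
  rewrite -Cminus_conj Cmod_conj; exact: H.
Qed.

Lemma ccont_Cmod {T : UniformSpace} (h : T -> C) p :
  (forall e, 0 < e -> locally p (fun q => Cmod (h q - h p)%C < e)) -> ccont h p.
Proof.
  move=> H. apply/filterlim_locally => e.
  have := H _ (cond_pos e). apply filter_imp => q Hq.
  apply: (C_NormedModule_mixin_compat1 (h p) (h q)). exact: Hq.
Qed.

Lemma ccont_locally {T : UniformSpace} (h : T -> C) p e : ccont h p -> 0 < e ->
  locally p (fun q => Cmod (h q - h p)%C < e).
Proof.
  move=> Hh He.
  have R : rcont (fun q => Cmod (h q - h p)%C) p by cont.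
  have := R _ (locally_ball _ (mkposreal _ He)). rewrite /filtermap.
  apply filter_imp => q /ball_Rabs.
  have -> : (h p - h p = RtoC 0)%C by ring.
  rewrite Cmod_0 Rminus_0_r /= => Hq.
  exact: (Rle_lt_trans _ _ _ (Rle_abs _) Hq).
Qed.

Lemma hol_ccont {T : UniformSpace} K f M a (g : T -> C) p : hol K f M a ->
  (forall q, K (g q)) -> ccont g p -> ccont (fun q => f (g q)) p.
Proof.
  move=> [HM [Ha H]] HK Hg. apply: ccont_Cmod => e He.
  have He' : 0 < e / (M + 1) by apply: Rdiv_lt_0_compat; lra.
  have [d Hd] := hpow_small a _ (proj1 Ha) He'.
  have := ccont_locally _ _ _ Hg (cond_pos d).
  apply filter_imp => q Hq.
  apply: (Rle_lt_trans _ _ _ (H _ _ (HK q) (HK p))).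
  have A := Hd _ Hq.
  have B := hpow_ge0 (Cmod (g q - g p)%C) a.
  have -> : e = (M + 1) * (e / (M + 1)) by field; lra.
  nra.
Qed.

(** * The Cauchy and Poisson kernels *)

Definition den (s t : R) : C := (RtoC 1 - RtoC s * Cconj (cis t))%C.
Definition cauchy_kernel (s t : R) : C := (/ den s t)%C.
Definition poisson_kernel (s t : R) : R := (1 - s ^ 2) / Cmod (den s t) ^ 2.

Lemma den_ge s t : 0 <= s -> 1 - s <= Cmod (den s t).
Proof.
  move=> Hs.
  have := Cmod_triangle (den s t) (RtoC s * Cconj (cis t))%C.
  have -> : (den s t + RtoC s * Cconj (cis t) = RtoC 1)%C by rewrite /den; ring.
  rewrite Cmod_1 Cmod_mult Cmod_conj Cmod_cis Cmod_R Rabs_pos_eq //; lra.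
Qed.

Lemma den_nz s t : 0 <= s < 1 -> den s t <> RtoC 0.
Proof. move=> Hs. apply/Cmod_gt_0. have := den_ge s t; lra. Qed.

Lemma cont_den s t : ccont (den s) t.
Proof. rewrite /den; cont. Qed.

Lemma cont_cauchy s : 0 <= s < 1 -> forall t, ccont (cauchy_kernel s) t.
Proof.
  move=> Hs t. apply: ccont_inv; [exact: den_nz | exact: cont_den].
Qed.

Lemma Cmod_cauchy s t : 0 <= s < 1 -> Cmod (cauchy_kernel s t) <= / (1 - s).
Proof.
  move=> Hs. rewrite Cmod_inv; last exact: den_nz.
  apply: Rinv_le_contravar; [lra | apply: den_ge; lra].
Qed.

Lemma cauchy_step s t : 0 <= s < 1 ->
  cauchy_kernel s t = (RtoC 1 + RtoC s * Cconj (cis t) * cauchy_kernel s t)%C.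
Proof.
  move=> Hs. have D := den_nz s t Hs. rewrite /cauchy_kernel.
  transitivity ((den s t + RtoC s * Cconj (cis t)) * / den s t)%C.
  - have -> : (den s t + RtoC s * Cconj (cis t) = RtoC 1)%C by rewrite /den; ring. ring.
  - rewrite Cmult_plus_distr_r Cinv_r //.
Qed.

(** The kernel is the sum over [n >= 0] of [s^n e^-int]; only [n = 0] contributes. *)
Lemma avg_cauchy (g : R -> C) B s : 0 <= s < 1 -> (forall t, ccont g t) -> (forall t, Cmod (g t) <= B) ->
  (forall n, (0 < n)%nat -> avg (fun t => g t * Cconj (cis t) ^ n)%C = RtoC 0) ->
  avg (fun t => g t * cauchy_kernel s t)%C = avg g.
Proof.
  move=> Hs Hg HB H0. have Hc := cont_cauchy s Hs.
  pose u n := avg (fun t => g t * Cconj (cis t) ^ n * cauchy_kernel s t)%C.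
  have step n : u n = (avg (fun t => g t * Cconj (cis t) ^ n) + RtoC s * u (S n))%C.
  { rewrite /u -avg_scal -?avg_plus; try by cont.
    apply: avg_ext => t. rewrite {1}(cauchy_step s t Hs) Cpow_S; ring. }
  have E n : u O = (avg g + RtoC (s ^ S n) * u (S n))%C.
  { elim: n => [|n IH].
    - rewrite step /= Rmult_1_r; congr Cplus. apply: avg_ext => t; ring.
    - rewrite IH (step (S n)) H0; last lia. rewrite -(tech_pow_Rmult s (S n)) RtoC_mult; ring. }
  have Bu n : Cmod (u n) <= B * / (1 - s).
  { apply: Cmod_avg_le; first by cont.
    move=> t. rewrite !Cmod_mult Cmod_pow Cmod_conj Cmod_cis pow1 Rmult_1_r.
    apply: Rmult_le_compat => //; try exact: Cmod_ge_0. exact: Cmod_cauchy. }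
  have -> : avg (fun t => g t * cauchy_kernel s t)%C = u O.
  { apply: avg_ext => t; rewrite /=; ring. }
  apply/Ceq_minus. apply: Cmod_eq_0.
  apply: Rle_antisym; last exact: Cmod_ge_0.
  apply: le_epsilon => e He. rewrite Rplus_0_l.
  set D := B * / (1 - s) in Bu.
  have HD : 0 <= D := Rle_trans _ _ _ (Cmod_ge_0 _) (Bu O).
  have He' : 0 < e / (D + 1) by apply: Rdiv_lt_0_compat; lra.
  have Hsa : Rabs s < 1 by rewrite Rabs_pos_eq; lra.
  have [N HN] := pow_lt_1_zero s Hsa _ He'.
  rewrite (E N).
  have -> : (avg g + RtoC (s ^ S N) * u (S N) - avg g = RtoC (s ^ S N) * u (S N))%C by ring.
  rewrite Cmod_mult Cmod_R.
  have A := HN (S N) ltac:(lia). have A' := Rabs_pos (s ^ S N). have := Bu (S N). have := Cmod_ge_0 (u (S N)).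
  have -> : e = e / (D + 1) * (D + 1) by field; lra.
  nra.
Qed.

Lemma avg_cauchy_kernel s : 0 <= s < 1 -> avg (cauchy_kernel s) = RtoC 1.
Proof.
  move=> Hs.
  rewrite -(avg_const (RtoC 1)) -(avg_cauchy (fun _ => RtoC 1) 1 s) //.
  - apply: avg_ext => t; ring.
  - cont.
  - move=> t; rewrite Cmod_1; lra.
  - move=> n Hn. rewrite (avg_ext _ (fun t => Cconj (cis t ^ n))).
    + rewrite avg_conj; last by cont. rewrite avg_cis_pow //. by rewrite /Cconj /RtoC /= Ropp_0.
    + move=> t. rewrite Cpow_conj; ring.
Qed.

Lemma poissonE s t : 0 <= s < 1 ->
  RtoC (poisson_kernel s t) = (cauchy_kernel s t + Cconj (cauchy_kernel s t) - RtoC 1)%C.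
Proof.
  move=> Hs. have D := den_nz s t Hs.
  have D' : Cconj (den s t) <> RtoC 0.
  { apply/Cmod_gt_0. rewrite Cmod_conj. exact/Cmod_gt_0. }
  have Dm : Cmod (den s t) <> 0 by have := den_ge s t; lra.
  have E1 := cis_conj_mult t.
  have Cj x : Cconj (RtoC x) = RtoC x by rewrite /Cconj /RtoC /= Ropp_0.
  have Ed : Cconj (den s t) = (RtoC 1 - RtoC s * cis t)%C by rewrite /den Cminus_conj Cmult_conj Cconj_conj !Cj.
  rewrite /poisson_kernel /cauchy_kernel Cinv_conj // RtoC_div; last by apply: pow_nonzero.
  rewrite Cmod2_conj RtoC_minus RtoC_pow.
  have -> : (RtoC 1 - RtoC s ^ 2 = RtoC 1 - RtoC s ^ 2 * (cis t * Cconj (cis t)))%C by rewrite E1; ring.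
  rewrite Ed in D' *. move: D; rewrite /den => D. field. by split.
Qed.

Lemma cont_poisson s : 0 <= s < 1 -> forall t, rcont (poisson_kernel s) t.
Proof.
  move=> Hs t. have D := cont_den s. rewrite /poisson_kernel. cont.
  have := den_ge s t. nra.
Qed.

Lemma avg_poisson s : 0 <= s < 1 -> avg (fun t => RtoC (poisson_kernel s t)) = RtoC 1.
Proof.
  move=> Hs. have Hc := cont_cauchy s Hs.
  rewrite (avg_ext _ (fun t => (cauchy_kernel s t + Cconj (cauchy_kernel s t)) - RtoC 1)%C); last by move=> t; exact: poissonE.
  rewrite avg_minus; [|cont|cont]. rewrite avg_plus; [|cont|cont]. rewrite avg_conj //.
  rewrite avg_cauchy_kernel // avg_const. have -> : Cconj (RtoC 1) = RtoC 1 by rewrite /Cconj /RtoC /= Ropp_0. ring.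
Qed.

(** Every approximation below is an integral of a function bounded by the left-hand side.
    Since [|e^it - 1| <= 2 |den s t|], the bound [hpow_linear] for [|den s t|^2] at scale
    [1 - s] reduces it to the Poisson kernel, whose average is 1: this gives the rate
    [(1 - s)^(a / 2)] without any improper integral. *)
Lemma kernel_dom s t a : 0 <= s < 1 -> 0 < a < 1 ->
  hpow (Cmod (cis t - RtoC 1)%C) a * ((1 - s) / Cmod (den s t) ^ 2) <=
  2 * hpow (1 - s) (a / 2) * (poisson_kernel s t + 1).
Proof.
  move=> Hs Ha. set d := Cmod (den s t).
  have Hd : 1 - s <= d by apply: den_ge; lra.
  have H2 : Cmod (cis t - RtoC 1)%C <= 2 * d.
  { have -> : Cmod (cis t - RtoC 1)%C = Cmod (den s t + RtoC (- (1 - s)) * Cconj (cis t))%C.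
    { rewrite -Cmod_conj -Cmod_opp; congr Cmod.
      rewrite Cminus_conj /den RtoC_opp RtoC_minus.
      have -> : Cconj (RtoC 1) = RtoC 1 by rewrite /Cconj /RtoC /= Ropp_0. ring. }
    apply: (Rle_trans _ _ _ (Cmod_triangle _ _)).
    rewrite Cmod_mult Cmod_conj Cmod_cis Cmod_R Rabs_Ropp Rabs_pos_eq -/d; lra. }
  have H3 : hpow (Cmod (cis t - RtoC 1)%C) a <= 2 * (hpow (1 - s) (a / 2) * (1 + d ^ 2 / (1 - s))).
  { apply: (Rle_trans _ (hpow (2 * d) a)); first by apply: hpow_mono => //; lra.
    rewrite hpow_mult; [|lra|lra].
    have T : hpow 2 a <= 2.
    { rewrite -{2}(hpow_one 2); last lra. rewrite !hpowE; try lra. apply: Rle_Rpower; lra. }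
    rewrite -(hpow_sqr d); last lra.
    have L := hpow_linear (d ^ 2) (1 - s) (a / 2) ltac:(nra) ltac:(lra) ltac:(lra).
    apply: Rmult_le_compat => //; exact: hpow_ge0. }
  have Q : 0 <= (1 - s) / d ^ 2.
  { apply: Rmult_le_pos; first lra. left; apply: Rinv_0_lt_compat; nra. }
  apply: (Rle_trans _ (2 * (hpow (1 - s) (a / 2) * (1 + d ^ 2 / (1 - s))) * ((1 - s) / d ^ 2))).
  { exact: Rmult_le_compat_r. }
  have -> : 2 * (hpow (1 - s) (a / 2) * (1 + d ^ 2 / (1 - s))) * ((1 - s) / d ^ 2) =
    2 * hpow (1 - s) (a / 2) * ((1 - s) / d ^ 2 + 1) by field; lra.
  apply: Rmult_le_compat_l; first by have := hpow_ge0 (1 - s) (a / 2); lra.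
  apply: Rplus_le_compat_r. rewrite /poisson_kernel -/d.
  have -> : (1 - s ^ 2) / d ^ 2 = (1 - s) / d ^ 2 * (1 + s) by field; lra. nra.
Qed.

Lemma avg_kernel_dom (q : R -> C) B s a : 0 <= s < 1 -> 0 < a < 1 -> 0 <= B -> (forall t, ccont q t) ->
  (forall t, Cmod (q t) <= B * (hpow (Cmod (cis t - RtoC 1)%C) a * ((1 - s) / Cmod (den s t) ^ 2))) ->
  Cmod (avg q) <= 4 * B * hpow (1 - s) (a / 2).
Proof.
  move=> Hs Ha HB Hq H.
  have Hp := cont_poisson s Hs.
  set D := B * (2 * hpow (1 - s) (a / 2)).
  have := Cmod_avg_dom q (fun t => D * (poisson_kernel s t + 1)) Hq.
  rewrite (avg_ext (fun t => RtoC (D * (poisson_kernel s t + 1))) (fun t => RtoC D * (RtoC (poisson_kernel s t) + RtoC 1))%C);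
    last by move=> t; rewrite RtoC_mult RtoC_plus.
  rewrite avg_scal; last by cont. rewrite avg_plus; [|cont|cont]. rewrite avg_poisson // avg_const.
  move=> L. apply: (Rle_trans _ _ _ (L _ _)).
  - by cont.
  - move=> t. apply: (Rle_trans _ _ _ (H t)). rewrite /D Rmult_assoc.
    apply: Rmult_le_compat_l => //. exact: kernel_dom.
  - rewrite /D /=. right; ring.
Qed.

(** * The Cauchy transform in the angular variable *)

Definition cauchy_transform (f : C -> C) (s : R) (z : C) : C :=
  avg (fun t => f (z * cis t) * cauchy_kernel s t)%C.

Lemma annulus_rot r1 r2 z t : annulus r1 r2 z -> annulus r1 r2 (z * cis t)%C.
Proof. by rewrite /annulus Cmod_mult Cmod_cis Rmult_1_r. Qed.

Section Transform.
Variables (r1 r2 M a : R) (f : C -> C).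
Hypothesis hf : hol (annulus r1 r2) f M a.
Let HM := proj1 hf.
Let Ha := proj1 (proj2 hf).

Lemma cont_rot z : annulus r1 r2 z -> forall t, ccont (fun t => f (z * cis t)%C) t.
Proof.
  move=> Hz t. apply: (hol_ccont _ _ _ _ (fun t => z * cis t)%C _ hf); last by cont.
  move=> q; exact: annulus_rot.
Qed.

Lemma rot_diff z t : annulus r1 r2 z ->
  Cmod (f (z * cis t) - f z)%C <= M * hpow r2 a * hpow (Cmod (cis t - RtoC 1)%C) a.
Proof.
  move=> Hz. have [_ [_ H]] := hf.
  apply: (Rle_trans _ _ _ (H _ _ (annulus_rot _ _ _ _ Hz) Hz)).
  have -> : (z * cis t - z = z * (cis t - RtoC 1))%C by ring.
  rewrite Cmod_mult hpow_mult; try exact: Cmod_ge_0.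
  rewrite Rmult_assoc. apply: Rmult_le_compat_l => //.
  apply: Rmult_le_compat_r; first exact: hpow_ge0.
  apply: hpow_mono; [lra | exact: (proj2 Hz)].
Qed.

(** The Hoelder constant of [f] along rotations. *)
Definition rate_const : R := M * hpow r2 a.
Lemma rate_const_ge0 : 0 <= rate_const.
Proof. apply: Rmult_le_pos => //; exact: hpow_ge0. Qed.

(** The average of the Cauchy kernel is independent of [s], so that [f (z e^it)] may be
    replaced by [f (z e^it) - f z]; halving [1 - s] changes the kernel by at most
    [(1 - s) / |den s t|^2]. *)
Lemma cauchy_transform_step s z : 0 <= s < 1 -> annulus r1 r2 z ->
  Cmod (cauchy_transform f ((1 + s) / 2) z - cauchy_transform f s z)%C
    <= 4 * rate_const * hpow (1 - s) (a / 2).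
Proof.
  move=> Hs Hz. set s' := (1 + s) / 2.
  have Hs' : 0 <= s' < 1 by rewrite /s'; lra.
  have C1 := cont_cauchy s Hs. have C2 := cont_cauchy s' Hs'. have C3 := cont_rot z Hz.
  have -> : (cauchy_transform f s' z - cauchy_transform f s z)%C =
    avg (fun t => (f (z * cis t) - f z) * (cauchy_kernel s' t - cauchy_kernel s t))%C.
  { transitivity (avg (fun t => f (z * cis t) * cauchy_kernel s' t) - avg (fun t => f (z * cis t) * cauchy_kernel s t)
       - (f z * avg (cauchy_kernel s') - f z * avg (cauchy_kernel s)))%C.
    - rewrite !avg_cauchy_kernel // /cauchy_transform; ring.
    - rewrite -!avg_scal -?avg_minus; try by cont.
      apply: avg_ext => t; ring. }
  apply: avg_kernel_dom => //; first exact: rate_const_ge0.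
  { by cont. }
  move=> t. rewrite Cmod_mult.
  have K : Cmod (cauchy_kernel s' t - cauchy_kernel s t)%C <= (1 - s) / Cmod (den s t) ^ 2.
  { have D := den_nz s t Hs. have D' := den_nz s' t Hs'.
    have -> : (cauchy_kernel s' t - cauchy_kernel s t)%C = (RtoC (s' - s) * Cconj (cis t) * (/ den s' t * / den s t))%C.
    { rewrite /cauchy_kernel.
      have -> : (RtoC (s' - s) * Cconj (cis t) = den s t - den s' t)%C by rewrite /den RtoC_minus; ring.
      field; split => //. }
    rewrite !Cmod_mult Cmod_conj Cmod_cis Cmod_R Rabs_pos_eq; last by rewrite /s'; lra.
    rewrite !Cmod_inv //.
    set d := Cmod (den s t). set d' := Cmod (den s' t).
    have G : 1 - s <= d by apply: den_ge; lra.
    have G' : 1 - s' <= d' by apply: den_ge; lra.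
    have T : d <= 2 * d'.
    { apply: (Rle_trans _ (d' + (s' - s))); last by move: G'; rewrite /s'; lra.
      have -> : d = Cmod (den s' t + RtoC (s' - s) * Cconj (cis t))%C.
      { rewrite /d; congr Cmod. rewrite /den RtoC_minus; ring. }
      apply: (Rle_trans _ _ _ (Cmod_triangle _ _)).
      rewrite Cmod_mult Cmod_conj Cmod_cis Cmod_R Rabs_pos_eq; [rewrite -/d'; lra | rewrite /s'; lra]. }
    have -> : s' - s = (1 - s) / 2 by rewrite /s'; lra.
    have I : / d' <= 2 * / d.
    { have -> : 2 * / d = / (d / 2) by field; lra. apply: Rinv_le_contravar; lra. }
    have -> : (1 - s) / d ^ 2 = (1 - s) / 2 * (2 * / d * / d) by field; lra.
    rewrite Rmult_1_r. apply: Rmult_le_compat_l; first lra.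
    apply: Rmult_le_compat_r => //. left; apply: Rinv_0_lt_compat; lra. }
  rewrite -Rmult_assoc. apply: Rmult_le_compat => //; try exact: Cmod_ge_0. exact: rot_diff.
Qed.

Lemma poisson_approx s z : 0 <= s < 1 -> annulus r1 r2 z ->
  Cmod (avg (fun t => f (z * cis t) * RtoC (poisson_kernel s t)) - f z)%C
    <= 8 * rate_const * hpow (1 - s) (a / 2).
Proof.
  move=> Hs Hz.
  have C1 := cont_poisson s Hs. have C3 := cont_rot z Hz.
  have -> : (avg (fun t => f (z * cis t) * RtoC (poisson_kernel s t)) - f z)%C =
    avg (fun t => (f (z * cis t) - f z) * RtoC (poisson_kernel s t))%C.
  { transitivity (avg (fun t => f (z * cis t) * RtoC (poisson_kernel s t)) - f z * avg (fun t => RtoC (poisson_kernel s t)))%C.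
    - rewrite avg_poisson //; ring.
    - rewrite -!avg_scal -?avg_minus; try by cont.
      apply: avg_ext => t; ring. }
  have -> : 8 * rate_const = 4 * (2 * rate_const) by ring.
  have R0 := rate_const_ge0.
  apply: avg_kernel_dom => //; first lra.
  { by cont. }
  move=> t. rewrite Cmod_mult Cmod_R.
  have K : Rabs (poisson_kernel s t) <= 2 * ((1 - s) / Cmod (den s t) ^ 2).
  { have G := den_ge s t (proj1 Hs).
    have Q : 0 <= (1 - s) / Cmod (den s t) ^ 2.
    { apply: Rmult_le_pos; first lra. left; apply: Rinv_0_lt_compat; nra. }
    rewrite /poisson_kernel.
    have -> : (1 - s ^ 2) / Cmod (den s t) ^ 2 = (1 - s) / Cmod (den s t) ^ 2 * (1 + s) by field; lra.
    rewrite Rabs_pos_eq; nra. }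
  have -> : 2 * rate_const * (hpow (Cmod (cis t - RtoC 1)%C) a * ((1 - s) / Cmod (den s t) ^ 2)) =
    rate_const * hpow (Cmod (cis t - RtoC 1)%C) a * (2 * ((1 - s) / Cmod (den s t) ^ 2)) by ring.
  apply: Rmult_le_compat => //; [exact: Cmod_ge_0 | exact: Rabs_pos | exact: rot_diff].
Qed.

(** The transform averages over rotations, which are isometries. *)
Lemma cauchy_transform_lip s z w : 0 <= s < 1 -> annulus r1 r2 z -> annulus r1 r2 w ->
  Cmod (cauchy_transform f s z - cauchy_transform f s w)%C <= M * hpow (Cmod (z - w)%C) a * / (1 - s).
Proof.
  move=> Hs Hz Hw.
  have C1 := cont_cauchy s Hs. have C2 := cont_rot z Hz. have C3 := cont_rot w Hw.
  rewrite /cauchy_transform -avg_minus; [|cont|cont].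
  apply: Cmod_avg_le; first by cont.
  move=> t.
  have -> : (f (z * cis t) * cauchy_kernel s t - f (w * cis t) * cauchy_kernel s t = (f (z * cis t) - f (w * cis t)) * cauchy_kernel s t)%C by ring.
  rewrite Cmod_mult. apply: Rmult_le_compat; try exact: Cmod_ge_0; last exact: Cmod_cauchy.
  have [_ [_ H]] := hf.
  apply: (Rle_trans _ _ _ (H _ _ (annulus_rot _ _ _ _ Hz) (annulus_rot _ _ _ _ Hw))).
  have -> : (z * cis t - w * cis t = (z - w) * cis t)%C by ring.
  rewrite Cmod_mult Cmod_cis Rmult_1_r; lra.
Qed.
End Transform.

(** * The limit of the Cauchy transform *)

Definition climit (u : nat -> C) : C :=
  (real (Lim_seq (fun n => fst (u n))), real (Lim_seq (fun n => snd (u n)))).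

Lemma geometric_tail (u : nat -> R) D q : 0 <= D -> 0 < q < 1 ->
  (forall n, Rabs (u (S n) - u n) <= D * q ^ n) ->
  forall n, Rabs (real (Lim_seq u) - u n) <= D / (1 - q) * q ^ n.
Proof.
  move=> HD Hq H.
  have tail n m : Rabs (u (n + m)%nat - u n) <= D / (1 - q) * q ^ n * (1 - q ^ m).
  { elim: m => [|m IH].
    - rewrite Nat.add_0_r Rminus_eq_0 Rabs_R0 /=; lra.
    - rewrite Nat.add_succ_r.
      have -> : u (S (n + m)) - u n = (u (S (n + m)) - u (n + m)%nat) + (u (n + m)%nat - u n) by ring.
      apply: (Rle_trans _ _ _ (Rabs_triang _ _)).
      have := H (n + m)%nat. rewrite pow_add /= => Hn.
      have -> : D / (1 - q) * q ^ n * (1 - q * q ^ m) = D * (q ^ n * q ^ m) + D / (1 - q) * q ^ n * (1 - q ^ m) by field; lra.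
      lra. }
  have K0 : 0 <= D / (1 - q) by apply: Rmult_le_pos => //; left; apply: Rinv_0_lt_compat; lra.
  have qn n : 0 < q ^ n by apply: pow_lt; lra.
  have tail' n m : (n <= m)%nat -> Rabs (u m - u n) <= D / (1 - q) * q ^ n.
  { move=> Hnm. have -> : m = (n + (m - n))%nat by lia.
    apply: (Rle_trans _ _ _ (tail _ _)).
    have := qn n. have := qn (m - n)%nat => A B.
    have : 0 <= D / (1 - q) * q ^ n by nra. nra. }
  have ex : ex_finite_lim_seq u.
  { apply/ex_lim_seq_cauchy_corr => e.
    have He : 0 < e / (2 * (D / (1 - q)) + 1) by apply: Rdiv_lt_0_compat; [exact: cond_pos | lra].
    have Hqa : Rabs q < 1 by rewrite Rabs_pos_eq; lra.
    have [N HN] := pow_lt_1_zero q Hqa _ He.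
    exists N => n m Hn Hm.
    have A := HN N (le_n _). rewrite Rabs_pos_eq in A; last by left.
    have B : (2 * (D / (1 - q)) + 1) * (e / (2 * (D / (1 - q)) + 1)) = e by field; split; lra.
    have T1 := tail' N n Hn. have T2 := tail' N m Hm. rewrite Rabs_minus_sym in T2.
    have -> : u n - u m = (u n - u N) + (u N - u m) by ring.
    apply: (Rle_lt_trans _ _ _ (Rabs_triang _ _)). have := qn N. nra. }
  have L := Lim_seq_correct' _ ex.
  move=> n.
  have L2 : is_lim_seq (fun m => Rabs (u (n + m)%nat - u n)) (Rabs (real (Lim_seq u) - u n)).
  { apply: (is_lim_seq_abs _ (Finite (real (Lim_seq u) - u n))).
    apply: is_lim_seq_minus'; last exact: is_lim_seq_const.
    apply: (is_lim_seq_ext (fun m => u (m + n)%nat)); first by move=> m; rewrite Nat.add_comm.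
    exact: (proj1 (is_lim_seq_incr_n u n _) L). }
  apply: (is_lim_seq_le _ (fun _ => D / (1 - q) * q ^ n) (Finite _) (Finite _) _ L2 (is_lim_seq_const _)).
  move=> m; apply: tail'; lia.
Qed.

Lemma climit_tail (u : nat -> C) D q : 0 <= D -> 0 < q < 1 ->
  (forall n, Cmod (u (S n) - u n)%C <= D * q ^ n) ->
  forall n, Cmod (climit u - u n)%C <= 2 * (D / (1 - q)) * q ^ n.
Proof.
  move=> HD Hq H n.
  have A1 k : Rabs (fst (u (S k)) - fst (u k)) <= D * q ^ k.
  { apply: (Rle_trans _ _ _ _ (H k)). apply: (Rle_trans _ _ _ _ (Rmax_Cmod _)). exact: Rmax_l. }
  have A2 k : Rabs (snd (u (S k)) - snd (u k)) <= D * q ^ k.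
  { apply: (Rle_trans _ _ _ _ (H k)). apply: (Rle_trans _ _ _ _ (Rmax_Cmod _)). exact: Rmax_r. }
  have B1 := geometric_tail (fun k => fst (u k)) D q HD Hq A1 n.
  have B2 := geometric_tail (fun k => snd (u k)) D q HD Hq A2 n.
  have sum (c : C) : Cmod c <= Rabs (fst c) + Rabs (snd c).
  { have -> : c = (RtoC (fst c) + RtoC (snd c) * Ci)%C.
    { case: c => x y; rewrite /Cplus /Cmult /RtoC /Ci /=; congr pair; ring. }
    apply: (Rle_trans _ _ _ (Cmod_triangle _ _)).
    rewrite Cmod_mult Cmod_Ci !Cmod_R /=. right.
    rewrite Rmult_1_r; congr Rplus; congr Rabs; ring. }
  apply: (Rle_trans _ _ _ (sum _)). simpl in *. unfold Rminus in *. lra.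
Qed.

(** The radii along which the limit is taken: [1 - s] is halved at each step. *)
Definition dyadic (j : nat) : R := 1 - (/ 2) ^ j.

Lemma dyadic_range j : 0 <= dyadic j < 1.
Proof.
  rewrite /dyadic. have : 0 < (/ 2) ^ j by apply: pow_lt; lra.
  have : (/ 2) ^ j <= 1 by rewrite -(pow1 j); apply: pow_incr; lra. lra.
Qed.

Lemma dyadic_S j : dyadic (S j) = (1 + dyadic j) / 2.
Proof. rewrite /dyadic /=; field. Qed.

(** The part of [f] with nonnegative angular frequencies. *)
Definition analytic_part (f : C -> C) (z : C) : C :=
  climit (fun j => cauchy_transform f (dyadic j) z).

Section Limit.
Variables (r1 r2 M a : R) (f : C -> C).
Hypothesis hf : hol (annulus r1 r2) f M a.
Let HM := proj1 hf.
Let Ha := proj1 (proj2 hf).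

Definition ratio : R := hpow (/ 2) (a / 2).
Lemma ratio_range : 0 < ratio < 1.
Proof. rewrite /ratio; split; [apply: hpow_gt0; lra | apply: hpow_lt1; lra]. Qed.

Lemma ratio_pow j : ratio ^ j = hpow ((/ 2) ^ j) (a / 2).
Proof. rewrite /ratio hpow_pow //; lra. Qed.

Definition limit_const : R := 2 * (4 * rate_const r2 M a / (1 - ratio)).

Lemma limit_const_ge0 : 0 <= limit_const.
Proof.
  have R0 := rate_const_ge0 _ _ _ _ _ hf. have Q := ratio_range.
  have : 0 <= 4 * rate_const r2 M a / (1 - ratio).
  { apply: Rmult_le_pos; first lra. left; apply: Rinv_0_lt_compat; lra. }
  rewrite /limit_const; lra.
Qed.

Lemma analytic_part_tail z j : annulus r1 r2 z ->
  Cmod (analytic_part f z - cauchy_transform f (dyadic j) z)%C <= limit_const * ratio ^ j.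
Proof.
  move=> Hz. have R0 := rate_const_ge0 _ _ _ _ _ hf.
  apply: (climit_tail (fun j => cauchy_transform f (dyadic j) z)); [lra | exact: ratio_range |].
  move=> n. rewrite dyadic_S ratio_pow.
  have := cauchy_transform_step _ _ _ _ _ hf (dyadic n) z (dyadic_range n) Hz.
  have -> : 1 - dyadic n = (/ 2) ^ n by rewrite /dyadic; ring. by [].
Qed.

Lemma dyadic_scale h : 0 < h <= 1 -> exists j, (/ 2) ^ j <= h /\ h <= 2 * (/ 2) ^ j.
Proof.
  move=> [H0 H1].
  have [N HN] := pow_lt_1_zero (/ 2) ltac:(rewrite Rabs_pos_eq; lra) h H0.
  have : (/ 2) ^ N <= h.
  { have := HN N (le_n _). rewrite Rabs_pos_eq; first lra. apply: pow_le; lra. }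
  clear HN. elim: N => [|N IH] H.
  - exists O => /=. move: H => /=; lra.
  - case: (Rle_dec ((/ 2) ^ N) h) => [/IH //|Hn]. exists (S N). split => //. move=> /=. lra.
Qed.

(** For [h = |z - w|], the approximation of index [j] has error [ratio ^ j] and
    oscillation at most [h^a 2^j]; both are [O(h^(a^2 / 4))] when [2^-j] is of the
    order of [h^(a / 2)]. *)
Lemma analytic_part_hol : exists M', hol (annulus r1 r2) (analytic_part f) M' (a * a / 4).
Proof.
  have L0 := limit_const_ge0. have HM' := HM. have Ha' := Ha.
  have hb := hpow_ge0 (2 * r2) a.
  exists (2 * limit_const + 2 * M + M * hpow (2 * r2) a).
  split; first nra. split; first nra.
  move=> z w Hz Hw.
  set h := Cmod (z - w)%C. have Hh : 0 <= h := Cmod_ge_0 _.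
  have main j : Cmod (analytic_part f z - analytic_part f w)%C <= 2 * (limit_const * ratio ^ j) + M * hpow h a * 2 ^ j.
  { have A := analytic_part_tail z j Hz. have B := analytic_part_tail w j Hw.
    have Cc := cauchy_transform_lip _ _ _ _ _ hf (dyadic j) z w (dyadic_range j) Hz Hw.
    have E : / (1 - dyadic j) = 2 ^ j.
    { rewrite /dyadic. have -> : 1 - (1 - (/ 2) ^ j) = (/ 2) ^ j by ring. rewrite pow_inv Rinv_inv //. }
    rewrite E -/h in Cc.
    have -> : (analytic_part f z - analytic_part f w)%C =
      ((analytic_part f z - cauchy_transform f (dyadic j) z) +
       ((cauchy_transform f (dyadic j) z - cauchy_transform f (dyadic j) w) +
       - (analytic_part f w - cauchy_transform f (dyadic j) w)))%C by ring.
    apply: (Rle_trans _ _ _ (Cmod_triangle _ _)).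
    have := Cmod_triangle (cauchy_transform f (dyadic j) z - cauchy_transform f (dyadic j) w)
       (- (analytic_part f w - cauchy_transform f (dyadic j) w)).
    rewrite Cmod_opp. lra. }
  case: (Req_dec h 0) => [H0|Hn0].
  { have -> : z = w by apply/Ceq_minus; exact: Cmod_eq_0.
    have -> : (analytic_part f w - analytic_part f w = RtoC 0)%C by ring.
    rewrite Cmod_0. apply: Rmult_le_pos; [nra | exact: hpow_ge0]. }
  case: (Rle_dec h 1) => Hh1.
  - have Hhb : 0 < hpow h (a / 2) <= 1 by split; [apply: hpow_gt0; lra | apply: hpow_le1; lra].
    have [j [J1 J2]] := dyadic_scale _ Hhb.
    apply: (Rle_trans _ _ _ (main j)).
    have E1 : ratio ^ j <= hpow h (a * a / 4).
    { rewrite ratio_pow. apply: (Rle_trans _ (hpow (hpow h (a / 2)) (a / 2))); first by apply: hpow_mono; lra.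
      rewrite hpow_hpow. right; congr hpow; field. }
    have E2 : hpow h a * 2 ^ j <= 2 * hpow h (a * a / 4).
    { have -> : hpow h a = hpow h (a / 2) * hpow h (a / 2) by rewrite hpow_plus; congr hpow; field.
      have F : hpow h (a / 2) <= hpow h (a * a / 4) by apply: hpow_anti; [nra | lra].
      have G : hpow h (a / 2) * 2 ^ j <= 2.
      { have P2 : 0 < 2 ^ j by apply: pow_lt; lra.
        have : (/ 2) ^ j * 2 ^ j = 1 by rewrite -Rpow_mult_distr Rinv_l ?pow1 //; lra. nra. }
      have := hpow_ge0 h (a * a / 4). have := hpow_ge0 h (a / 2). nra. }
    have E3 := hpow_ge0 h (a * a / 4).
    have : 0 <= M * hpow (2 * r2) a by nra. nra.
  - have := main O. rewrite /= !Rmult_1_r => B. apply: (Rle_trans _ _ _ B).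
    have G1 : 1 <= hpow h (a * a / 4) by apply: hpow_ge1; nra.
    have G2 : hpow h a <= hpow (2 * r2) a.
    { apply: hpow_mono; first lra. rewrite /h. apply: (Rle_trans _ _ _ (Cmod_triangle _ _)).
      rewrite Cmod_opp. have := proj2 Hz. have := proj2 Hw. lra. }
    have : 0 <= M * hpow (2 * r2) a by nra. have : M * hpow h a <= M * hpow (2 * r2) a by nra. nra.
Qed.
End Limit.

Lemma geometric_zero (c : C) D q : 0 <= D -> 0 < q < 1 -> (forall j, Cmod c <= D * q ^ j) -> c = RtoC 0.
Proof.
  move=> HD Hq H. apply: Cmod_eq_0. apply: Rle_antisym; last exact: Cmod_ge_0.
  apply: le_epsilon => e He. rewrite Rplus_0_l.
  have He' : 0 < e / (D + 1) by apply: Rdiv_lt_0_compat; lra.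
  have Hqa : Rabs q < 1 by rewrite Rabs_pos_eq; lra.
  have [N HN] := pow_lt_1_zero q Hqa _ He'.
  have A := HN N (le_n _). have A' := Rle_abs (q ^ N).
  apply: (Rle_trans _ _ _ (H N)).
  have -> : e = e / (D + 1) * (D + 1) by field; lra. 
  have : 0 <= q ^ N by apply: pow_le; lra. nra.
Qed.

Lemma ccont_limit_zero (g : R -> C) : ccont g 1 -> (forall l, 0 <= l < 1 -> g l = RtoC 0) -> g 1 = RtoC 0.
Proof.
  move=> Hg H. case: (Ceq_dec (g 1) (RtoC 0)) => // /Cmod_gt_0 Hn. exfalso.
  have [d Hd] := ccont_locally g 1 _ Hg Hn.
  have Hm : 0 < Rmin d 1 by apply: Rmin_glb_lt; [exact: cond_pos | lra].
  have L1 := Rmin_l d 1. have L2 := Rmin_r d 1.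
  have : Cmod (g (1 - Rmin d 1 / 2)%R - g 1)%C < Cmod (g 1).
  { apply: Hd. rewrite /ball /= /AbsRing_ball /= /abs /minus /plus /opp /=.
    rewrite Rabs_left; lra. }
  rewrite H; last lra.
  have -> : (RtoC 0 - g 1 = - g 1)%C by ring. rewrite Cmod_opp; lra.
Qed.

Lemma rcont_Rmin {T : UniformSpace} (f g : T -> R) p : rcont f p -> rcont g p -> rcont (fun x => Rmin (f x) (g x)) p.
Proof.
  move=> Hf Hg. apply: (rcont_ext (fun x => (f x + g x - Rabs (f x - g x)) / 2)).
  - move=> x. rewrite /Rmin. case: Rle_dec => H; [rewrite Rabs_left1 | rewrite Rabs_pos_eq]; lra.
  - rewrite /Rdiv. cont. apply: (rcont_comp Rabs); first exact: continuous_Rabs. by cont.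
Qed.

Lemma rcont_Rmax {T : UniformSpace} (f g : T -> R) p : rcont f p -> rcont g p -> rcont (fun x => Rmax (f x) (g x)) p.
Proof.
  move=> Hf Hg. apply: (rcont_ext (fun x => (f x + g x + Rabs (f x - g x)) / 2)).
  - move=> x. rewrite /Rmax. case: Rle_dec => H; [rewrite Rabs_left1 | rewrite Rabs_pos_eq]; lra.
  - rewrite /Rdiv. cont. apply: (rcont_comp Rabs); first exact: continuous_Rabs. by cont.
Qed.

(** * Moments on circles surrounding the origin *)

Lemma circle_cis a rho t : 0 < rho -> circle a rho (a + RtoC rho * cis t)%C.
Proof.
  move=> H. rewrite /circle.
  have -> : (a + RtoC rho * cis t - a = RtoC rho * cis t)%C by ring.
  rewrite Cmod_mult Cmod_cis Cmod_R Rabs_pos_eq; lra.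
Qed.

Lemma circle_around_0_range r1 r2 a rho : circle_around_0_in (annulus r1 r2) a rho ->
  0 < rho /\ Cmod a < rho /\ r1 <= rho - Cmod a /\ rho + Cmod a <= r2.
Proof.
  move=> [H0 [HA Hd]].
  have Hd' : Cmod a < rho.
  { move: Hd. rewrite /Defs.disc. have -> : (RtoC 0 - a = - a)%C by ring. by rewrite Cmod_opp. }
  have Hc := Cmod_ge_0 a.
  split => //; split => //.
  have [t Ht] := polar a.
  split.
  - have [L _] : annulus r1 r2 (RtoC (Cmod a - rho) * cis t)%C.
    { apply: HA. rewrite /circle {2}Ht.
      have -> : (RtoC (Cmod a - rho) * cis t - RtoC (Cmod a) * cis t = RtoC (- rho) * cis t)%C.
      { rewrite RtoC_minus RtoC_opp; ring. }
      rewrite Cmod_mult Cmod_cis Cmod_R Rabs_Ropp Rabs_pos_eq; lra. }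
    rewrite Cmod_mult Cmod_cis Cmod_R Rabs_left in L; lra.
  - have [_ L] : annulus r1 r2 (RtoC (Cmod a + rho) * cis t)%C.
    { apply: HA. rewrite /circle {2}Ht.
      have -> : (RtoC (Cmod a + rho) * cis t - RtoC (Cmod a) * cis t = RtoC rho * cis t)%C.
      { rewrite RtoC_plus; ring. }
      rewrite Cmod_mult Cmod_cis Cmod_R Rabs_pos_eq; lra. }
    rewrite Cmod_mult Cmod_cis Cmod_R Rabs_pos_eq in L; lra.
Qed.

Lemma range_circle_around_0 r1 r2 a rho : 0 < rho -> Cmod a < rho -> r1 <= rho - Cmod a -> rho + Cmod a <= r2 ->
  circle_around_0_in (annulus r1 r2) a rho.
Proof.
  move=> H0 H1 H2 H3. split => //; split.
  - move=> z Hz. rewrite /circle in Hz. split.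
    + have := Cmod_triangle (a - z)%C z.
      have -> : (a - z + z = a)%C by ring.
      have := Cmod_triangle (z - a)%C (- a)%C. have := Cmod_triangle z (- a)%C.
      rewrite Cmod_opp. have : Cmod (z + - a)%C = rho by rewrite -Hz. lra.
    + have := Cmod_triangle (z - a)%C a. have -> : (z - a + a = z)%C by ring. lra.
  - rewrite /Defs.disc. have -> : (RtoC 0 - a = - a)%C by ring. by rewrite Cmod_opp.
Qed.

Section Moments.
Variables (r1 r2 M al : R) (f : C -> C).
Hypothesis (hr1 : 0 < r1) (hr12 : r1 < r2).
Hypothesis hf : hol (annulus r1 r2) f M al.
Hypothesis hmean : forall a rho, circle_around_0_in (annulus r1 r2) a rho ->
  circle_mean f a rho = RtoC 0.

Lemma hmean_avg a rho : circle_around_0_in (annulus r1 r2) a rho ->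
  avg (fun t => f (a + RtoC rho * cis t)%C) = RtoC 0.
Proof. exact: hmean. Qed.

Lemma cont_circle g M' al' a rho : hol (annulus r1 r2) g M' al' ->
  circle_around_0_in (annulus r1 r2) a rho -> forall t, ccont (fun t => g (a + RtoC rho * cis t)%C) t.
Proof.
  move=> Hg [H0 [HA _]] t. apply: (hol_ccont _ _ _ _ (fun t => a + RtoC rho * cis t)%C _ Hg); last by cont.
  move=> q. apply: HA; exact: circle_cis.
Qed.

Lemma mean_rot z : annulus r1 r2 z -> avg (fun t => f (z * cis t)%C) = RtoC 0.
Proof.
  move=> Hz. have [tau Ht] := polar z.
  have Hz0 : 0 < Cmod z by case: Hz; lra.
  have adm : circle_around_0_in (annulus r1 r2) (RtoC 0) (Cmod z).
  { apply: range_circle_around_0; rewrite ?Cmod_0; try lra; case: Hz; lra. }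
  rewrite -(hmean_avg _ _ adm).
  rewrite -(avg_shift (fun t => f (RtoC 0 + RtoC (Cmod z) * cis t)%C) tau).
  - apply: avg_ext => t. congr f. rewrite cis_plus {1}Ht; ring.
  - exact: cont_circle hf adm.
  - move=> t; by rewrite cis_period.
Qed.

(** The component of [f] of angular frequency [n]. *)
Definition ang_part (n : nat) (z : C) : C := avg (fun t => f (z * cis t) * Cconj (cis t) ^ n)%C.

(** Clamping makes [radial] continuous on the whole line, so that it can be averaged over
    dilations. *)
Definition clamp_radius (s : R) : R := Rmax r1 (Rmin (sqrt s) r2).

Definition radial (n : nat) (s : R) : C :=
  (ang_part n (RtoC (clamp_radius s)) * / RtoC (clamp_radius s) ^ n)%C.

Lemma clamp_range s : r1 <= clamp_radius s <= r2.
Proof.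
  rewrite /clamp_radius; split; first exact: Rmax_l.
  apply: Rmax_lub; [lra | exact: Rmin_r].
Qed.

Lemma clamp_annulus s : annulus r1 r2 (RtoC (clamp_radius s)).
Proof. rewrite /annulus Cmod_R. have := clamp_range s. move=> H; rewrite Rabs_pos_eq; lra. Qed.

Lemma clamp_sqr r : r1 <= r <= r2 -> clamp_radius (r ^ 2) = r.
Proof.
  move=> H. rewrite /clamp_radius sqrt_pow2; last lra.
  rewrite Rmin_left; last lra. rewrite Rmax_right; lra.
Qed.

Lemma cont_clamp s : rcont clamp_radius s.
Proof.
  apply: rcont_Rmax; first exact: rcont_const. apply: rcont_Rmin; last exact: rcont_const.
  exact: continuous_sqrt.
Qed.

Lemma cont_radial n s : ccont (radial n) s.
Proof.
  have Cc := cont_clamp.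
  apply: ccont_mult.
  - apply: (ccont_avg_param (fun s t => f (RtoC (clamp_radius s) * cis t) * Cconj (cis t) ^ n)%C) => p.
    apply: ccont_mult; last by cont.
    apply: (hol_ccont _ _ _ _ (fun q : R2 => RtoC (clamp_radius (fst q)) * cis (snd q))%C _ hf); last by cont.
    move=> q; apply: annulus_rot; exact: clamp_annulus.
  - cont. apply: Cpow_nz => [[]]. have := clamp_range s; lra.
Qed.

Lemma ang_part_rot n z tau : annulus r1 r2 z -> ang_part n (z * cis tau)%C = (cis tau ^ n * ang_part n z)%C.
Proof.
  move=> Hz. have Cr := cont_rot _ _ _ _ _ hf z Hz.
  rewrite /ang_part -avg_scal; last by cont.
  rewrite -[RHS](avg_shift _ tau).
  - apply: avg_ext => t. rewrite !cis_plus.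
    have E : (cis tau ^ n * Cconj (cis t * cis tau) ^ n = Cconj (cis t) ^ n)%C.
    { rewrite -Cpow_mult_l; congr Cpow. rewrite Cmult_conj.
      transitivity (Cconj (cis t) * (cis tau * Cconj (cis tau)))%C; first by ring.
      rewrite cis_conj_mult; ring. }
    have -> : (z * (cis t * cis tau) = z * cis tau * cis t)%C by ring.
    rewrite -{1}E; ring.
  - cont.
  - move=> t; by rewrite cis_period.
Qed.

Lemma ang_partE n z : annulus r1 r2 z -> ang_part n z = (radial n (Cmod z ^ 2)%R * z ^ n)%C.
Proof.
  move=> Hz. have [tau Ht] := polar z.
  have Hz0 : 0 < Cmod z by case: Hz; lra.
  have Hzc : annulus r1 r2 (RtoC (Cmod z)) by rewrite /annulus Cmod_R Rabs_pos_eq //; lra.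
  rewrite /radial clamp_sqr //.
  rewrite {1}Ht ang_part_rot // {4}Ht Cpow_mult_l.
  have N : (RtoC (Cmod z) ^ n)%C <> RtoC 0 by apply: Cpow_nz => [[]]; lra.
  field. exact: N.
Qed.

Lemma cont_ang_circle n a rho : circle_around_0_in (annulus r1 r2) a rho ->
  forall t, ccont (fun t => ang_part n (a + RtoC rho * cis t)%C) t.
Proof.
  move=> [H0 [HA _]] t.
  apply: (ccont_avg_param (fun t u => f ((a + RtoC rho * cis t) * cis u) * Cconj (cis u) ^ n)%C) => p.
  apply: ccont_mult; last by cont.
  apply: (hol_ccont _ _ _ _ (fun q : R2 => (a + RtoC rho * cis (fst q)) * cis (snd q))%C _ hf); last by cont.
  move=> q; apply: annulus_rot. apply: HA; exact: circle_cis.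
Qed.

(** The component is an average of rotates of [f], and a rotation maps circles
    surrounding the origin in the annulus to such circles. *)
Lemma ang_part_mean n a rho : circle_around_0_in (annulus r1 r2) a rho ->
  avg (fun t => ang_part n (a + RtoC rho * cis t)%C) = RtoC 0.
Proof.
  move=> Ha. have [H0 [H1 [H2 H3]]] := circle_around_0_range _ _ _ _ Ha.
  have HA := proj1 (proj2 Ha).
  rewrite /ang_part avg_swap.
  - rewrite (avg_ext _ (fun _ => RtoC 0)); first exact: avg_const.
    move=> u.
    have adm : circle_around_0_in (annulus r1 r2) (a * cis u)%C rho.
    { apply: range_circle_around_0 => //; rewrite Cmod_mult Cmod_cis Rmult_1_r //. }
    have Cc := cont_circle f _ _ _ _ hf adm.
    rewrite (avg_ext _ (fun t => Cconj (cis u) ^ n * (fun t => f (a * cis u + RtoC rho * cis t)) (t + u)%R)%C).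
    + rewrite avg_scal.
      * rewrite (avg_shift (fun t => f (a * cis u + RtoC rho * cis t)%C)) //; last by move=> t; rewrite cis_period.
        rewrite hmean_avg //; ring.
      * move=> t. apply: (ccont_comp (fun t => f (a * cis u + RtoC rho * cis t)%C)) => //. by cont.
    + move=> t. rewrite cis_plus.
      have -> : ((a + RtoC rho * cis t) * cis u = a * cis u + RtoC rho * (cis t * cis u))%C by ring. ring.
  - move=> p. apply: ccont_mult; last by cont.
    apply: (hol_ccont _ _ _ _ (fun q : R2 => (a + RtoC rho * cis (fst q)) * cis (snd q))%C _ hf); last by cont.
    move=> q; apply: annulus_rot. apply: HA; exact: circle_cis.
Qed.

Lemma pt_annulus x r t : r1 <= r - Rabs x -> r + Rabs x <= r2 -> annulus r1 r2 (pt x r t).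
Proof.
  move=> H1 H2. have := Rabs_pos x => Hx.
  have adm : circle_around_0_in (annulus r1 r2) (RtoC x) r.
  { apply: range_circle_around_0; rewrite ?Cmod_R; lra. }
  apply: (proj1 (proj2 adm)). apply: circle_cis; lra.
Qed.

Lemma ang_part_pt n x r t : r1 <= r - Rabs x -> r + Rabs x <= r2 ->
  ang_part n (pt x r t) = (radial n (sq x r t) * pt x r t ^ n)%C.
Proof. move=> H1 H2. rewrite ang_partE ?sq_Cmod //. exact: pt_annulus. Qed.

Lemma radial_mom_open n k x r : admissible r1 r2 x r -> mom (radial n) n k x r = RtoC 0.
Proof.
  apply: (mom_zero_cont _ (cont_radial n) n r1 r2); first lra.
  move=> {}x {}r [H1 H2]. have Hx := Rabs_pos x.
  have adm : circle_around_0_in (annulus r1 r2) (RtoC x) r.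
  { apply: range_circle_around_0; rewrite ?Cmod_R; lra. }
  rewrite -(ang_part_mean n _ _ adm).
  apply: avg_ext => t. rewrite -/(pt x r t) ang_part_pt; [|lra|lra]. rewrite /=; ring.
Qed.

(** A circle touching the boundary of the annulus is the limit of the interior circles
    obtained by moving towards the circle centred at the origin of radius [m]. *)
Lemma radial_mom n k x r : r1 <= r - Rabs x -> r + Rabs x <= r2 -> mom (radial n) n k x r = RtoC 0.
Proof.
  move=> H1 H2. have Cr := cont_radial n.
  set m := (r1 + r2) / 2.
  have := ccont_limit_zero (fun l => mom (radial n) n k (l * x) (l * r + (1 - l) * m)).
  rewrite !Rmult_1_l Rminus_eq_0 Rmult_0_l Rplus_0_r; apply.
  - apply: (ccont_avg_param (fun l t => radial n (sq (l * x) (l * r + (1 - l) * m) t) * pt (l * x) (l * r + (1 - l) * m) t ^ n * cis t ^ k)%C).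
    move=> p. rewrite /sq /pt. by cont.
  - move=> l Hl. apply: radial_mom_open. rewrite /admissible Rabs_mult (Rabs_pos_eq l) /m; last lra.
    split; nra.
Qed.

(** Rotating the centre to the real axis multiplies the moment by a power of
    [e^iu]. *)
Lemma ang_part_mom n k a rho : circle_around_0_in (annulus r1 r2) a rho ->
  avg (fun t => ang_part n (a + RtoC rho * cis t) * cis t ^ k)%C = RtoC 0.
Proof.
  move=> Ha. have [H0 [H1 [H2 H3]]] := circle_around_0_range _ _ _ _ Ha.
  have Cc := cont_ang_circle n _ _ Ha.
  have [tau Ht] := polar a.
  have Hx : Rabs (Cmod a) = Cmod a by apply: Rabs_pos_eq; exact: Cmod_ge_0.
  rewrite -(avg_shift _ tau); last first.
  { move=> t; by rewrite cis_period. }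
  { by cont. }
  rewrite (avg_ext _ (fun t => cis tau ^ (n + k) * (radial n (sq (Cmod a) rho t) * pt (Cmod a) rho t ^ n * cis t ^ k))%C).
  - rewrite avg_scal.
    + have := radial_mom n k (Cmod a) rho. rewrite /mom Hx => ->; [ring | done | done].
    + move=> t. have Cr := cont_radial n. rewrite /sq /pt. by cont.
  - move=> t. rewrite cis_plus.
    have -> : (a + RtoC rho * (cis t * cis tau) = pt (Cmod a) rho t * cis tau)%C by rewrite {1}Ht /pt; ring.
    rewrite ang_part_rot; last by apply: pt_annulus; rewrite Hx.
    rewrite ang_part_pt ?Hx //. rewrite Cpow_mult_l Cpow_add_r; ring.
Qed.

Lemma hol_bounded : exists B, forall z, annulus r1 r2 z -> Cmod (f z) <= B.
Proof.
  have [HM [Ha H]] := hf.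
  exists (Cmod (f (RtoC r1)) + M * hpow (2 * r2) al) => z Hz.
  have H1 : annulus r1 r2 (RtoC r1) by rewrite /annulus Cmod_R Rabs_pos_eq; lra.
  have -> : f z = (f (RtoC r1) + (f z - f (RtoC r1)))%C by ring.
  apply: (Rle_trans _ _ _ (Cmod_triangle _ _)). apply: Rplus_le_compat_l.
  apply: (Rle_trans _ _ _ (H _ _ Hz H1)). apply: Rmult_le_compat_l => //.
  apply: hpow_mono; first lra. apply: (Rle_trans _ _ _ (Cmod_triangle _ _)).
  rewrite Cmod_opp. case: Hz; case: H1; lra.
Qed.

(** As a function of the rotation angle, the moment has no component of frequency
    [n >= 0], and the Cauchy kernel only sees those. *)
Lemma cauchy_transform_mom s k a rho : 0 <= s < 1 -> circle_around_0_in (annulus r1 r2) a rho ->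
  avg (fun t => cauchy_transform f s (a + RtoC rho * cis t) * cis t ^ k)%C = RtoC 0.
Proof.
  move=> Hs Ha. have HA := proj1 (proj2 Ha). have H0 := proj1 Ha.
  have [B HB] := hol_bounded.
  have Hin t : annulus r1 r2 (a + RtoC rho * cis t)%C by apply: HA; exact: circle_cis.
  have C2 : forall p : R2, ccont (fun q : R2 => f ((a + RtoC rho * cis (fst q)) * cis (snd q))%C) p.
  { move=> p. apply: (hol_ccont _ _ _ _ (fun q : R2 => (a + RtoC rho * cis (fst q)) * cis (snd q))%C _ hf); last by cont.
    move=> q; exact: annulus_rot. }
  have Ck := cont_cauchy s Hs.
  pose G u := avg (fun t => f ((a + RtoC rho * cis t) * cis u) * cis t ^ k)%C.
  have cG : forall u, ccont G u.
  { apply: (ccont_avg_param (fun u t => f ((a + RtoC rho * cis t) * cis u) * cis t ^ k)%C).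
    apply: (ccont2_swap (fun t u => f ((a + RtoC rho * cis t) * cis u) * cis t ^ k)%C) => p. by cont. }
  have slice u : forall t, ccont (fun t => f ((a + RtoC rho * cis t) * cis u)%C) t.
  { move=> t. exact: (ccont_slice_l (fun t u => f ((a + RtoC rho * cis t) * cis u)%C) t u (C2 (t, u))). }
  have slice' t : forall u, ccont (fun u => f ((a + RtoC rho * cis t) * cis u)%C) u.
  { move=> u. exact: (ccont_slice_r (fun t u => f ((a + RtoC rho * cis t) * cis u)%C) t u (C2 (t, u))). }
  (* used both for the Cauchy kernel and for the pure frequencies *)
  have exch (g : R -> C) : (forall u, ccont g u) ->
    avg (fun t => avg (fun u => f ((a + RtoC rho * cis t) * cis u) * g u) * cis t ^ k)%C = avg (fun u => G u * g u)%C.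
  { move=> Hg.
    rewrite (avg_ext _ (fun t => avg (fun u => f ((a + RtoC rho * cis t) * cis u) * g u * cis t ^ k)%C)).
    - rewrite avg_swap; last by move=> p; cont.
      apply: avg_ext => u. rewrite /G.
      transitivity (g u * avg (fun t => f ((a + RtoC rho * cis t) * cis u) * cis t ^ k))%C; last by ring.
      rewrite -avg_scal; last by (have := slice u => S; cont). apply: avg_ext => t; ring.
    - move=> t. have S := slice' t. rewrite Cmult_comm -avg_scal; last by cont. apply: avg_ext => u; ring. }
  rewrite (exch (cauchy_kernel s)) //.
  have Hn n : avg (fun u => G u * Cconj (cis u) ^ n)%C = RtoC 0.
  { rewrite -(exch (fun u => Cconj (cis u) ^ n)%C); last by cont. exact: ang_part_mom. }
  rewrite (avg_cauchy G B) //.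
  - rewrite -(Hn O). apply: avg_ext => u; rewrite /=; ring.
  - move=> u. apply: Cmod_avg_le; first by (have S := slice u; cont).
    move=> t. rewrite Cmod_mult Cmod_pow Cmod_cis pow1 Rmult_1_r. apply: HB; exact: annulus_rot.
Qed.

Lemma analytic_part_mom k a rho : circle_around_0_in (annulus r1 r2) a rho ->
  avg (fun t => analytic_part f (a + RtoC rho * cis t) * cis t ^ k)%C = RtoC 0.
Proof.
  move=> Ha. have HA := proj1 (proj2 Ha). have H0 := proj1 Ha.
  have Hin t : annulus r1 r2 (a + RtoC rho * cis t)%C by apply: HA; exact: circle_cis.
  have [M' hF] := analytic_part_hol _ _ _ _ _ hf.
  have cF := cont_circle _ _ _ _ _ hF Ha.
  apply: (geometric_zero _ (limit_const r2 M al) (ratio al)).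
  - exact: limit_const_ge0 hf.
  - exact: ratio_range hf.
  - move=> j. have Hs := dyadic_range j.
    have Ck := cont_cauchy _ Hs.
    have cU : forall t, ccont (fun t => cauchy_transform f (dyadic j) (a + RtoC rho * cis t)%C) t.
    { apply: (ccont_avg_param (fun t u => f ((a + RtoC rho * cis t) * cis u) * cauchy_kernel (dyadic j) u)%C) => p.
      apply: ccont_mult; last by cont.
      apply: (hol_ccont _ _ _ _ (fun q : R2 => (a + RtoC rho * cis (fst q)) * cis (snd q))%C _ hf); last by cont.
      move=> q; exact: annulus_rot. }
    have -> : avg (fun t => analytic_part f (a + RtoC rho * cis t) * cis t ^ k)%C =
      avg (fun t => (analytic_part f (a + RtoC rho * cis t) - cauchy_transform f (dyadic j) (a + RtoC rho * cis t)) * cis t ^ k)%C.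
    { transitivity (avg (fun t => analytic_part f (a + RtoC rho * cis t) * cis t ^ k) -
        avg (fun t => cauchy_transform f (dyadic j) (a + RtoC rho * cis t) * cis t ^ k))%C.
      - rewrite cauchy_transform_mom //; ring.
      - rewrite -avg_minus; [|cont|cont]. apply: avg_ext => t; ring. }
    apply: Cmod_avg_le; first by cont.
    move=> t. rewrite Cmod_mult Cmod_pow Cmod_cis pow1 Rmult_1_r. exact: (analytic_part_tail _ _ _ _ _ hf).
Qed.

(** The Cauchy kernel and its conjugate add up to the Poisson kernel plus 1, and the
    constant 1 contributes a mean of [f] over a circle centred at the origin. *)
Lemma decomposition z : annulus r1 r2 z ->
  f z = (analytic_part f z + Cconj (analytic_part (fun w => Cconj (f w)) z))%C.
Proof.
  move=> Hz. have hf' := hol_conj _ _ _ _ hf.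
  have R0 := rate_const_ge0 _ _ _ _ _ hf. have L0 := limit_const_ge0 _ _ _ _ _ hf.
  have CR := cont_rot _ _ _ _ _ hf z Hz.
  apply/Ceq_minus.
  apply: (geometric_zero _ (8 * rate_const r2 M al + 2 * limit_const r2 M al) (ratio al)); first lra.
  - exact: ratio_range hf.
  - move=> j. have Hs := dyadic_range j. have Ck := cont_cauchy _ Hs.
    have A := analytic_part_tail _ _ _ _ _ hf z j Hz.
    have B := analytic_part_tail _ _ _ _ _ hf' z j Hz.
    have P := poisson_approx _ _ _ _ _ hf (dyadic j) z Hs Hz.
    have E : 1 - dyadic j = (/ 2) ^ j by rewrite /dyadic; ring.
    rewrite E -ratio_pow in P.
    have S : avg (fun t => f (z * cis t) * RtoC (poisson_kernel (dyadic j) t))%C =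
      (cauchy_transform f (dyadic j) z + Cconj (cauchy_transform (fun w => Cconj (f w)) (dyadic j) z))%C.
    { rewrite /cauchy_transform -avg_conj; last by cont.
      rewrite -avg_plus; [|cont|cont].
      transitivity (avg (fun t => f (z * cis t) * (cauchy_kernel (dyadic j) t + Cconj (cauchy_kernel (dyadic j) t))) - avg (fun t => f (z * cis t)))%C.
      - rewrite -avg_minus; [|cont|cont]. apply: avg_ext => t. rewrite poissonE //; ring.
      - rewrite mean_rot //.
        transitivity (avg (fun t => f (z * cis t) * (cauchy_kernel (dyadic j) t + Cconj (cauchy_kernel (dyadic j) t))))%C; first by ring.
        apply: avg_ext => t. rewrite Cmult_conj Cconj_conj; ring. }
    rewrite S in P.
    set F := analytic_part f z in A *. set G := analytic_part _ z in B *.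
    set u := cauchy_transform f _ z in A P. set v := cauchy_transform _ _ z in B P.
    have -> : (f z - (F + Cconj G) = - (u + Cconj v - f z) + (- (F - u) + - Cconj (G - v)))%C by rewrite Cminus_conj; ring.
    apply: (Rle_trans _ _ _ (Cmod_triangle _ _)).
    have := Cmod_triangle (- (F - u)) (- Cconj (G - v)). rewrite !Cmod_opp Cmod_conj. lra.
Qed.
End Moments.

(** * Complex differentiability *)

Lemma near_locally (z0 : C) (P : C -> Prop) d : 0 < d -> (forall z, Cmod (z - z0)%C < d -> P z) ->
  locally (T := C_UniformSpace) z0 P.
Proof.
  move=> Hd H. have := ccont_locally (T := C_UniformSpace) (fun z => z) z0 d (continuous_id _) Hd.
  by apply filter_imp.
Qed.

Definition cdiff (g : C -> C) (z0 l : C) : Prop :=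
  forall e, 0 < e -> exists d, 0 < d /\ forall z, Cmod (z - z0)%C < d ->
    Cmod (g z - g z0 - l * (z - z0))%C <= e * Cmod (z - z0)%C.

Lemma cdiff_derive g z0 l : cdiff g z0 l -> is_derive (K := C_AbsRing) (V := C_NormedModule) g z0 l.
Proof.
  move=> H. split; first exact: is_linear_scal_l.
  move=> x Hx e.
  have <- : z0 = x by exact: (is_filter_lim_locally_unique (K := C_AbsRing) (V := AbsRing_NormedModule C_AbsRing)).
  have [d [Hd Hz]] := H _ (cond_pos e).
  exists (mkposreal _ Hd) => z Hb.
  have := Hz z Hb. rewrite (Cmult_comm l). by [].
Qed.

Lemma derive_cdiff g z0 l : is_derive (K := C_AbsRing) (V := C_NormedModule) g z0 l -> cdiff g z0 l.
Proof.
  move=> [_ H] e He.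
  have [d Hd] := H z0 (fun P HP => HP) (mkposreal _ He).
  exists d; split; first exact: cond_pos.
  move=> z Hz. have := Hd z Hz. rewrite /= (Cmult_comm l). by [].
Qed.

Lemma cdiff_quadratic g z0 l d B : 0 < d -> 0 <= B ->
  (forall z, Cmod (z - z0)%C < d -> Cmod (g z - g z0 - l * (z - z0))%C <= B * Cmod (z - z0)%C ^ 2) ->
  cdiff g z0 l.
Proof.
  move=> Hd HB H e He.
  have He' : 0 < e / (B + 1) by apply: Rdiv_lt_0_compat; lra.
  exists (Rmin d (e / (B + 1))); split; first exact: Rmin_glb_lt.
  move=> z Hz. have L1 := Rmin_l d (e / (B + 1)). have L2 := Rmin_r d (e / (B + 1)).
  apply: (Rle_trans _ _ _ (H z ltac:(lra))).
  have E : e = e / (B + 1) * (B + 1) by field; lra.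
  have P := Cmod_ge_0 (z - z0)%C. set m := Cmod _ in Hz P *. 
  have : B * m <= e by nra. nra.
Qed.

Lemma cdiff_cont g z0 l : cdiff g z0 l -> forall e, 0 < e ->
  exists d, 0 < d /\ forall z, Cmod (z - z0)%C < d -> Cmod (g z - g z0)%C < e.
Proof.
  move=> H e He.
  have [d [Hd Hz]] := H 1 Rlt_0_1.
  have K : 0 < 1 + Cmod l by have := Cmod_ge_0 l; lra.
  have He' : 0 < e / (1 + Cmod l) by apply: Rdiv_lt_0_compat.
  exists (Rmin d (e / (1 + Cmod l))); split; first exact: Rmin_glb_lt.
  move=> z Hm. have L1 := Rmin_l d (e / (1 + Cmod l)). have L2 := Rmin_r d (e / (1 + Cmod l)).
  have A := Hz z ltac:(lra).
  have T := Cmod_triangle (g z - g z0 - l * (z - z0))%C (l * (z - z0))%C.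
  have E : (g z - g z0 - l * (z - z0) + l * (z - z0) = g z - g z0)%C by ring.
  rewrite E Cmod_mult in T.
  have F : e = e / (1 + Cmod l) * (1 + Cmod l) by field; lra.
  nra.
Qed.

Lemma cdiff_comp f g z0 l m : cdiff f (g z0) l -> cdiff g z0 m -> cdiff (fun z => f (g z)) z0 (l * m)%C.
Proof.
  move=> Hf Hg e He.
  have Hl := Cmod_ge_0 l. have Hm := Cmod_ge_0 m.
  have He1 : 0 < e / (2 * (2 + Cmod m)) by apply: Rdiv_lt_0_compat; lra.
  have [d1 [Hd1 H1]] := Hf _ He1.
  have He2 : 0 < Rmin 1 (e / (2 * (1 + Cmod l))) by apply: Rmin_glb_lt; [lra | apply: Rdiv_lt_0_compat; lra].
  have [d2 [Hd2 H2]] := Hg _ He2.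
  have Hd3 : 0 < d1 / (2 + Cmod m) by apply: Rdiv_lt_0_compat; lra.
  exists (Rmin d2 (d1 / (2 + Cmod m))); split; first exact: Rmin_glb_lt.
  move=> z Hz.
  have L1 := Rmin_l d2 (d1 / (2 + Cmod m)). have L2 := Rmin_r d2 (d1 / (2 + Cmod m)).
  have K1 := Rmin_l 1 (e / (2 * (1 + Cmod l))). have K2 := Rmin_r 1 (e / (2 * (1 + Cmod l))).
  set q := Rmin 1 _ in He2 H2 K1 K2.
  have B := H2 z ltac:(lra).
  have P := Cmod_ge_0 (z - z0)%C. set h := Cmod (z - z0)%C in B Hz P *.
  have T := Cmod_triangle (g z - g z0 - m * (z - z0))%C (m * (z - z0))%C.
  have E : (g z - g z0 - m * (z - z0) + m * (z - z0) = g z - g z0)%C by ring.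
  rewrite E Cmod_mult -/h in T.
  have G : Cmod (g z - g z0)%C <= (2 + Cmod m) * h by nra.
  have F : d1 = d1 / (2 + Cmod m) * (2 + Cmod m) by field; lra.
  have G' : Cmod (g z - g z0)%C < d1 by nra.
  have A := H1 (g z) G'.
  have -> : (f (g z) - f (g z0) - l * m * (z - z0) =
    (f (g z) - f (g z0) - l * (g z - g z0)) + l * (g z - g z0 - m * (z - z0)))%C by ring.
  apply: (Rle_trans _ _ _ (Cmod_triangle _ _)). rewrite Cmod_mult.
  have E1 : e / (2 * (2 + Cmod m)) * ((2 + Cmod m) * h) = e / 2 * h by field; lra.
  have E2 : Cmod l * (e / (2 * (1 + Cmod l))) <= e / 2.
  { have -> : e / 2 = (1 + Cmod l) * (e / (2 * (1 + Cmod l))) by field; lra.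
    apply: Rmult_le_compat_r; last lra. left; apply: Rdiv_lt_0_compat; lra. }
  have A' : Cmod (f (g z) - f (g z0) - l * (g z - g z0))%C <= e / 2 * h.
  { apply: (Rle_trans _ _ _ A). rewrite -E1. apply: Rmult_le_compat_l; lra. }
  have B' : Cmod l * Cmod (g z - g z0 - m * (z - z0))%C <= e / 2 * h.
  { apply: (Rle_trans _ (Cmod l * (q * h))); first by apply: Rmult_le_compat_l.
    have : Cmod l * q <= e / 2 by nra. nra. }
  lra.
Qed.

Lemma cdiff_ext_near f g z0 l d : 0 < d -> (forall z, Cmod (z - z0)%C < d -> f z = g z) -> cdiff f z0 l -> cdiff g z0 l.
Proof.
  move=> Hd E H e He. have [d' [Hd' Hz]] := H e He.
  exists (Rmin d d'); split; first exact: Rmin_glb_lt.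
  move=> z Hm. have L1 := Rmin_l d d'. have L2 := Rmin_r d d'.
  rewrite -!E; [apply: Hz; lra | | lra].
  have -> : (z0 - z0 = RtoC 0)%C by ring. by rewrite Cmod_0.
Qed.

Lemma cdiff_conj g z0 l : cdiff g (Cconj z0) l -> cdiff (fun z => Cconj (g (Cconj z))) z0 (Cconj l).
Proof.
  move=> H e He. have [d [Hd Hz]] := H e He. exists d; split => // z Hm.
  have E : Cmod (Cconj z - Cconj z0)%C = Cmod (z - z0)%C by rewrite -Cminus_conj Cmod_conj.
  have := Hz (Cconj z). rewrite E => /(_ Hm).
  rewrite -Cmod_conj !Cminus_conj Cmult_conj Cminus_conj !Cconj_conj. by [].
Qed.

Lemma cdiff_mobius p0 p1 q0 q1 z0 : (q0 + q1 * z0)%C <> RtoC 0 ->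
  exists l, cdiff (fun z => (p0 + p1 * z) / (q0 + q1 * z))%C z0 l.
Proof.
  move=> Hn. set D0 := (q0 + q1 * z0)%C. set N0 := (p0 + p1 * z0)%C.
  have Hd0 : 0 < Cmod D0 by apply/Cmod_gt_0.
  have Hq1 := Cmod_ge_0 q1.
  have Hd : 0 < Cmod D0 / (2 * (1 + Cmod q1)) by apply: Rdiv_lt_0_compat; lra.
  exists ((p1 * D0 - q1 * N0) / (D0 * D0))%C.
  apply: (cdiff_quadratic _ _ _ _ (Cmod (q1 * (p1 * D0 - q1 * N0))%C / (Cmod D0 / 2 * (Cmod D0 * Cmod D0))) Hd).
  { apply: Rmult_le_pos; first exact: Cmod_ge_0. left; apply: Rinv_0_lt_compat.
    apply: Rmult_lt_0_compat; first lra. exact: Rmult_lt_0_compat. }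
  move=> z Hz.
  have G : Cmod D0 / 2 <= Cmod (q0 + q1 * z)%C.
  { have T := Cmod_triangle (q0 + q1 * z)%C (- (q1 * (z - z0)))%C.
    have E : (q0 + q1 * z + - (q1 * (z - z0)) = D0)%C by rewrite /D0; ring.
    rewrite E Cmod_opp Cmod_mult in T.
    have : Cmod q1 * Cmod (z - z0)%C <= Cmod D0 / 2.
    { apply: (Rle_trans _ ((1 + Cmod q1) * (Cmod D0 / (2 * (1 + Cmod q1))))); last by right; field; lra.
      apply: Rmult_le_compat; try lra. exact: Cmod_ge_0. }
    lra. }
  have Hn' : (q0 + q1 * z)%C <> RtoC 0 by apply/Cmod_gt_0; lra.
  have -> : ((p0 + p1 * z) / (q0 + q1 * z) - (p0 + p1 * z0) / (q0 + q1 * z0) - (p1 * D0 - q1 * N0) / (D0 * D0) * (z - z0) =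
    - (q1 * (p1 * D0 - q1 * N0) * ((z - z0) * (z - z0)) * / ((q0 + q1 * z) * (D0 * D0))))%C.
  { rewrite /D0 /N0. field. by split. }
  rewrite Cmod_opp Cmod_mult (Cmod_mult _ ((z - z0) * _)) (Cmod_mult (z - z0)) Cmod_inv; last first.
  { apply: Cmult_neq_0 => //. exact: Cmult_neq_0. }
  rewrite (Cmod_mult (q0 + q1 * z)%C) (Cmod_mult D0 D0).
  rewrite /Rdiv. set m := Cmod (z - z0)%C. set L := Cmod (q1 * _)%C.
  have HL : 0 <= L := Cmod_ge_0 _. have Hm : 0 <= m := Cmod_ge_0 _.
  have -> : L * / (Cmod D0 * / 2 * (Cmod D0 * Cmod D0)) * m ^ 2 = L * (m * m) * / (Cmod D0 * / 2 * (Cmod D0 * Cmod D0)) by ring.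
  apply: Rmult_le_compat_l; first by nra.
  apply: Rinv_le_contravar; first by apply: Rmult_lt_0_compat; [lra | nra].
  apply: Rmult_le_compat_r; [nra | lra].
Qed.

(** * Extension into the disc *)

Definition cauchy_integral (h : C -> C) (a : C) (rho : R) (z : C) : C :=
  avg (fun t => h (a + RtoC rho * cis t) * (RtoC rho / (RtoC rho - (z - a) * Cconj (cis t))))%C.

Section Extension.
Variables (K : C -> Prop) (h : C -> C) (M al : R) (a : C) (rho : R).
Hypothesis (hh : hol K h M al) (hrho : 0 < rho) (hK : forall z, circle a rho z -> K z).
Hypothesis hmom : forall n, (0 < n)%nat -> avg (fun t => h (a + RtoC rho * cis t) * cis t ^ n)%C = RtoC 0.

(** Transported to the unit circle, which is the annulus of radii 1 and 1, the function
    falls under the estimates for rotation-invariant sets. *)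
Definition scaled (w : C) : C := h (a + RtoC rho * w)%C.

Lemma scaled_in w : annulus 1 1 w -> K (a + RtoC rho * w)%C.
Proof.
  move=> [A B]. apply: hK. rewrite /circle.
  have -> : (a + RtoC rho * w - a = RtoC rho * w)%C by ring.
  rewrite Cmod_mult Cmod_R Rabs_pos_eq; last lra. have -> : Cmod w = 1 by lra. ring.
Qed.

Lemma hol_scaled : hol (annulus 1 1) scaled (M * hpow rho al) al.
Proof.
  have [HM [Hal H]] := hh. split.
  { apply: Rmult_le_pos => //; exact: hpow_ge0. }
  split => // z w Hz Hw.
  apply: (Rle_trans _ _ _ (H _ _ (scaled_in _ Hz) (scaled_in _ Hw))).
  have -> : (a + RtoC rho * z - (a + RtoC rho * w) = RtoC rho * (z - w))%C by ring.
  rewrite Cmod_mult Cmod_R Rabs_pos_eq; last lra.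
  rewrite hpow_mult; [lra | lra | exact: Cmod_ge_0].
Qed.

Lemma cis_annulus t : annulus 1 1 (cis t).
Proof. rewrite /annulus Cmod_cis; lra. Qed.

Lemma cont_scaled_cis t : ccont (fun t => scaled (cis t)) t.
Proof.
  apply: (hol_ccont _ _ _ _ cis _ hol_scaled); last by cont. exact: cis_annulus.
Qed.

Lemma scaled_bounded : exists B, forall t, Cmod (scaled (cis t)) <= B.
Proof.
  have [HM [Ha H]] := hol_scaled.
  exists (Cmod (scaled (cis 0)) + M * hpow rho al * hpow 2 al) => t.
  have -> : scaled (cis t) = (scaled (cis 0) + (scaled (cis t) - scaled (cis 0)))%C by ring.
  apply: (Rle_trans _ _ _ (Cmod_triangle _ _)). apply: Rplus_le_compat_l.
  apply: (Rle_trans _ _ _ (H _ _ (cis_annulus _) (cis_annulus _))). apply: Rmult_le_compat_l => //.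
  apply: hpow_mono; first lra. apply: (Rle_trans _ _ _ (Cmod_triangle _ _)).
  rewrite Cmod_opp !Cmod_cis; lra.
Qed.

Lemma kernel_den z t : Cmod (z - a)%C < rho ->
  rho - Cmod (z - a)%C <= Cmod (RtoC rho - (z - a) * Cconj (cis t))%C.
Proof.
  move=> Hz.
  have T := Cmod_triangle (RtoC rho - (z - a) * Cconj (cis t))%C ((z - a) * Cconj (cis t))%C.
  have E : (RtoC rho - (z - a) * Cconj (cis t) + (z - a) * Cconj (cis t) = RtoC rho)%C by ring.
  rewrite E Cmod_mult Cmod_conj Cmod_cis Cmod_R Rabs_pos_eq in T; lra.
Qed.

Lemma kernel_den_nz z t : Cmod (z - a)%C < rho -> (RtoC rho - (z - a) * Cconj (cis t))%C <> RtoC 0.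
Proof. move=> Hz. apply/Cmod_gt_0. have := kernel_den z t Hz; lra. Qed.

(** The kernel is a rational function of [z] without pole in the disc; its second order
    remainder is uniformly quadratic. *)
Lemma cauchy_integral_diff z0 : Cmod (z0 - a)%C < rho -> exists l, cdiff (cauchy_integral h a rho) z0 l.
Proof.
  move=> Hz0. have [B HB] := scaled_bounded.
  have HB0 : 0 <= B := Rle_trans _ _ _ (Cmod_ge_0 _) (HB 0).
  have cS := cont_scaled_cis.
  set eta := (rho - Cmod (z0 - a)%C) / 2.
  have Heta : 0 < eta by rewrite /eta; lra.
  exists (avg (fun t => scaled (cis t) * (RtoC rho * Cconj (cis t) / (RtoC rho - (z0 - a) * Cconj (cis t)) ^ 2))%C).
  apply: (cdiff_quadratic _ _ _ eta (B * (rho * / (eta * eta ^ 2)))) => //.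
  { apply: Rmult_le_pos => //. apply: Rmult_le_pos; first lra. left; apply: Rinv_0_lt_compat.
    apply: Rmult_lt_0_compat => //. exact: pow_lt. }
  move=> z Hz.
  have Hz' : Cmod (z - a)%C < rho - eta.
  { have := Cmod_triangle (z - z0)%C (z0 - a)%C. have -> : (z - z0 + (z0 - a) = z - a)%C by ring.
    move: Hz; rewrite /eta; lra. }
  have N0 t := kernel_den_nz z0 t Hz0.
  have N t := kernel_den_nz z t ltac:(lra).
  have c1 w t : Cmod (w - a)%C < rho -> ccont (fun t => RtoC rho / (RtoC rho - (w - a) * Cconj (cis t)))%C t.
  { move=> Hw. cont. exact: kernel_den_nz. }
  have c2 t : ccont (fun t => RtoC rho * Cconj (cis t) / (RtoC rho - (z0 - a) * Cconj (cis t)) ^ 2)%C t.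
  { cont. apply: Cpow_nz; exact: N0. }
  have c1z t := c1 z t ltac:(lra). have c1z0 t := c1 z0 t Hz0.
  have -> : (cauchy_integral h a rho z - cauchy_integral h a rho z0 -
     avg (fun t => scaled (cis t) * (RtoC rho * Cconj (cis t) / (RtoC rho - (z0 - a) * Cconj (cis t)) ^ 2)) * (z - z0) =
     avg (fun t => scaled (cis t) * (RtoC rho * ((z - z0) * Cconj (cis t)) ^ 2 / ((RtoC rho - (z - a) * Cconj (cis t)) * (RtoC rho - (z0 - a) * Cconj (cis t)) ^ 2))))%C.
  { rewrite (Cmult_comm _ (z - z0)%C) -avg_scal; last by move=> t; apply: ccont_mult.
    rewrite /cauchy_integral -/scaled -avg_minus.
    - rewrite -avg_minus.
      + apply: avg_ext => t. rewrite /scaled. field. split; [exact: N0 | exact: N].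
      + move=> t. apply: ccont_minus; apply: ccont_mult; [exact: cS | exact: c1z | exact: cS | exact: c1z0].
      + move=> t. apply: ccont_mult; first exact: ccont_const. apply: ccont_mult; [exact: cS | exact: c2].
    - move=> t. apply: ccont_mult; [exact: cS | exact: c1z].
    - move=> t. apply: ccont_mult; [exact: cS | exact: c1z0]. }
  apply: Cmod_avg_le.
  { move=> t. cont. apply: Cmult_neq_0; [exact: N | apply: Cpow_nz; exact: N0]. }
  move=> t. have G0 := kernel_den z0 t Hz0. have G := kernel_den z t ltac:(lra).
  rewrite Cmod_mult. rewrite Rmult_assoc. apply: Rmult_le_compat; try exact: Cmod_ge_0; first exact: HB.
  rewrite Cmod_div; last by apply: Cmult_neq_0; [exact: N | apply: Cpow_nz; exact: N0].
  rewrite Cmod_mult Cmod_R Rabs_pos_eq; last lra.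
  rewrite Cmod_pow (Cmod_mult (z - z0)%C) Cmod_conj Cmod_cis Rmult_1_r Cmod_mult Cmod_pow.
  set m := Cmod (z - z0)%C.
  have -> : rho * / (eta * eta ^ 2) * m ^ 2 = rho * m ^ 2 * / (eta * eta ^ 2) by ring.
  have Hp : 0 < eta ^ 2 by apply: pow_lt.
  apply: Rmult_le_compat_l.
  { apply: Rmult_le_pos; first lra. apply: pow_le; exact: Cmod_ge_0. }
  apply: Rinv_le_contravar; first by apply: Rmult_lt_0_compat.
  apply: Rmult_le_compat; [lra | lra | lra |].
  apply: pow_incr. split; [lra|]. move: G0; rewrite /eta; lra.
Qed.

Lemma cauchy_integral_center : cauchy_integral h a rho a = avg (fun t => h (a + RtoC rho * cis t)%C).
Proof.
  apply: avg_ext => t.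
  have N : RtoC rho <> RtoC 0 by case; lra.
  have -> : (RtoC rho - (a - a) * Cconj (cis t) = RtoC rho)%C by ring.
  field. exact: N.
Qed.

(** The two kernels differ by [conj (cauchy_kernel s t) - 1], which contains only the
    frequencies killed by the vanishing moments. *)
Lemma cauchy_integral_poisson s tau : 0 <= s < 1 ->
  cauchy_integral h a rho (a + RtoC (rho * s) * cis tau)%C =
  avg (fun t => scaled (cis tau * cis t)%C * RtoC (poisson_kernel s t))%C.
Proof.
  move=> Hs. have [B HB] := scaled_bounded. have cS := cont_scaled_cis.
  have Ck := cont_cauchy s Hs.
  have Nr : RtoC rho <> RtoC 0 by case; lra.
  have cR t : ccont (fun t => scaled (cis tau * cis t)%C) t.
  { apply: (cont_rot _ _ _ _ _ hol_scaled). exact: cis_annulus. }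
  have E1 : cauchy_integral h a rho (a + RtoC (rho * s) * cis tau)%C =
    avg (fun t => scaled (cis tau * cis t) * cauchy_kernel s t)%C.
  { rewrite -[LHS](avg_shift _ tau).
    - apply: avg_ext => t. rewrite cis_plus /scaled /cauchy_kernel.
      have -> : (cis t * cis tau = cis tau * cis t)%C by ring.
      congr Cmult.
      have D : den s t <> RtoC 0 := den_nz s t Hs.
      have -> : (RtoC rho - (a + RtoC (rho * s) * cis tau - a) * Cconj (cis tau * cis t) = RtoC rho * den s t)%C.
      { rewrite /den RtoC_mult Cmult_conj.
        transitivity (RtoC rho - RtoC rho * RtoC s * Cconj (cis t) * (cis tau * Cconj (cis tau)))%C; first by ring.
        rewrite cis_conj_mult; ring. }
      field. by split.
    - move=> t. apply: ccont_mult; first exact: cS. cont. apply: kernel_den_nz.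
      have -> : (a + RtoC (rho * s) * cis tau - a = RtoC (rho * s) * cis tau)%C by ring.
      rewrite Cmod_mult Cmod_cis Cmod_R Rabs_pos_eq; nra.
    - move=> t; by rewrite cis_period. }
  have E2 : avg (fun t => scaled (cis tau * cis t) * Cconj (cauchy_kernel s t))%C = avg (fun t => scaled (cis tau * cis t)%C).
  { rewrite (avg_ext _ (fun t => Cconj (Cconj (scaled (cis tau * cis t)) * cauchy_kernel s t))%C); last first.
    { move=> t. by rewrite Cmult_conj Cconj_conj. }
    rewrite avg_conj; last by cont.
    rewrite (avg_cauchy (fun t => Cconj (scaled (cis tau * cis t)%C)) B) //.
    - rewrite -avg_conj; last by cont. apply: avg_ext => t; by rewrite Cconj_conj.
    - cont.
    - move=> t. rewrite Cmod_conj -cis_plus. exact: HB.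
    - move=> n Hn.
      rewrite (avg_ext _ (fun t => Cconj (scaled (cis tau * cis t) * cis t ^ n))%C); last first.
      { move=> t. by rewrite Cmult_conj Cpow_conj. }
      rewrite avg_conj; last by cont.
      have -> : avg (fun t => scaled (cis tau * cis t) * cis t ^ n)%C = RtoC 0.
      { have Sh := avg_shift (fun t => scaled (cis t) * cis t ^ n)%C tau.
        rewrite (avg_ext _ (fun t => cis (- tau) ^ n * (scaled (cis (t + tau)) * cis (t + tau) ^ n))%C).
        - rewrite avg_scal.
          + rewrite Sh; [|cont|by move=> t; rewrite cis_period].
            rewrite /scaled hmom //; ring.
          + move=> t. apply: (ccont_comp (fun t => scaled (cis t) * cis t ^ n)%C); by cont.
        - move=> t. rewrite cis_opp cis_plus.
          have -> : (cis t * cis tau = cis tau * cis t)%C by ring.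
          transitivity (scaled (cis tau * cis t) * ((Cconj (cis tau) * (cis tau * cis t)) ^ n))%C.
          + congr Cmult. congr Cpow.
            transitivity ((cis tau * Cconj (cis tau)) * cis t)%C; [rewrite cis_conj_mult; ring | ring].
          + rewrite Cpow_mult_l; ring. }
      by rewrite /Cconj /RtoC /= Ropp_0. }
  rewrite E1.
  rewrite [RHS](avg_ext _ (fun t => scaled (cis tau * cis t) * cauchy_kernel s t + (scaled (cis tau * cis t) * Cconj (cauchy_kernel s t) - scaled (cis tau * cis t)))%C); last first.
  { move=> t. rewrite poissonE //; ring. }
  rewrite avg_plus; [|cont|cont]. rewrite avg_minus; [|cont|cont]. rewrite E2; ring.
Qed.

Definition disc_fun (z : C) : C :=
  match Rlt_dec (Cmod (z - a)%C) rho with left _ => cauchy_integral h a rho z | right _ => h z end.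

Lemma disc_fun_in z : Cmod (z - a)%C < rho -> disc_fun z = cauchy_integral h a rho z.
Proof. rewrite /disc_fun; case: Rlt_dec => //. Qed.

Lemma disc_fun_out z : rho <= Cmod (z - a)%C -> disc_fun z = h z.
Proof. rewrite /disc_fun; case: Rlt_dec => //; lra. Qed.

Lemma disc_fun_diff z0 : Cmod (z0 - a)%C < rho -> exists l, cdiff disc_fun z0 l.
Proof.
  move=> Hz. have [l Hl] := cauchy_integral_diff z0 Hz. exists l.
  apply: (cdiff_ext_near (cauchy_integral h a rho) _ _ _ (rho - Cmod (z0 - a)%C)) => //; first lra.
  move=> z Hm. symmetry; apply: disc_fun_in.
  have := Cmod_triangle (z - z0)%C (z0 - a)%C. have -> : (z - z0 + (z0 - a) = z - a)%C by ring. lra.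
Qed.

Definition boundary_const : R := 8 * rate_const 1 (M * hpow rho al) al.

(** Uniform radial convergence at the circle, by the Poisson estimate. *)
Lemma disc_fun_boundary s tau : 0 <= s <= 1 ->
  Cmod (disc_fun (a + RtoC (rho * s) * cis tau) - h (a + RtoC rho * cis tau))%C <= boundary_const * hpow (1 - s) (al / 2).
Proof.
  move=> Hs.
  have Em : Cmod (a + RtoC (rho * s) * cis tau - a)%C = rho * s.
  { have -> : (a + RtoC (rho * s) * cis tau - a = RtoC (rho * s) * cis tau)%C by ring.
    rewrite Cmod_mult Cmod_cis Cmod_R Rabs_pos_eq; nra. }
  have R0 := rate_const_ge0 _ _ _ _ _ hol_scaled.
  case: (Req_dec s 1) => [->|Hs1].
  - rewrite Rmult_1_r disc_fun_out.
    + have -> : (h (a + RtoC rho * cis tau) - h (a + RtoC rho * cis tau) = RtoC 0)%C by ring.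
      rewrite Cmod_0. apply: Rmult_le_pos; [rewrite /boundary_const; lra | exact: hpow_ge0].
    + have -> : (a + RtoC rho * cis tau - a = RtoC rho * cis tau)%C by ring.
      rewrite Cmod_mult Cmod_cis Cmod_R Rabs_pos_eq; lra.
  - rewrite disc_fun_in; last by rewrite Em; nra.
    rewrite cauchy_integral_poisson; last lra.
    apply: (poisson_approx _ _ _ _ _ hol_scaled); [lra | exact: cis_annulus].
Qed.

(** The radial projection [p] of [z] is at distance at most [|z - z0|] from [z]. *)
Lemma disc_fun_cont_boundary z0 e : Cmod (z0 - a)%C = rho -> 0 < e ->
  exists d, 0 < d /\ forall z, Cmod (z - a)%C <= rho -> Cmod (z - z0)%C < d ->
    Cmod (disc_fun z - disc_fun z0)%C < e.
Proof.
  move=> Hz0 He. have [HM [Hal H]] := hh.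
  have R0 := rate_const_ge0 _ _ _ _ _ hol_scaled.
  have D0 : 0 <= boundary_const by rewrite /boundary_const; lra.
  have He1 : 0 < e / (2 * (boundary_const + 1)) by apply: Rdiv_lt_0_compat; lra.
  have He2 : 0 < e / (2 * (M + 1)) by apply: Rdiv_lt_0_compat; lra.
  have [d1 Hd1] := hpow_small (al / 2) _ ltac:(lra) He1.
  have [d2 Hd2] := hpow_small al _ ltac:(lra) He2.
  have P1 := cond_pos d1. have P2 := cond_pos d2.
  exists (Rmin (rho * d1) (d2 / 2)); split; first by apply: Rmin_glb_lt; nra.
  move=> z Hz Hzz.
  have L1 := Rmin_l (rho * d1) (d2 / 2). have L2 := Rmin_r (rho * d1) (d2 / 2).
  have [tau Ht] := polar (z - a)%C.
  set s := Cmod (z - a)%C / rho.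
  have Er : rho * s = Cmod (z - a)%C by rewrite /s; field; lra.
  have Hs : 0 <= s <= 1.
  { have := Cmod_ge_0 (z - a)%C. split; nra. }
  have Ez : z = (a + RtoC (rho * s) * cis tau)%C by rewrite Er -Ht; ring.
  have Hd : rho * (1 - s) <= Cmod (z - z0)%C.
  { have T := Cmod_triangle (z0 - z)%C (z - a)%C.
    have E : (z0 - z + (z - a) = z0 - a)%C by ring.
    have E' : Cmod (z0 - z)%C = Cmod (z - z0)%C by rewrite -Cmod_opp; congr Cmod; ring.
    rewrite E Hz0 E' in T. lra. }
  set p := (a + RtoC rho * cis tau)%C.
  have Kp : K p by apply: hK; exact: circle_cis.
  have Kz0 : K z0 by apply: hK.
  have B1 := disc_fun_boundary s tau Hs. rewrite -Ez -/p in B1.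
  have Hpz : Cmod (p - z0)%C <= 2 * Cmod (z - z0)%C.
  { have -> : (p - z0 = RtoC (rho * (1 - s)) * cis tau + (z - z0))%C.
    { rewrite {1}Ez /p RtoC_mult RtoC_minus RtoC_mult; ring. }
    apply: (Rle_trans _ _ _ (Cmod_triangle _ _)).
    rewrite Cmod_mult Cmod_cis Cmod_R Rabs_pos_eq; first lra. nra. }
  have B2 := H _ _ Kp Kz0.
  have S1 : hpow (1 - s) (al / 2) < e / (2 * (boundary_const + 1)) by apply: Hd1; nra.
  have S2 : hpow (Cmod (p - z0)%C) al < e / (2 * (M + 1)) by apply: Hd2; lra.
  rewrite (disc_fun_out z0); last lra.
  have -> : (disc_fun z - h z0 = (disc_fun z - h p) + (h p - h z0))%C by ring.
  apply: (Rle_lt_trans _ _ _ (Cmod_triangle _ _)).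
  have F1 : (boundary_const + 1) * (e / (2 * (boundary_const + 1))) = e / 2 by field; lra.
  have F2 : (M + 1) * (e / (2 * (M + 1))) = e / 2 by field; lra.
  have G1 := hpow_ge0 (1 - s) (al / 2). have G2 := hpow_ge0 (Cmod (p - z0)%C) al.
  have : boundary_const * hpow (1 - s) (al / 2) < e / 2 by nra.
  have : M * hpow (Cmod (p - z0)%C) al < e / 2 by nra.
  lra.
Qed.

Lemma disc_fun_cont z0 : Cmod (z0 - a)%C <= rho -> forall e, 0 < e ->
  exists d, 0 < d /\ forall z, Cmod (z - a)%C <= rho -> Cmod (z - z0)%C < d ->
    Cmod (disc_fun z - disc_fun z0)%C < e.
Proof.
  move=> Hz e He. case: (Req_dec (Cmod (z0 - a)%C) rho) => Hb; first exact: disc_fun_cont_boundary.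
  have [l Hl] := disc_fun_diff z0 ltac:(lra).
  have [d [Hd H]] := cdiff_cont _ _ _ Hl e He.
  exists d; split => // z _; exact: H.
Qed.
End Extension.

Lemma ball_of_Cmod (u v : C) (e : posreal) : Cmod (v - u)%C < e -> ball (M := C_UniformSpace) u e v.
Proof. exact: (C_NormedModule_mixin_compat1 u v). Qed.

(** The extension is the Cauchy integral: it is differentiable by
    [cauchy_integral_diff], and continuous up to the circle because it is also a Poisson
    integral. The value at the centre decides about the point at infinity after
    reflection. *)
Lemma extension_into_disc K h M al a rho : hol K h M al -> 0 < rho -> (forall z, circle a rho z -> K z) ->
  (forall n, (0 < n)%nat -> avg (fun t => h (a + RtoC rho * cis t) * cis t ^ n)%C = RtoC 0) ->
  exists g, disc_extension h a rho g /\ g a = avg (fun t => h (a + RtoC rho * cis t)%C).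
Proof.
  move=> hh hrho hK hmom. exists (disc_fun h a rho). split; last first.
  { rewrite disc_fun_in; first exact: cauchy_integral_center.
    have -> : (a - a = RtoC 0)%C by ring. by rewrite Cmod_0. }
  split; last split.
  - move=> z Hz. apply: disc_fun_out. rewrite Hz; lra.
  - move=> z0 Hz0. apply/filterlim_locally => e.
    have [d [Hd H]] := disc_fun_cont K h M al a rho hh hrho hK hmom z0 Hz0 e (cond_pos e).
    apply: (near_locally _ _ d Hd) => z Hz Hc. apply: ball_of_Cmod. exact: H.
  - move=> z Hz. have [l Hl] := disc_fun_diff K h M al a rho hh hrho hK z Hz.
    exists l. exact: cdiff_derive.
Qed.

(** * Reflection in a circle *)

(** The reflection [z |-> a + rho^2 / conj (z - a)] fixes the circle and
    exchanges the disc with its exterior, the centre corresponding to infinity. *)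
Definition reflection (a : C) (rho : R) (z : C) : C := (a + RtoC (rho ^ 2) / Cconj (z - a))%C.

Definition reflected (g : C -> C) (a : C) (rho : R) (p : sphere) : C :=
  match p with
  | Fin z => Cconj (g (reflection a rho z))
  | Infty => RtoC 0
  end.

Lemma Cconj_RtoC x : Cconj (RtoC x) = RtoC x.
Proof. by rewrite /Cconj /RtoC /= Ropp_0. Qed.

Lemma Cconj_nz z : z <> RtoC 0 -> Cconj z <> RtoC 0.
Proof. move=> H; apply/Cmod_gt_0; rewrite Cmod_conj; exact/Cmod_gt_0. Qed.

Lemma Cmod_reflection a rho z : z <> a -> Cmod (reflection a rho z - a)%C = rho ^ 2 / Cmod (z - a)%C.
Proof.
  move=> Hz.
  have -> : (reflection a rho z - a = RtoC (rho ^ 2) / Cconj (z - a))%C by rewrite /reflection; ring.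
  rewrite Cmod_div; last by apply: Cconj_nz; exact: Cminus_eq_contra.
  rewrite Cmod_conj Cmod_R Rabs_pos_eq //. exact: pow2_ge_0.
Qed.

Section Reflection.
Variables (h : C -> C) (a : C) (rho : R) (g : C -> C).
Hypothesis (hrho : 0 < rho).
Hypothesis (hg : disc_extension (fun z => Cconj (h z)) a rho g).
Hypothesis (hga : g a = RtoC 0).

Lemma ne_center z : 0 < Cmod (z - a)%C -> z <> a.
Proof. move=> H E. move: H. rewrite E. have -> : (a - a = RtoC 0)%C by ring. rewrite Cmod_0; lra. Qed.

Lemma reflection_bound z d : 0 < d -> d <= Cmod (z - a)%C -> Cmod (reflection a rho z - a)%C <= rho ^ 2 / d.
Proof.
  move=> Hd Hz. rewrite Cmod_reflection; last by apply: ne_center; lra.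
  apply: Rmult_le_compat_l; first exact: pow2_ge_0. exact: Rinv_le_contravar.
Qed.

Lemma reflected_circle z : circle a rho z -> reflected g a rho (Fin z) = h z.
Proof.
  move=> Hz. have Hn : (z - a)%C <> RtoC 0 by apply/Cmod_gt_0; rewrite Hz.
  rewrite /= /reflection.
  have -> : (RtoC (rho ^ 2) / Cconj (z - a) = z - a)%C.
  { rewrite -Hz Cmod2_conj. field. exact: Cconj_nz. }
  have -> : (a + (z - a) = z)%C by ring.
  rewrite (proj1 hg) // Cconj_conj //.
Qed.

Lemma g_cont z0 e : closed_disc a rho z0 -> 0 < e ->
  exists d, 0 < d /\ forall z, Cmod (z - z0)%C < d -> closed_disc a rho z -> Cmod (g z - g z0)%C < e.
Proof.
  move=> Hz0 He. have [_ [Hc _]] := hg.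
  have He' : 0 < e / sqrt 2 by apply: Rdiv_lt_0_compat => //; apply: sqrt_lt_R0; lra.
  have [d Hd] := proj1 (filterlim_locally _ _) (Hc z0 Hz0) (mkposreal _ He').
  exists d; split; first exact: cond_pos.
  move=> z Hz Hcz. have := Hd z (ball_of_Cmod _ _ _ Hz) Hcz => Hb.
  have := C_NormedModule_mixin_compat2 (g z0) (g z) (mkposreal _ He') Hb.
  rewrite /=. have -> : sqrt 2 * (e / sqrt 2) = e by field; apply: Rgt_not_eq; apply: sqrt_lt_R0; lra.
  by [].
Qed.

Lemma reflected_cont : sphere_continuous_on (sphere_minus (Defs.disc a rho)) (reflected g a rho).
Proof.
  have Hr2 : 0 < rho ^ 2 by apply: pow_lt.
  have into z : rho <= Cmod (z - a)%C -> closed_disc a rho (reflection a rho z).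
  { move=> Hz. rewrite /closed_disc. have := reflection_bound z rho hrho Hz.
    have -> : rho ^ 2 / rho = rho by field; lra. by []. }
  case => [z0|] /= Hz0 P [e HP].
  - have Hz0' : rho <= Cmod (z0 - a)%C by apply: Rnot_lt_le.
    have [d [Hd H]] := g_cont _ _ (into _ Hz0') (cond_pos e).
    have Hc : ccont (T := C_UniformSpace) (reflection a rho) z0.
    { have cid : ccont (T := C_UniformSpace) (fun z : C => z) z0 by exact: continuous_id.
      rewrite /reflection. cont. apply: Cconj_nz. apply/Cmod_gt_0. lra. }
    change (locally (T := C_UniformSpace) z0
      (fun w => ~ Defs.disc a rho w -> P (Cconj (g (reflection a rho w))))).
    have := ccont_locally _ _ _ Hc Hd. apply filter_imp => z Hz Hout.
    apply: HP. apply: ball_of_Cmod => /=. rewrite -Cminus_conj Cmod_conj.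
    apply: H => //. apply: into. exact: Rnot_lt_le.
  - have Ha : closed_disc a rho a.
    { rewrite /closed_disc. have -> : (a - a = RtoC 0)%C by ring. rewrite Cmod_0; lra. }
    have [d [Hd H]] := g_cont _ _ Ha (cond_pos e).
    split.
    { move=> _. apply: HP. exact: ball_center. }
    exists (Cmod a + rho + 2 * (rho ^ 2 / d)) => w Hw Hout. apply: HP. apply: ball_of_Cmod => /=.
    have Q : 0 < rho ^ 2 / d by apply: Rdiv_lt_0_compat.
    have T : rho <= Cmod (w - a)%C /\ 2 * (rho ^ 2 / d) <= Cmod (w - a)%C.
    { have := Cmod_triangle (w - a)%C a. have -> : (w - a + a = w)%C by ring. lra. }
    have -> : (Cconj (g (reflection a rho w)) - RtoC 0 = Cconj (g (reflection a rho w) - g a))%C.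
    { rewrite hga Cminus_conj Cconj_RtoC //. }
    rewrite Cmod_conj. apply: H; last by apply: into; lra.
    apply: (Rle_lt_trans _ _ _ (reflection_bound w (2 * (rho ^ 2 / d)) ltac:(lra) ltac:(lra))).
    have -> : rho ^ 2 / (2 * (rho ^ 2 / d)) = d / 2 by field; lra. lra.
Qed.

Lemma g_diff z : Cmod (z - a)%C < rho -> exists l, cdiff g z l.
Proof.
  move=> Hz. have [_ [_ Hd]] := hg. have [l Hl] := Hd z Hz. exists l. exact: derive_cdiff.
Qed.

(** The conjugate of the reflection is a Moebius map, in the chart at infinity as well;
    it is composed with [conj o g o conj], which is holomorphic. *)
Lemma conj_g_mobius p0 p1 q0 q1 z0 : (q0 + q1 * z0)%C <> RtoC 0 ->
  Cmod (Cconj ((p0 + p1 * z0) / (q0 + q1 * z0)) - a)%C < rho ->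
  exists l, cdiff (fun z => Cconj (g (Cconj ((p0 + p1 * z) / (q0 + q1 * z))%C))) z0 l.
Proof.
  move=> Hn Hin. have [m Hm] := cdiff_mobius p0 p1 q0 q1 z0 Hn.
  have [l Hl] := g_diff _ Hin. exists (Cconj l * m)%C.
  apply: (cdiff_comp (fun u => Cconj (g (Cconj u))) (fun z => (p0 + p1 * z) / (q0 + q1 * z))%C) => //.
  exact: cdiff_conj.
Qed.

Lemma reflected_holo : sphere_holomorphic_on (sphere_minus (closed_disc a rho)) (reflected g a rho).
Proof.
  have Hr2 : 0 < rho ^ 2 by apply: pow_lt.
  case => [z0|] /= Hz0.
  - have Hz0' : rho < Cmod (z0 - a)%C by apply: Rnot_le_lt.
    pose p0 := (RtoC (rho ^ 2) - Cconj a * a)%C.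
    have E z : z <> a -> Cconj ((p0 + Cconj a * z) / (- a + RtoC 1 * z))%C = reflection a rho z.
    { move=> Hz. have N := Cminus_eq_contra _ _ Hz.
      have N' : (- a + RtoC 1 * z)%C <> RtoC 0 by have -> : (- a + RtoC 1 * z = z - a)%C by ring.
      rewrite Cdiv_conj //. rewrite /p0 /reflection Cplus_conj Cminus_conj !Cmult_conj Cconj_RtoC !Cconj_conj.
      have -> : Cconj (- a + RtoC 1 * z)%C = Cconj (z - a)%C by congr Cconj; ring.
      have N2 := Cconj_nz _ N. rewrite Cminus_conj in N2 *. field. exact: N2. }
    have Hne : z0 <> a by apply: ne_center; lra.
    have Hin : Cmod (Cconj ((p0 + Cconj a * z0) / (- a + RtoC 1 * z0)) - a)%C < rho.
    { rewrite E // Cmod_reflection //. apply: (Rmult_lt_reg_r (Cmod (z0 - a)%C)); first lra.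
      have -> : rho ^ 2 / Cmod (z0 - a)%C * Cmod (z0 - a)%C = rho ^ 2 by field; lra. nra. }
    have Hden : (- a + RtoC 1 * z0)%C <> RtoC 0.
    { have -> : (- a + RtoC 1 * z0 = z0 - a)%C by ring. exact: Cminus_eq_contra. }
    have [l Hl] := conj_g_mobius p0 (Cconj a) (- a)%C (RtoC 1) z0 Hden Hin.
    exists l. apply: cdiff_derive. apply: (cdiff_ext_near _ _ _ _ (Cmod (z0 - a)%C) _ _ Hl); first lra.
    move=> z Hz. rewrite E //. apply: ne_center.
    have := Cmod_triangle (z0 - z)%C (z - a)%C. have -> : (z0 - z + (z - a) = z0 - a)%C by ring.
    have -> : Cmod (z0 - z)%C = Cmod (z - z0)%C by rewrite -Cmod_opp; congr Cmod; ring. lra.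
  - pose p1 := (RtoC (rho ^ 2) - Cconj a * a)%C.
    have D0 : (RtoC 1 + - a * RtoC 0)%C <> RtoC 0.
    { have -> : (RtoC 1 + - a * RtoC 0 = RtoC 1)%C by ring. exact: C1_nz. }
    have V0 : Cconj ((Cconj a + p1 * RtoC 0) / (RtoC 1 + - a * RtoC 0))%C = a.
    { have -> : ((Cconj a + p1 * RtoC 0) / (RtoC 1 + - a * RtoC 0) = Cconj a)%C by field; exact: C1_nz.
      exact: Cconj_conj. }
    have Hin : Cmod (Cconj ((Cconj a + p1 * RtoC 0) / (RtoC 1 + - a * RtoC 0)) - a)%C < rho.
    { rewrite V0. have -> : (a - a = RtoC 0)%C by ring. by rewrite Cmod_0. }
    have [l Hl] := conj_g_mobius (Cconj a) p1 (RtoC 1) (- a)%C (RtoC 0) D0 Hin.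
    exists l. apply: cdiff_derive.
    have Hd : 0 < / (1 + Cmod a) by apply: Rinv_0_lt_compat; have := Cmod_ge_0 a; lra.
    apply: (cdiff_ext_near _ _ _ _ _ Hd _ Hl) => w Hw.
    rewrite /sphere_inv. case: Ceq_dec => [->|Hw0] /=.
    { by rewrite V0 hga Cconj_RtoC. }
    congr Cconj; congr g.
    have Hw' : Cmod a * Cmod w < 1.
    { have Hw2 : Cmod w < / (1 + Cmod a) by have <- : (w - RtoC 0 = w)%C by ring.
      have A0 := Cmod_ge_0 a. have W0 := Cmod_ge_0 w.
      have F : (1 + Cmod a) * / (1 + Cmod a) = 1 by field; lra. nra. }
    have N : (RtoC 1 + - a * w)%C <> RtoC 0.
    { move=> E. have : (a * w = RtoC 1)%C by rewrite -(Cplus_0_l (a * w)%C) -E; ring.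
      move=> /(f_equal Cmod). rewrite Cmod_mult Cmod_1. lra. }
    have N1 : (/ w - a)%C <> RtoC 0.
    { move=> E. apply: N. transitivity ((/ w - a) * w)%C; [field; exact: Hw0 | rewrite E; ring]. }
    rewrite /reflection /p1.
    have -> : (RtoC (rho ^ 2) / Cconj (/ w - a) = Cconj (RtoC (rho ^ 2) / (/ w - a)))%C.
    { by rewrite Cdiv_conj // Cconj_RtoC. }
    rewrite -{5}(Cconj_conj a) -Cplus_conj; congr Cconj.
    field. split; first exact: Hw0. move=> E; apply: N; rewrite -E /=; ring.
Qed.
End Reflection.

(** The extension is the conjugate of [g] composed with the reflection; [g a = 0] gives
    the value 0 at infinity. *)
Lemma extension_outside (h : C -> C) a rho g : 0 < rho ->
  disc_extension (fun z => Cconj (h z)) a rho g -> g a = RtoC 0 ->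
  exists G, exterior_extension h a rho G.
Proof.
  move=> hrho hg hga. exists (reflected g a rho). split; [|split; [|split]] => //.
  - move=> z Hz; exact: reflected_circle.
  - exact: (reflected_cont h).
  - exact: (reflected_holo h).
Qed.

Theorem theorem1p1 (r1 r2 : R) (hr1 : (0 < r1)%R) (hr12 : (r1 < r2)%R)
  (f : C -> C)
  (hf : holder_on (annulus r1 r2) f)
  (hmean : forall (a : C) (rho : R),
     circle_around_0_in (annulus r1 r2) a rho ->
     circle_mean f a rho = RtoC 0) :
  exists fp fm : C -> C,
    (forall z : C, annulus r1 r2 z -> f z = (fp z + fm z)%C) /\
    holder_on (annulus r1 r2) fp /\
    holder_on (annulus r1 r2) fm /\
    forall (a : C) (rho : R),
      circle_around_0_in (annulus r1 r2) a rho ->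
      (exists g : C -> C, disc_extension fp a rho g) /\
      (exists g : sphere -> C, exterior_extension fm a rho g).
Proof.
  have [M [al Hf]] := holder_hol _ _ hf.
  have Hf' := hol_conj _ _ _ _ Hf.
  have hmean' a rho : circle_around_0_in (annulus r1 r2) a rho ->
    circle_mean (fun z => Cconj (f z)) a rho = RtoC 0.
  { move=> Ha. have C1 := cont_circle _ _ _ _ _ _ _ Hf Ha.
    transitivity (Cconj (avg (fun t => f (a + RtoC rho * cis t)%C))); first by rewrite -avg_conj.
    have -> : avg (fun t => f (a + RtoC rho * cis t)%C) = RtoC 0 := hmean a rho Ha. exact: Cconj_RtoC. }
  have [Mp Hp] := analytic_part_hol _ _ _ _ _ Hf.
  have [Mm Hm] := analytic_part_hol _ _ _ _ _ Hf'.
  exists (analytic_part f), (fun z => Cconj (analytic_part (fun w => Cconj (f w)) z)).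
  split; first exact: (decomposition _ _ _ _ _ hr1 Hf hmean).
  split; first exact: hol_holder Hp.
  split; first exact: hol_holder (hol_conj _ _ _ _ Hm).
  move=> a rho Ha. have [H0 [HA _]] := Ha. split.
  - have [g [Hg _]] := extension_into_disc _ _ _ _ a rho Hp H0 HA
      (fun n _ => analytic_part_mom _ _ _ _ _ hr1 hr12 Hf hmean n a rho Ha).
    by exists g.
  - have mom := fun n => analytic_part_mom _ _ _ _ _ hr1 hr12 Hf' hmean' n a rho Ha.
    have [g [Hg Hga]] := extension_into_disc _ _ _ _ a rho Hm H0 HA (fun n _ => mom n).
    apply: (extension_outside _ a rho g H0).
    + move: Hg => [A B]. split => // z Hz. by rewrite Cconj_conj A.
    + rewrite Hga -(mom O). apply: avg_ext => t; rewrite /=; ring.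
Qed.
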